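(* Let $c\in\{0,\ 1,\ 2\text{ nested},\ 2\text{ non nested},\ 3,\ 4\}$ and let $t$ be an odd integer such that $\max(3,2c+1)\le t\le 13$ (where in both cases ''$2$ nested'' and ''$2$ non nested'' one takes $c=2$ in the expression $2c+1$). Then the set $$\{f\in\mathrm{Sym}^4(\mathbb{R}^3)\ :\ f \text{ has } c \text{ ovals},\ \#\{\text{real eigenvectors of } f\}=t\}$$ has positive volume.
   Context: $\mathrm{Sym}^4(\mathbb{R}^3)$ denotes the real vector space of homogeneous polynomials of degree $4$ in three variables $x,y,z$ with real coefficients, identified with $\mathbb{R}^{15}$ via coefficients; volume means Lebesgue measure. A real eigenvector of $f$ is a nonzero vector $v\in\mathbb{R}^3$ such that $\nabla f(v)=\lambda v$ for some $\lambda\in\mathbb{R}$ ($\lambda=0$ is allowed); eigenvectors are counted up to nonzero real scalar multiples, i.e. as points of $\mathbb{P}^2(\mathbb{R})$. ''$f$ has $c$ ovals'' means: $f\neq 0$ and the real zero locus $\{f=0\}\subset\mathbb{P}^2(\mathbb{R})$ is the disjoint union of exactly $c$ ovals, where an oval is an embedded circle in $\mathbb{P}^2(\mathbb{R})$ whose complement is disconnected; the complement of an oval then has two components, one of which (its interior) is homeomorphic to an open disc and the other to an open Möbius band. Two disjoint ovals are nested if one of them is contained in the interior of the other, and non nested otherwise; ''$f$ has $2$ nested (resp. $2$ non nested) ovals'' means that $f$ has exactly two ovals and they are nested (resp. non nested). *)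

(* Defs.v *)
From HB Require Import structures.
From mathcomp Require Import all_boot all_order all_algebra.
From mathcomp Require Import all_classical all_reals all_analysis.
From mathcomp Require Import -(notations) mpoly.

Set Implicit Arguments.
Unset Strict Implicit.
Unset Printing Implicit Defensive.

Import Order.TTheory GRing.Theory Num.Theory.
Import numFieldNormedType.Exports.

Local Open Scope classical_set_scope.
Local Open Scope quotient_scope.
Local Open Scope ring_scope.

Definition punctured_space (R : realType) : set 'rV[R]_3 :=
  [set v | v != 0].
Arguments punctured_space : clear implicits.

Definition proportional (R : realType) : rel (punctured_space R) :=
  fun v w => `[< exists2 k : R, k != 0 & \val v = k *: \val w >].

Lemma proportional_equiv (R : realType) :
  equiv_class_of (@proportional R).
Proof.
split=> [v|v w|w v u].
- by apply/asboolP; exists 1; rewrite ?oner_neq0 ?scale1r.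
- apply: asbool_equiv_eq; split=> -[k k0 vw]; exists k^-1; rewrite ?invr_neq0//;
  by rewrite vw scalerA mulVf ?scale1r.
- move=> /asboolP[k k0 vw] /asboolP[l l0 wu]; apply/asboolP.
  by exists (k * l); rewrite ?mulf_neq0// -scalerA -wu.
Qed.

Canonical proportional_equiv_rel (R : realType) :=
  EquivRelPack (proportional_equiv R).

Definition RP2 (R : realType) : topologicalType :=
  quotient_topology {eq_quot (@proportional_equiv_rel R)}.

Definition proj_point (R : realType) (v : punctured_space R) : RP2 R :=
  \pi_({eq_quot (@proportional_equiv_rel R)}) v.

Definition homeomorphic_sets (T U : topologicalType) (A : set T) (B : set U) :=
  exists (f : A -> B) (g : B -> A),
    [/\ cancel f g, cancel g f, continuous f & continuous g].

Definition unit_circle (R : realType) : set (R * R) :=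
  [set p | p.1 ^+ 2 + p.2 ^+ 2 = 1].
Arguments unit_circle : clear implicits.

Definition open_disc (R : realType) : set (R * R) :=
  [set p | p.1 ^+ 2 + p.2 ^+ 2 < 1].
Arguments open_disc : clear implicits.

Definition oval (R : realType) (O : set (RP2 R)) :=
  homeomorphic_sets (unit_circle R) O /\ ~ connected (~` O).

(* The component of the complement of [O] that is an open disc; the other
   component of the complement of an oval is an open Moebius band. *)
Definition oval_interior (R : realType) (O : set (RP2 R)) : set (RP2 R) :=
  [set x | (~` O) x /\
     homeomorphic_sets (connected_component (~` O) x) (open_disc R)].

Definition nested (R : realType) (O1 O2 : set (RP2 R)) :=
  O1 `<=` oval_interior O2 \/ O2 `<=` oval_interior O1.

Definition quartic (R : realType) := mpoly.dhomog 3 R 4.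

Definition eval_at (R : realType) (p : mpoly.mpoly 3 R) (v : 'rV[R]_3) : R :=
  mpoly.meval (fun i => v 0 i) p.

Definition zero_locus (R : realType) (f : quartic R) : set (RP2 R) :=
  @proj_point R @` [set v | eval_at f (\val v) = 0].

Definition eigenpoints (R : realType) (f : quartic R) : set (RP2 R) :=
  @proj_point R @` [set v | exists lambda : R, forall i : 'I_3,
    eval_at (mpoly.mderiv i f) (\val v) = lambda * \val v 0 i].

Definition is_oval_decomposition (R : realType) (f : quartic R) (n : nat)
    (O : 'I_n -> set (RP2 R)) :=
  [/\ f != 0, forall i, oval (O i), trivIset setT O &
      zero_locus f = \bigcup_i O i].

Inductive arrangement :=
  | NoOval | OneOval | TwoNested | TwoNonNested | ThreeOvals | FourOvals.

Definition nb_ovals (c : arrangement) : nat :=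
  match c with
  | NoOval => 0 | OneOval => 1 | TwoNested => 2 | TwoNonNested => 2
  | ThreeOvals => 3 | FourOvals => 4
  end.

Definition has_ovals (R : realType) (c : arrangement) (f : quartic R) :=
  exists O : 'I_(nb_ovals c) -> set (RP2 R),
    is_oval_decomposition f O /\
    match c with
    | TwoNested => forall i j, i != j -> nested (O i) (O j)
    | TwoNonNested => forall i j, i != j -> ~ nested (O i) (O j)
    | _ => True
    end.

(* The exponents of the 15 monomials x^(4-i) y^(i-j) z^j, 0 <= j <= i <= 4. *)
Definition quartic_monomials : 15.-tuple (mpoly.multinom 3) :=
  @Tuple 15 _ [seq mpoly.Multinom [tuple (4 - i)%N; (i - j)%N; j]
                 | i <- iota 0 5, j <- iota 0 i.+1] isT.

Definition coefficients (R : realType) (f : quartic R) : 15.-tuple R :=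
  [tuple mpoly.mcoeff (tnth quartic_monomials k) (f : mpoly.mpoly 3 R)
     | k < 15].

(* Lebesgue measure on the Borel sets of R^n, as the n-fold product of the
   Lebesgue measure on R. *)
Fixpoint lebesgue_tuple (R : realType) (n : nat) : set (n.-tuple R) -> \bar R :=
  match n with
  | 0%N => \d_([tuple] : 0.-tuple R)
  | m.+1 => fun A => (\int[@lebesgue_measure R]_x
      lebesgue_tuple [set y : m.-tuple R | A [tuple of x :: y]])%E
  end.

(* [lebesgue_tuple] is meaningful on Borel sets only; a set has positive volume
   when it contains a Borel set of positive measure, which for a Lebesgue
   measurable set says exactly that its Lebesgue measure is positive. *)
Definition positive_volume (R : realType) (S : set (quartic R)) :=
  exists B : set (15.-tuple R),
    [/\ measurable B, B `<=` @coefficients R @` S & (0 < lebesgue_tuple B)%E].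

(* Main.v *)
Require Import Defs.
From HB Require Import structures.
From mathcomp Require Import all_boot all_order all_algebra.
From mathcomp Require Import all_classical all_reals all_analysis.
From mathcomp Require Import -(notations) mpoly.
From mathcomp Require Import ring lra.

(** It suffices to exhibit, for each arrangement and each admissible t, one quartic form
    around which the arrangement of ovals and the number of eigenpoints do not change,
    because a neighbourhood in the space of coefficients contains a cube
    ([positive_volume_nbhs], [realizedP]).

    The eigenvectors of f are the critical points of f on the unit sphere. If all of them are
    nondegenerate, each one persists under perturbation, by a Newton iteration in an
    affine chart ([local_root], [eigen_persist]), and none is created elsewhere since the
    sphere is compact. So the number of eigenpoints is locally constant there
    ([stable_count]).

    Non nested ovals come from a nonnegative form g with finitely many zeros, all
    nondegenerate. For small e > 0 the form g - e |v|^4 has one small oval around each zero of g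
    and no other real zero, and this persists nearby ([stable_ovals], [realized_psd]). An oval
    is constructed as the unit sphere of a gauge in an affine chart: on each ray from the
    zero there is exactly one point of the curve. Two of these ovals are not nested because
    through each one there is a projective line that misses the other, and an open disc
    does not contain a projective line ([line_not_disc]): the line does not lift to a
    closed loop of vectors, whereas a loop that contracts does. Two nested ovals come
    from forms that are positive at a point p and at infinity and negative on a circle around p,
    with a convexity condition on each ray from p ([nested_ovals]).

    Most of the forms needed are even, f = q(x^2, y^2, z^2) with q a quadratic form. Their
    eigenvectors solve linear systems in the squares of the coordinates: the three
    coordinate points are always eigenpoints, each coordinate line contributes two more
    or none, and the points off these lines are four or none ([even_count]). The
    number ranges over the odd integers from 3 to 13. Nonnegative forms q(x^2, y^2, z^2)
    with up to four zeros, and forms with two nested ovals around (0, 0, 1), realize all pairs but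
    three: two nested ovals with 5 eigenpoints, three ovals with 7 and four ovals with 9. For
    these pairs explicit forms that are even in y only are analysed by elimination. *)

Set Implicit Arguments.
Unset Strict Implicit.
Unset Printing Implicit Defensive.

Import Order.TTheory GRing.Theory Num.Theory.
Import numFieldNormedType.Exports.

Local Open Scope classical_set_scope.
Local Open Scope ring_scope.

(** * Quartic forms in coordinates *)

Section forms.
Context {R : realType}.
Implicit Types (c : 'rV[R]_15) (x y z : R) (v : 'rV[R]_3).

Definition cf c (k : nat) : R := c 0 (inord k).

Definition qform c x y z : R :=
  cf c 0 * x ^+ 4 + cf c 1 * (x ^+ 3 * y) + cf c 2 * (x ^+ 3 * z)
  + cf c 3 * (x ^+ 2 * y ^+ 2) + cf c 4 * (x ^+ 2 * y * z)
  + cf c 5 * (x ^+ 2 * z ^+ 2) + cf c 6 * (x * y ^+ 3)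
  + cf c 7 * (x * y ^+ 2 * z) + cf c 8 * (x * y * z ^+ 2)
  + cf c 9 * (x * z ^+ 3) + cf c 10 * y ^+ 4 + cf c 11 * (y ^+ 3 * z)
  + cf c 12 * (y ^+ 2 * z ^+ 2) + cf c 13 * (y * z ^+ 3) + cf c 14 * z ^+ 4.

Definition qx c x y z : R :=
  4 * cf c 0 * x ^+ 3 + 3 * cf c 1 * (x ^+ 2 * y) + 3 * cf c 2 * (x ^+ 2 * z)
  + 2 * cf c 3 * (x * y ^+ 2) + 2 * cf c 4 * (x * y * z)
  + 2 * cf c 5 * (x * z ^+ 2) + cf c 6 * y ^+ 3
  + cf c 7 * (y ^+ 2 * z) + cf c 8 * (y * z ^+ 2) + cf c 9 * z ^+ 3.

Definition qy c x y z : R :=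
  cf c 1 * x ^+ 3 + 2 * cf c 3 * (x ^+ 2 * y) + cf c 4 * (x ^+ 2 * z)
  + 3 * cf c 6 * (x * y ^+ 2) + 2 * cf c 7 * (x * y * z)
  + cf c 8 * (x * z ^+ 2) + 4 * cf c 10 * y ^+ 3
  + 3 * cf c 11 * (y ^+ 2 * z) + 2 * cf c 12 * (y * z ^+ 2)
  + cf c 13 * z ^+ 3.

Definition qz c x y z : R :=
  cf c 2 * x ^+ 3 + cf c 4 * (x ^+ 2 * y) + 2 * cf c 5 * (x ^+ 2 * z)
  + cf c 7 * (x * y ^+ 2) + 2 * cf c 8 * (x * y * z)
  + 3 * cf c 9 * (x * z ^+ 2) + cf c 11 * y ^+ 3
  + 2 * cf c 12 * (y ^+ 2 * z) + 3 * cf c 13 * (y * z ^+ 2)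
  + 4 * cf c 14 * z ^+ 3.

Definition ev c v : R := qform c (v 0 0) (v 0 1) (v 0 2).

Definition grad c v : 'rV[R]_3 :=
  \row_i [tuple qx c (v 0 0) (v 0 1) (v 0 2); qy c (v 0 0) (v 0 1) (v 0 2);
                qz c (v 0 0) (v 0 1) (v 0 2)]`_i.

Definition poly_of_coef c : mpoly.mpoly 3 R :=
  \sum_(k < 15) c 0 k *: mpoly.mpolyX R (tnth quartic_monomials k).

Lemma poly_of_coef_homog c :
  poly_of_coef c \is @mpoly.ishomog1 3 R 4 mpoly.mdeg.
Proof.
apply: (big_ind (fun p => p \is @mpoly.ishomog1 3 R 4 mpoly.mdeg)).
- exact: mpoly.dhomog0.
- by move=> p q; apply: mpoly.dhomogD.
move=> k _; apply: mpoly.dhomogZ; rewrite mpoly.dhomogX.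
have /allP : all (fun m => mpoly.mdeg m == 4%N) quartic_monomials.
  by rewrite /= !mpoly.mdegE !big_ord_recl !big_ord0.
apply; exact: mem_tnth.
Qed.

Definition quartic_of c : quartic R := mpoly.DHomog (poly_of_coef_homog c).

Lemma coefficients_quartic_of (t : 15.-tuple R) :
  coefficients (quartic_of (\row_k tnth t k)) = t.
Proof.
apply: eq_from_tnth => j; rewrite tnth_mktuple/= /poly_of_coef raddf_sum/=.
rewrite (bigD1 j)//= mpoly.mcoeffZ mpoly.mcoeffX eqxx mulr1 mxE big1 ?addr0//.
move=> k kj; rewrite mpoly.mcoeffZ mpoly.mcoeffX.
rewrite (inj_eq (tuple_uniqP _ _)) ?(negbTE kj) ?mulr0//.
Qed.

Definition mon (a b d : nat) : mpoly.multinom 3 := mpoly.Multinom [tuple a; b; d].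

Lemma sum_quartic_monomials c (G : mpoly.multinom 3 -> R) :
  \sum_(k < 15) c 0 k * G (tnth quartic_monomials k) =
  cf c 0 * G (mon 4 0 0) + (cf c 1 * G (mon 3 1 0) + (cf c 2 * G (mon 3 0 1)
  + (cf c 3 * G (mon 2 2 0) + (cf c 4 * G (mon 2 1 1) + (cf c 5 * G (mon 2 0 2)
  + (cf c 6 * G (mon 1 3 0) + (cf c 7 * G (mon 1 2 1) + (cf c 8 * G (mon 1 1 2)
  + (cf c 9 * G (mon 1 0 3) + (cf c 10 * G (mon 0 4 0) + (cf c 11 * G (mon 0 3 1)
  + (cf c 12 * G (mon 0 2 2) + (cf c 13 * G (mon 0 1 3)
  + cf c 14 * G (mon 0 0 4)))))))))))))).
Proof.
under eq_bigr => k _.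
  rewrite (tnth_nth (mon 0 0 0)) -[X in c 0 X]inord_val -/(cf c _); over.
rewrite -(big_mkord xpredT
  (fun k => cf c k * G (nth (mon 0 0 0) quartic_monomials k))).
by rewrite unlock /= addr0.
Qed.

Lemma meval_mon v (a b d : nat) :
  mpoly.meval (fun i => v 0 i) (mpoly.mpolyX R (mon a b d)) =
  v 0 0 ^+ a * v 0 1 ^+ b * v 0 2 ^+ d.
Proof.
rewrite mpoly.mevalX !big_ord_recl big_ord0 mulr1 mulrA.
by congr (v 0 _ ^+ _ * v 0 _ ^+ _ * v 0 _ ^+ _); apply: val_inj.
Qed.

Lemma eval_quartic_of c v : eval_at (quartic_of c) v = ev c v.
Proof.
rewrite /eval_at /= /poly_of_coef raddf_sum/= /ev.
under eq_bigr do rewrite mpoly.mevalZ.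
rewrite (sum_quartic_monomials c
  (fun m => mpoly.meval (fun i => v 0 i) (mpoly.mpolyX R m))) !meval_mon.
rewrite /qform; ring.
Qed.

Lemma mderiv_mon (i : 'I_3) (a b d : nat) :
  mpoly.mderiv i (mpoly.mpolyX R (mon a b d)) =
  (nth 0%N [tuple a; b; d] i)%:R *: mpoly.mpolyX R
     (mon (a - (i == 0)%R) (b - (i == 1)%R) (d - (i == 2)%R)).
Proof.
rewrite mpoly.mderivX; congr (_%:R *: mpoly.mpolyX R _).
  by rewrite /= -(tnth_nth 0%N).
apply/mpoly.mnmP => j; rewrite mpoly.mnmBE mpoly.mnm1E.
by case: j => -[|[|[|//]]] j3; rewrite /mon /mpoly.fun_of_multinom !(tnth_nth 0%N).
Qed.

Lemma eval_mderiv_quartic_of c v (i : 'I_3) :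
  eval_at (mpoly.mderiv i (quartic_of c)) v = grad c v 0 i.
Proof.
rewrite /eval_at /= /poly_of_coef mxE.
rewrite (big_morph _ (@mpoly.mderivD _ _ i) (@mpoly.mderiv0 _ _ i)) raddf_sum/=.
under eq_bigr do rewrite mpoly.mderivZ mpoly.mevalZ.
rewrite (sum_quartic_monomials c
  (fun m => mpoly.meval (fun i => v 0 i) (mpoly.mderiv i (mpoly.mpolyX R m)))).
rewrite !mderiv_mon !mpoly.mevalZ !meval_mon.
by case: i => -[|[|[|//]]] i3 /=; rewrite /qx /qy /qz; ring.
Qed.

Lemma eq_quartic_of0 c : quartic_of c = 0 -> c = 0.
Proof.
move=> /(congr1 (@coefficients R)) c0; apply/rowP => k.
move: c0; rewrite [X in quartic_of X](_ : c = \row_k tnth [tuple c 0 k | k < 15] k).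
  rewrite coefficients_quartic_of => /(congr1 (fun t => tnth t k)).
  by rewrite !tnth_mktuple mpoly.mcoeff0 mxE.
by apply/rowP => j; rewrite mxE tnth_mktuple.
Qed.

End forms.

(** * Volume of open sets of quartics *)

Section volume.
Context {R : realType}.

Lemma lebesgue_tuple0 n : @lebesgue_tuple R n set0 = 0%E.
Proof.
case: n => [|n] /=; first by rewrite diracE in_set0.
elim: n => [|n IHn]; under eq_integral => x _.
- rewrite (_ : [set y | _] = set0); last by apply/seteqP; split.
  rewrite /= diracE in_set0; over.
- by rewrite integral_cst ?mul0e.
- rewrite (_ : [set y | _] = set0); last by apply/seteqP; split.
  rewrite /= IHn; over.
- by rewrite integral_cst ?mul0e.
Qed.

Definition cube n (a : n.-tuple R) (e : R) : set (n.-tuple R) :=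
  [set t | forall k, ball (tnth a k) e (tnth t k)].

Lemma measurable_cube n (a : n.-tuple R) e : measurable (cube a e).
Proof.
rewrite (_ : cube a e =
  \bigcap_(k in [set: 'I_n]) ((fun t => tnth t k) @^-1` ball (tnth a k) e)).
  apply: fin_bigcap_measurable => // k _.
  rewrite -[X in measurable X]setTI; apply: measurable_tnth => //.
  exact: measurable_realfun.measurable_ball.
by apply/seteqP; split => [t ta k _|t ta k]; exact: ta.
Qed.

(** Each slice of a cube by its first coordinate is a cube or empty, so the iterated
    integral is a product. *)
Lemma lebesgue_tuple_cube n (a : n.-tuple R) (e : R) : 0 <= e ->
  lebesgue_tuple (cube a e) = ((e *+ 2) ^+ n)%:E.
Proof.
move=> e0; elim: n a => [|n IHn] a.
  rewrite /= diracE mem_set ?expr0// => -[].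
  by [].
rewrite /=.
transitivity (\int[@lebesgue_measure R]_(x in ball (tnth a ord0) e)
   cst ((e *+ 2) ^+ n)%:E x)%E.
  rewrite [RHS]integral_mkcond; apply: eq_integral => x _.
  rewrite patchE; case: ifPn => [|] xa.
    rewrite -(IHn [tuple of behead a]); congr lebesgue_tuple.
    apply/seteqP; split => y /= ya k.
      have := ya (lift ord0 k).
      by rewrite !(tnth_nth 0) /= nth_behead.
    case: (unliftP ord0 k) => [j|] ->; last by move: xa; rewrite inE /= !(tnth_nth 0).
    by have := ya j; rewrite !(tnth_nth 0) /= nth_behead.
  rewrite (_ : [set y | _] = set0) ?lebesgue_tuple0//.
  apply/seteqP; split => // y /= /(_ ord0).
  by rewrite [tnth (cons_tuple _ _) _](tnth_nth 0)/= => /mem_set; rewrite (negbTE xa).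
rewrite integral_cst; last exact: measurable_realfun.measurable_ball.
transitivity (((e *+ 2) ^+ n)%:E * (e *+ 2)%:E)%E.
  by congr (_ * _)%E; exact: lebesgue_measure_ball.
by rewrite -EFinM -exprSr.
Qed.

(** A neighbourhood for the sup norm on coefficients contains a cube. *)
Lemma positive_volume_nbhs (S : set (quartic R)) (c : 'rV[R]_15) :
  (\forall d \near c, S (quartic_of d)) -> positive_volume S.
Proof.
move=> /nbhs_ballP[e /= e0 ce]; exists (cube [tuple c 0 k | k < 15] e); split.
- exact: measurable_cube.
- move=> t ta; exists (quartic_of (\row_k tnth t k)).
    apply: ce; split => // i j; rewrite mxE ord1; have := ta j.
    by rewrite tnth_mktuple.
  exact: coefficients_quartic_of.
- by rewrite lebesgue_tuple_cube ?ltW// lte_fin exprn_gt0// mulrn_wgt0.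
Qed.

End volume.

Local Open Scope quotient_scope.

(** * Continuity of polynomial expressions *)
Section continuity.
Context {R : realType} {T : topologicalType}.
Implicit Types (f g : T -> R) (x : T).

Lemma ctsD f g x : {for x, continuous f} -> {for x, continuous g} ->
  {for x, continuous (fun y => f y + g y)}.
Proof. exact: cvgD. Qed.

Lemma ctsN f x : {for x, continuous f} -> {for x, continuous (fun y => - f y)}.
Proof. exact: cvgN. Qed.

Lemma ctsM f g x : {for x, continuous f} -> {for x, continuous g} ->
  {for x, continuous (fun y => f y * g y)}.
Proof. exact: cvgM. Qed.

Lemma ctsX f n x : {for x, continuous f} ->
  {for x, continuous (fun y => f y ^+ n)}.
Proof.
move=> cf; exact: (@continuous_comp _ _ _ f (fun z => z ^+ n) x cf
  (@exprn_continuous _ n (f x))).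
Qed.

Lemma ctsV f x : {for x, continuous f} -> f x != 0 ->
  {for x, continuous (fun y => (f y)^-1)}.
Proof. by move=> cf f0; exact: cvgV. Qed.

Lemma cts_cst (U : topologicalType) (a : U) x : {for x, continuous (fun=> a)}.
Proof. exact: cvg_cst. Qed.

Lemma cts_pair (U V : topologicalType) (f : T -> U) (g : T -> V) x :
  {for x, continuous f} -> {for x, continuous g} ->
  {for x, continuous (fun y => (f y, g y))}.
Proof.
move=> cf cg.
exact: (@cvg_pair _ _ _ (nbhs x) (nbhs (f x)) (nbhs (g x)) _ _ _ f g cf cg).
Qed.

Lemma cts_fst (U V : topologicalType) (f : T -> U * V) x :
  {for x, continuous f} -> {for x, continuous (fun y => (f y).1)}.
Proof.
by move=> cf; apply: (@continuous_comp _ _ _ f fst x cf); exact: cvg_fst.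
Qed.

Lemma cts_snd (U V : topologicalType) (f : T -> U * V) x :
  {for x, continuous f} -> {for x, continuous (fun y => (f y).2)}.
Proof.
by move=> cf; apply: (@continuous_comp _ _ _ f snd x cf); exact: cvg_snd.
Qed.

Lemma cts_coord m n (f : T -> 'M[R]_(m, n)) i j x :
  {for x, continuous f} -> {for x, continuous (fun y => f y i j)}.
Proof.
move=> cf; apply: (@continuous_comp _ _ _ f (fun M : 'M[R]_(m, n) => M i j) x cf).
exact: coord_continuous.
Qed.

Lemma cts_mx m n (f : T -> 'M[R]_(m.+1, n.+1)) x :
  (forall i j, {for x, continuous (fun y => f y i j)}) ->
  {for x, continuous f}.
Proof.
move=> cf; apply/cvg_ballP => e e0.
have : \forall y \near x, forall i j, ball (f x i j) e (f y i j).
  apply: filter_forall => i; apply: filter_forall => j.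
  by have /cvg_ballP/(_ e e0) := cf i j.
by apply: filterS => y fy; split.
Qed.

Lemma cts_lt f g x : {for x, continuous f} -> {for x, continuous g} ->
  f x < g x -> \forall y \near x, f y < g y.
Proof.
move=> cf cg fg; near=> y; rewrite -subr_gt0; near: y.
have cfg : {for x, continuous (fun y => g y + - f y)} by apply: ctsD => //; exact: ctsN.
by move/cvgr_gt : cfg; apply; rewrite subr_gt0.
Unshelve. all: by end_near. Qed.

Lemma cts_neq0 f x : {for x, continuous f} -> f x != 0 ->
  \forall y \near x, f y != 0.
Proof.
move=> cf; rewrite neq_lt => /orP[f0|f0].
  have := @cts_lt f (fun=> 0) x cf (@cts_cst _ 0 _) f0.
  by apply: filterS => y /lt_eqF/negbT.
have := @cts_lt (fun=> 0) f x (@cts_cst _ 0 _) cf f0.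
by apply: filterS => y /gt_eqF/negbT.
Qed.

End continuity.

(** Structural continuity of functions given as lambda terms. The component functions
    are passed explicitly to avoid higher-order unification. *)
Ltac cts :=
  lazymatch goal with
  | |- prop_for _ (inPhantom (continuous ?F)) =>
    lazymatch F with
    | (fun _ => ?cts_a) => exact: (@cts_cst _ _ cts_a)
    | (fun y => y) => exact: cvg_id
    | (fun y => (@?cts_f y + @?cts_g y)%R) => apply: (@ctsD _ _ cts_f cts_g); cts
    | (fun y => (- @?cts_f y)%R) => apply: (@ctsN _ _ cts_f); cts
    | (fun y => (@?cts_f y * @?cts_g y)%R) => apply: (@ctsM _ _ cts_f cts_g); cts
    | (fun y => (@?cts_f y ^+ ?n)%R) => apply: (@ctsX _ _ cts_f n); cts
    | (fun y => (@?cts_f y, @?cts_g y)) =>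
        apply: (@cts_pair _ _ _ cts_f cts_g); cts
    | (fun y => (@?cts_f y).1) => apply: (@cts_fst _ _ _ cts_f); cts
    | (fun y => (@?cts_f y).2) => apply: (@cts_snd _ _ _ cts_f); cts
    | (fun y => fun_of_matrix (@?cts_f y) ?i ?j) =>
        apply: (@cts_coord _ _ _ _ cts_f i j); cts
    | _ => try assumption
    end
  end.

(** * The projective plane *)
Section projective_plane.
Context {R : realType}.
Implicit Types (v w : 'rV[R]_3) (x : RP2 R) (U : set (RP2 R)).

Lemma row1_neq0 : (const_mx 1 : 'rV[R]_3) \in punctured_space R.
Proof.
by apply/mem_set/eqP => /rowP/(_ 0); rewrite !mxE => /eqP; rewrite oner_eq0.
Qed.

Definition punctured v : punctured_space R :=
  insubd (exist (fun w => w \in punctured_space R) _ row1_neq0 : punctured_space R) v.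

Lemma puncturedK v : v != 0 -> \val (punctured v) = v.
Proof. by move=> v0; rewrite /punctured insubdK// unfold_in; apply/mem_set. Qed.

Lemma val_punctured_neq0 (v : punctured_space R) : \val v != 0.
Proof. exact: set_mem (valP v). Qed.

Definition pt v : RP2 R := proj_point (punctured v).

Lemma proj_pointE (v : punctured_space R) : proj_point v = pt (\val v).
Proof.
by congr proj_point; apply: val_inj; rewrite puncturedK// val_punctured_neq0.
Qed.

Lemma pt_eqP v w : v != 0 -> w != 0 ->
  pt v = pt w <-> exists2 k, k != 0 & v = k *: w.
Proof.
move=> v0 w0.
have -> : (pt v = pt w) <-> proportional (punctured v) (punctured w).
  by split=> [/eqquotP|h]; [|apply/eqquotP].
by split=> [/asboolP|h]; [|apply/asboolP]; rewrite !puncturedK.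
Qed.

Lemma ptZ k v : k != 0 -> v != 0 -> pt (k *: v) = pt v.
Proof. by move=> k0 v0; apply/pt_eqP => //; [rewrite scaler_eq0 negb_or k0|exists k]. Qed.

Lemma pt_surj x : exists2 v, v != 0 & x = pt v.
Proof.
exists (\val (repr x)); first exact: val_punctured_neq0.
by rewrite -proj_pointE /proj_point reprK.
Qed.

Lemma image_proj_point (P : set 'rV[R]_3) :
  @proj_point R @` [set v | P (\val v)] = [set x | exists v, [/\ v != 0, P v & x = pt v]].
Proof.
apply/seteqP; split => [_ [v Pv <-]|_ [v [v0 Pv ->]]].
  by exists (\val v); split=> //; [exact: val_punctured_neq0|exact: proj_pointE].
by exists (punctured v) => //=; rewrite puncturedK.
Qed.

Lemma nbhs_neq0 v : v != 0 -> nbhs v [set w | w != 0].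
Proof.
move=> v0; apply: open_nbhs_nbhs; split=> //.
have -> : [set w : 'rV[R]_3 | w != 0] = ~` [set 0].
  by apply/seteqP; split=> w /= /eqP.
exact/closed_openC/accessible_closed_set1/hausdorff_accessible/norm_hausdorff.
Qed.

Lemma open_RP2 U : open U <-> forall v, v != 0 -> U (pt v) -> nbhs v (U \o pt).
Proof.
split.
  move=> [A oA AU] v v0 Uv.
  have Av : A v.
    have : (val @^-1` A) (punctured v) by rewrite AU.
    by rewrite /= puncturedK.
  apply: filterS (filterI (open_nbhs_nbhs (conj oA Av)) (nbhs_neq0 v0)) => w [Aw w0].
  have : (val @^-1` A) (punctured w) by rewrite /= puncturedK.
  by rewrite AU.
move=> oU; exists [set v | v != 0 /\ U (pt v)].
  rewrite openE => v [v0 Uv]; apply: filterS (filterI (nbhs_neq0 v0) (oU v v0 Uv)).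
  by move=> w [].
apply/seteqP; split => v /=; rewrite -proj_pointE; first by case.
by split=> //; exact: val_punctured_neq0.
Qed.

Lemma nbhs_scale k v (A : set 'rV[R]_3) : k != 0 ->
  nbhs (k *: v) A -> nbhs v [set w | A (k *: w)].
Proof. by move=> k0 /(@scaler_continuous _ _ k v). Qed.

(** Scaling is a homeomorphism, so the projection from nonzero vectors is open. *)
Lemma nbhs_pt v U : v != 0 -> nbhs (pt v) U <-> nbhs v (U \o pt).
Proof.
move=> v0; split.
  rewrite nbhsE => -[A [/open_RP2 oA Av] AU].
  by apply: filterS (oA _ v0 Av) => w; exact: AU.
move=> vU; rewrite nbhsE.
exists [set x | exists w, [/\ w != 0, nbhs w (U \o pt) & x = pt w]]; last first.
  by move=> _ [w [w0 wU ->]]; exact: nbhs_singleton wU.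
split; last by exists v.
apply/open_RP2 => w w0 [w' [w'0 w'U /(pt_eqP w0 w'0)[k k0 ww']]].
have {w'U} : nbhs w' [set z : 'rV[R]_3 | z != 0 /\ nbhs z (U \o pt)].
  exact: filterI (nbhs_neq0 w'0) (nbhs_interior w'U).
have -> : w' = k^-1 *: w by rewrite ww' scalerA mulVf// scale1r.
move=> /(nbhs_scale (invr_neq0 k0)); apply: filterS => z [kz0 zU].
have z0 : z != 0 by apply: contraNneq kz0 => ->; rewrite scaler0.
by exists (k^-1 *: z); split=> //; rewrite ptZ// invr_neq0.
Qed.

End projective_plane.

(** * Gauges of star-shaped plane regions *)
Section gauges.
Context {R : realType}.
Implicit Types (u w : R * R) (s t : R).

Definition scl s u : R * R := (s * u.1, s * u.2).
Definition enorm u : R := Num.sqrt (u.1 ^+ 2 + u.2 ^+ 2).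

Lemma scl1 u : scl 1 u = u. Proof. by case: u => a b; rewrite /scl !mul1r. Qed.
Lemma scl0 u : scl 0 u = (0, 0). Proof. by rewrite /scl !mul0r. Qed.
Lemma sclr0 s : scl s (0, 0) = (0, 0). Proof. by rewrite /scl !mulr0. Qed.
Lemma sclA s t u : scl s (scl t u) = scl (s * t) u.
Proof. by rewrite /scl !mulrA. Qed.

Lemma enorm_ge0 u : 0 <= enorm u. Proof. exact: sqrtr_ge0. Qed.
Lemma enorm_scl s u : enorm (scl s u) = `|s| * enorm u.
Proof.
rewrite /enorm /= !exprMn -mulrDr sqrtrM ?sqr_ge0//.
by rewrite sqrtr_sqr.
Qed.
Lemma enorm_eq0 u : (enorm u == 0) = (u == (0, 0)).
Proof.
case: u => a b; rewrite sqrtr_eq0 /= xpair_eqE.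
rewrite le_eqVlt ltNge addr_ge0 ?sqr_ge0// orbF.
by rewrite paddr_eq0 ?sqr_ge0// !sqrf_eq0.
Qed.
Lemma enorm_gt0 u : (0 < enorm u) = (u != (0, 0)).
Proof. by rewrite lt0r enorm_eq0 enorm_ge0 andbT. Qed.

Lemma unit_dir u : u != (0, 0) -> exists2 w, enorm w = 1 & u = scl (enorm u) w.
Proof.
move=> u0; have e0 : enorm u != 0 by rewrite enorm_eq0.
exists (scl (enorm u)^-1 u).
  by rewrite enorm_scl ger0_norm ?invr_ge0 ?enorm_ge0// mulVf.
by rewrite sclA divff// scl1.
Qed.

Lemma continuous_scl (T : topologicalType) (f : T -> R) (g : T -> R * R) x :
  {for x, continuous f} -> {for x, continuous g} ->
  {for x, continuous (fun y => scl (f y) (g y))}.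
Proof. by move=> cf cg; rewrite /scl; cts. Qed.

Lemma continuous_enorm : continuous enorm.
Proof.
move=> u; apply: (@continuous_comp _ _ _ (fun u : R * R => u.1 ^+ 2 + u.2 ^+ 2)).
  by cts.
exact: sqrt_continuous.
Qed.

Lemma unit_circle_enorm : unit_circle R = [set u | enorm u = 1].
Proof.
apply/seteqP; split => u; rewrite /unit_circle /enorm /=.
  by move=> ->; exact: sqrtr1.
by move=> /(congr1 (fun x => x ^+ 2)); rewrite sqr_sqrtr ?expr1n// addr_ge0 ?sqr_ge0.
Qed.

Lemma open_disc_enorm : open_disc R = [set u | enorm u < 1].
Proof.
have e u : (enorm u < 1) = (u.1 ^+ 2 + u.2 ^+ 2 < 1).
  by rewrite -[1 in LHS]sqrtr1 /enorm ltr_sqrt.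
by apply/seteqP; split => u; rewrite /open_disc /= e.
Qed.

Lemma compact_unit_circle : compact (unit_circle R).
Proof.
have K : compact (`[-1, 1]%classic `*` `[-1, 1]%classic : set (R * R)).
  by apply: compact_setX; exact: segment_compact.
apply: (subclosed_compact _ K).
  rewrite unit_circle_enorm (_ : [set u | _] = enorm @^-1` [set 1])//.
  move/continuous_closedP: continuous_enorm; apply.
  exact/accessible_closed_set1/hausdorff_accessible/norm_hausdorff.
move=> [a b]; rewrite /unit_circle /= !in_itv /= => ab.
by split; apply/andP; split; nra.
Qed.

(** A gauge is an asymmetric norm; the boundary of its unit ball meets each ray
    from the origin exactly once. *)
Definition gauge (N : R * R -> R) :=
  [/\ continuous N, forall s u, 0 <= s -> N (scl s u) = s * N u &
      forall u, u != (0, 0) -> 0 < N u].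

Lemma gauge0 N : gauge N -> N (0, 0) = 0.
Proof. by move=> [_ hN _]; rewrite -(scl0 (0,0)) hN// mul0r. Qed.

Lemma gauge_ge0 N u : gauge N -> 0 <= N u.
Proof.
move=> gN; have [->|u0] := eqVneq u (0, 0); first by rewrite (gauge0 gN).
by case: gN => _ _ /(_ u u0)/ltW.
Qed.

Lemma gauge_enorm : gauge enorm.
Proof.
split; first exact: continuous_enorm.
  by move=> s u s0; rewrite enorm_scl ger0_norm.
by move=> u; rewrite enorm_gt0.
Qed.

Lemma gauge_bound N : gauge N ->
  exists2 m, 0 < m & forall u, m * enorm u <= N u.
Proof.
move=> gN; have [cN hN N0] := gN.
have [m [m0 mN]] : exists m, 0 < m /\ unit_circle R `<=` [set u | m < N u].
  have := compact_unit_circle; move/compact_near_coveringP => nc.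
  have : \forall m \near (0 : R)^'+, unit_circle R `<=` (fun u => m < N u).
    apply: (nc _ _ (fun m u => m < N u)) => u cu.
    have Nu : 0 < N u.
      by apply: N0; move: cu; rewrite unit_circle_enorm -enorm_gt0 /= => ->.
    have H : \forall u' \near u, N u / 2 < N u'.
      apply: (@cts_lt _ _ (fun=> N u / 2) N u _ (cN u)); first exact: cts_cst.
      by rewrite /= ltr_pdivrMr// mulr_natr mulr2n ltrDl.
    near=> u' m => /=; apply: (@lt_trans _ _ (N u / 2)).
      by near: m; apply: nbhs_right_lt; exact: divr_gt0.
    by near: u'.
  move=> H; near (0 : R)^'+ => m; exists m; split => //.
  by near: m.
exists m => // u; have [->|u0] := eqVneq u (0, 0).
  by rewrite (gauge0 gN) (gauge0 gauge_enorm) mulr0.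
have e0 : 0 < enorm u by rewrite enorm_gt0.
have /= := mN (scl (enorm u)^-1 u).
rewrite hN ?invr_ge0 ?enorm_ge0//= ltr_pdivlMl// mulrC => h; apply/ltW/h.
rewrite unit_circle_enorm /= enorm_scl ger0_norm ?invr_ge0 ?enorm_ge0//.
by rewrite mulVf// gt_eqF.
Unshelve. all: by end_near. Qed.

(** The radial homeomorphism between the unit balls of two gauges. *)
Definition gauge_map (N1 N2 : R * R -> R) u := scl (N1 u / N2 u) u.

Lemma gauge_mapE N1 N2 u : gauge N1 -> gauge N2 -> N2 (gauge_map N1 N2 u) = N1 u.
Proof.
move=> g1 g2; have [_ h2 p2] := g2.
rewrite /gauge_map h2 ?divr_ge0 ?gauge_ge0//.
have [->|u0] := eqVneq u (0, 0); first by rewrite (gauge0 g1) !mul0r.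
by rewrite divfK// gt_eqF// p2.
Qed.

Lemma gauge_mapK N1 N2 : gauge N1 -> gauge N2 ->
  cancel (gauge_map N1 N2) (gauge_map N2 N1).
Proof.
move=> g1 g2 u; have [->|u0] := eqVneq u (0, 0).
  by rewrite /gauge_map !sclr0.
rewrite {1}/gauge_map gauge_mapE// /gauge_map sclA.
have [_ h1 p1] := g1; have [_ _ p2] := g2.
rewrite h1 ?divr_ge0 ?gauge_ge0// -[RHS]scl1; congr (scl _ _).
have := p1 u u0; have := p2 u u0 => /gt_eqF/negbT ? /gt_eqF/negbT ?.
by field; apply/andP.
Qed.

Lemma continuous_gauge_map N1 N2 : gauge N1 -> gauge N2 ->
  continuous (gauge_map N1 N2).
Proof.
move=> g1 g2 u; have [c1 h1 p1] := g1; have [c2 h2 p2] := g2.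
have [->|u0] := eqVneq u (0, 0); last first.
  apply: (@continuous_scl _ (fun u => N1 u / N2 u) id); last exact: cvg_id.
  apply: cvgM; first exact: c1.
  by apply: cvgV; [rewrite gt_eqF// p2|exact: c2].
have [m m0 mN] := gauge_bound g2.
have gm0 : gauge_map N1 N2 (0, 0) = (0, 0) by rewrite /gauge_map /scl /= !mulr0.
have cb e : 0 < e -> \forall w \near (0 : R, 0 : R), enorm (gauge_map N1 N2 w) < e.
  move=> e0.
  have : \forall w \near (0 : R, 0 : R), N1 w < m * e.
    apply: (@cts_lt _ _ N1 (fun=> m * e) _ (c1 _)); first exact: cts_cst.
    by rewrite (gauge0 g1) mulr_gt0.
  apply: filterS => w; rewrite -(gauge_mapE w g1 g2) => /(le_lt_trans (mN _)).
  by rewrite ltr_pM2l.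
have le1 (w : R * R) : `|w.1| <= enorm w.
  by rewrite -sqrtr_sqr ler_wsqrtr// lerDl sqr_ge0.
have le2 (w : R * R) : `|w.2| <= enorm w.
  by rewrite -sqrtr_sqr ler_wsqrtr// lerDr sqr_ge0.
apply/cvg_ballP => e e0; rewrite gm0; apply: filterS (cb e e0) => w we.
split; rewrite /ball/= sub0r normrN; [exact: le_lt_trans (le1 _) we|].
exact: le_lt_trans (le2 _) we.
Qed.

Lemma homeomorphic_on (T U : topologicalType) (A : set T) (B : set U)
    (f : T -> U) (g : U -> T) :
  (forall x, A x -> B (f x)) -> (forall y, B y -> A (g y)) ->
  (forall x, A x -> g (f x) = x) -> (forall y, B y -> f (g y) = y) ->
  (forall x, A x -> {for x, continuous f}) ->
  (forall y, B y -> {for y, continuous g}) -> homeomorphic_sets A B.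
Proof.
move=> fAB gBA gf fg cf cg.
have A_ (x : A) : A (set_val x) by exact: set_mem (valP x).
have B_ (x : B) : B (set_val x) by exact: set_mem (valP x).
exists (fun x : A => exist (fun y => y \in B) (f (set_val x)) (mem_set (fAB _ (A_ x)))).
exists (fun x : B => exist (fun y => y \in A) (g (set_val x)) (mem_set (gBA _ (B_ x)))).
split.
- by move=> x; apply: val_inj => /=; exact: gf.
- by move=> x; apply: val_inj => /=; exact: fg.
- apply: (@continuous_comp_initial _ _ U set_val) => x /=.
  apply: (@continuous_comp _ _ _ (set_val : A -> T) f); last exact: cf.
  exact: initial_continuous.
- apply: (@continuous_comp_initial _ _ T set_val) => x /=.
  apply: (@continuous_comp _ _ _ (set_val : B -> U) g); last exact: cg.
  exact: initial_continuous.
Qed.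

End gauges.

Section star_regions.
Context {R : realType}.
Implicit Types (u w : R * R) (s t : R).

Lemma continuous_ray u : continuous (fun s => scl s u).
Proof.
by move=> s; apply: (@continuous_scl _ _ id (fun=> u)); [exact: cvg_id|exact: cts_cst].
Qed.

(** The gauge of I is the inverse of the length rho of the ray inside I. Openness of I
    and of J makes it upper and lower semicontinuous. *)
Lemma star_gauge (I J : set (R * R)) : open I -> open J ->
  (forall u, I u -> ~ J u) ->
  (forall w, enorm w = 1 -> exists r, [/\ 0 < r,
     forall s, 0 <= s < r -> I (scl s w) & forall s, r < s -> J (scl s w)]) ->
  exists N, [/\ gauge N, forall u, N u < 1 <-> I u & forall u, N u = 1 <-> ~ I u /\ ~ J u].
Proof.
move=> oI oJ IJ unit_star.
have star u : u != (0, 0) -> exists r, [/\ 0 < r,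
     forall s, 0 <= s < r -> I (scl s u) & forall s, r < s -> J (scl s u)].
  move=> u0; have [w w1 uw] := unit_dir u0; have e0 : 0 < enorm u by rewrite enorm_gt0.
  have [r [r0 Ir Jr]] := unit_star w w1.
  exists (r / enorm u); split; first exact: divr_gt0.
    move=> s /andP[s0 sr]; rewrite uw sclA; apply: Ir.
    by rewrite mulr_ge0 ?(ltW e0)// -ltr_pdivlMr.
  by move=> s; rewrite ltr_pdivrMr// => rs; rewrite uw sclA; exact: Jr.
have I0 : I (0, 0).
  have u0 : (1, 0) != (0, 0) :> R * R by rewrite xpair_eqE oner_eq0.
  have [r [r0 Ir _]] := star _ u0.
  by rewrite -(scl0 (1, 0)); apply: Ir; rewrite lexx.
have [rho rhoP] : exists rho : R * R -> R, forall u, u != (0, 0) -> [/\ 0 < rho u,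
     forall s, 0 <= s < rho u -> I (scl s u) & forall s, rho u < s -> J (scl s u)].
  have H u : exists r, u != (0, 0) -> [/\ 0 < r,
     forall s, 0 <= s < r -> I (scl s u) & forall s, r < s -> J (scl s u)].
    have [->|u0] := eqVneq u (0, 0); first by exists 0.
    by have [r rP] := star u u0; exists r.
  by have [rho rhoP] := choice H; exists rho.
(* on a ray the two open regions are separated exactly at rho *)
have notI u : u != (0, 0) -> ~ I (scl (rho u) u).
  move=> u0 Iu; have [r0 Ir Jr] := rhoP u u0.
  have : \forall s \near (rho u)^'+, I (scl s u).
    by apply: cvg_within; apply: continuous_ray; exact: open_nbhs_nbhs.
  move=> h; near (rho u)^'+ => s.
  apply: (IJ (scl s u)); first by near: s.
  by apply: Jr; near: s; exact: nbhs_right_gt.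
have notJ u : u != (0, 0) -> ~ J (scl (rho u) u).
  move=> u0 Ju; have [r0 Ir Jr] := rhoP u u0.
  have : \forall s \near (rho u)^'-, J (scl s u).
    by apply: cvg_within; apply: continuous_ray; exact: open_nbhs_nbhs.
  move=> h; near (rho u)^'- => s.
  apply: (IJ (scl s u)); last by near: s.
  apply: Ir; apply/andP; split; near: s; [|exact: nbhs_left_lt].
  exact: nbhs_left_ge.
pose N u := if u == (0, 0) then 0 else (rho u)^-1.
have N_ge0 u : 0 <= N u.
  by rewrite /N; case: ifPn => // /rhoP[/ltW r0 _ _]; rewrite invr_ge0.
have NI u t : 0 < t -> (N u < t) <-> I (scl t^-1 u).
  move=> t0; rewrite /N; have [->|u0] := eqVneq u (0, 0).
    by rewrite sclr0 t0; split.
  have [r0 Ir Jr] := rhoP u u0; rewrite -[X in _ < X]invrK ltf_pV2 ?posrE ?invr_gt0//.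
  split=> [tr|It]; first by apply: Ir; rewrite invr_ge0 ltW.
  rewrite ltNge le_eqVlt; apply/negP => /orP[/eqP tr|/Jr]; last exact: IJ.
  by apply: (notI u u0); rewrite tr.
have NJ u t : 0 < t -> (t < N u) <-> J (scl t^-1 u).
  move=> t0; rewrite /N; have [->|u0] := eqVneq u (0, 0).
    by rewrite sclr0 ltNge ltW//; split => // /IJ; case.
  have [r0 Ir Jr] := rhoP u u0; rewrite -[X in X < _]invrK ltf_pV2 ?posrE ?invr_gt0//.
  split=> [tr|Jt]; first exact: Jr.
  rewrite ltNge le_eqVlt; apply/negP => /orP[/eqP tr|tr].
    by apply: (notJ u u0); rewrite -tr.
  by apply: IJ Jt; apply: Ir; rewrite invr_ge0 ltW.
have hN s u : 0 <= s -> N (scl s u) = s * N u.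
  rewrite le_eqVlt => /orP[/eqP<-|s0].
    by rewrite scl0 /N eqxx mul0r.
  have key t : 0 < t -> (N (scl s u) < t) <-> (N u < t / s).
    move=> t0; rewrite NI// sclA NI ?divr_gt0//.
    by rewrite invfM invrK mulrC.
  have mid (a b : R) : a < b -> a < (a + b) / 2 < b by move=> ab; lra.
  apply/eqP; rewrite eq_le !leNgt; apply/andP; split; apply/negP.
    move=> /[dup] h /mid/andP[h1 h2].
    have t0 : 0 < (s * N u + N (scl s u)) / 2 by apply: le_lt_trans h1; exact: mulr_ge0 (ltW s0) _.
    have : N u < (s * N u + N (scl s u)) / 2 / s by rewrite ltr_pdivlMr// mulrC.
    by move=> /(key _ t0); rewrite ltNge (ltW h2).
  move=> /[dup] h /mid/andP[h1 h2].
  have t0 : 0 < (N (scl s u) + s * N u) / 2 by exact: le_lt_trans h1.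
  have /(key _ t0) := h1; rewrite ltr_pdivlMr// mulrC ltNge.
  by rewrite (ltW h2).
have oscl (A : set (R * R)) t u : open A -> A (scl t u) -> \forall w \near u, A (scl t w).
  move=> oA At; have c : {for u, continuous (fun w => scl t w)}.
    by apply: (@continuous_scl _ _ (fun=> t) id); [exact: cts_cst|exact: cvg_id].
  by apply: c; exact: open_nbhs_nbhs.
exists N; split; first split=> //.
- move=> u; apply/cvgrPdist_lt => e e0.
  have t0 : 0 < N u + e by rewrite ltr_wpDl.
  have up : \forall w \near u, N w < N u + e.
    have /(NI _ _ t0)/(oscl _ _ _ oI) : N u < N u + e by rewrite ltrDl.
    by apply: filterS => w /(NI _ _ t0).
  have lo : \forall w \near u, N u - e < N w.
    have [s0|s0] := ltP 0 (N u - e / 2); last first.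
      by near=> w; apply: lt_le_trans (N_ge0 w); lra.
    have /(NJ _ _ s0)/(oscl _ _ _ oJ) : N u - e / 2 < N u by lra.
    by apply: filterS => w /(NJ _ _ s0); lra.
  apply: filterS (filterI up lo) => w [h1 h2].
  by rewrite ltr_norml; apply/andP; split; lra.
- move=> u u0; rewrite /N (negbTE u0) invr_gt0.
  by have [] := rhoP u u0.
- by move=> u; rewrite NI// invr1 scl1.
- move=> u; have := NI u 1 ltr01; have := NJ u 1 ltr01; rewrite invr1 scl1 => <- <-.
  split=> [->|[/negP n1 /negP n2]]; first by rewrite ltxx.
  by apply/eqP; rewrite eq_le !leNgt n1 n2.
Unshelve. all: by end_near. Qed.

End star_regions.

(** * Affine charts of the projective plane *)

Section charts.
Context {R : realType}.
Implicit Types (u w : R * R) (B : 'M[R]_3) (v : 'rV[R]_3).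

Definition vec3 (a b d : R) : 'rV[R]_3 := \row_i [tuple a; b; d]`_i.

Lemma vec3E a b d :
  (vec3 a b d 0 0 = a) * (vec3 a b d 0 1 = b) * (vec3 a b d 0 2 = d).
Proof. by rewrite !mxE. Qed.

Lemma vec3_eta v : v = vec3 (v 0 0) (v 0 1) (v 0 2).
Proof.
apply/rowP => -[[|[|[|//]]] i3]; rewrite mxE /=; congr (v _ _); exact: val_inj.
Qed.

(** The affine chart whose line at infinity is spanned by the last two rows of
    the frame B and whose origin is the first row. *)
Definition aff B u : 'rV[R]_3 := vec3 1 u.1 u.2 *m B.
Definition chart B u : RP2 R := pt (aff B u).
Definition hcoord B v : 'rV[R]_3 := v *m invmx B.
Definition dehom B v : R * R :=
  (hcoord B v 0 1 / hcoord B v 0 0, hcoord B v 0 2 / hcoord B v 0 0).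

Lemma hcoordK B v : B \in unitmx -> hcoord B v *m B = v.
Proof. by move=> Bu; rewrite mulmxKV. Qed.

Lemma aff_neq0 B u : B \in unitmx -> aff B u != 0.
Proof.
move=> Bu; apply/eqP => /(congr1 (fun x => x *m invmx B)).
rewrite mulmxK// mul0mx => /rowP/(_ 0); rewrite vec3E mxE => /eqP.
by rewrite oner_eq0.
Qed.

Lemma hcoord_aff B u : B \in unitmx -> hcoord B (aff B u) = vec3 1 u.1 u.2.
Proof. by move=> Bu; rewrite /hcoord mulmxK. Qed.

Lemma dehom_aff B u : B \in unitmx -> dehom B (aff B u) = u.
Proof.
by move=> Bu; rewrite /dehom hcoord_aff// !vec3E !divr1; case: u.
Qed.

Lemma aff_dehom B v : B \in unitmx -> hcoord B v 0 0 != 0 ->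
  v = hcoord B v 0 0 *: aff B (dehom B v).
Proof.
move=> Bu h0; rewrite /aff scalemxAl -[LHS](hcoordK v Bu); congr (_ *m B).
rewrite /dehom; move: (hcoord B v) h0 => h h0.
rewrite [LHS]vec3_eta; apply/rowP => -[[|[|[|//]]] i3]; rewrite !mxE /=.
- by rewrite mulr1.
- by rewrite mulrCA divff// mulr1.
- by rewrite mulrCA divff// mulr1.
Qed.

Lemma hcoordZ B k v j : hcoord B (k *: v) 0 j = k * hcoord B v 0 j.
Proof. by rewrite /hcoord -scalemxAl [LHS]mxE. Qed.

Lemma dehomZ B k v : k != 0 -> dehom B (k *: v) = dehom B v.
Proof.
move=> k0; rewrite /dehom !hcoordZ.
have e (a b : R) : k * a / (k * b) = a / b by rewrite invfM mulrACA divff// mul1r.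
by rewrite !e.
Qed.

Lemma chart_imageP B (A : set (R * R)) v : B \in unitmx -> v != 0 ->
  (chart B @` A) (pt v) <-> hcoord B v 0 0 != 0 /\ A (dehom B v).
Proof.
move=> Bu v0; split.
  move=> [u Au /esym/(pt_eqP v0 (aff_neq0 u Bu))[k k0 ->]].
  by rewrite dehomZ// dehom_aff// hcoordZ hcoord_aff// vec3E mulr1.
move=> [h0 Av]; exists (dehom B v) => //.
by rewrite [in RHS](aff_dehom Bu h0) ptZ// aff_neq0.
Qed.

Lemma chart_inj B : B \in unitmx -> injective (chart B).
Proof.
move=> Bu u w /(pt_eqP (aff_neq0 u Bu) (aff_neq0 w Bu))[k k0 e].
by rewrite -(dehom_aff u Bu) e dehomZ// dehom_aff.
Qed.

Lemma continuous_hcoord B : continuous (hcoord B).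
Proof.
move=> v; apply: cts_mx => i j.
have -> : (fun y => hcoord B y i j) = (fun y => y i ord0 * invmx B ord0 j
    + (y i (lift ord0 ord0) * invmx B (lift ord0 ord0) j
    + (y i (lift ord0 (lift ord0 ord0)) * invmx B (lift ord0 (lift ord0 ord0)) j + 0))).
  by apply/funext => y; rewrite mxE !big_ord_recl big_ord0.
by cts.
Qed.

Lemma continuous_dehom B v : hcoord B v 0 0 != 0 -> {for v, continuous (dehom B)}.
Proof.
move=> h0; apply: cts_pair; apply: ctsM; try apply: ctsV => //;
  by apply: cts_coord; exact: continuous_hcoord.
Qed.

Lemma continuous_aff B : continuous (aff B).
Proof.
move=> u; apply: cts_mx => i j.
have -> : (fun y => aff B y i j) = (fun y => 1 * B 0 j + y.1 * B 1 j + y.2 * B 2 j).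
  apply/funext => y; rewrite mxE !big_ord_recl big_ord0 addr0 addrA.
  rewrite !mxE /=.
  by congr (_ * B _ _ + _ * B _ _ + _ * B _ _); exact: val_inj.
by cts.
Qed.

Lemma continuous_chart B : B \in unitmx -> continuous (chart B).
Proof.
by move=> Bu u U /(nbhs_pt _ (aff_neq0 u Bu)) h; have := @continuous_aff B u _ h.
Qed.

Lemma open_chart B (A : set (R * R)) : B \in unitmx -> open A -> open (chart B @` A).
Proof.
move=> Bu oA; apply/open_RP2 => v v0 /(chart_imageP _ Bu v0)[h0 Av].
have n1 : \forall w \near v, hcoord B w 0 0 != 0.
  by apply: cts_neq0 => //; apply: cts_coord; exact: continuous_hcoord.
have n2 : \forall w \near v, A (dehom B w).
  by apply: (continuous_dehom h0); exact: open_nbhs_nbhs.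
apply: filterS (filterI (nbhs_neq0 v0) (filterI n1 n2)) => w [w0 [hw Aw]].
exact/(chart_imageP _ Bu w0).
Qed.

(** Left inverse of a chart, defined through a representative. *)
Definition unchart B (x : RP2 R) : R * R := dehom B (\val (repr x)).

Lemma unchart_pt B v : v != 0 -> unchart B (pt v) = dehom B v.
Proof.
move=> v0; rewrite /unchart; set w := \val (repr (pt v)).
have w0 : w != 0 by exact: val_punctured_neq0.
have : pt w = pt v by rewrite -proj_pointE /proj_point reprK.
by move=> /(pt_eqP w0 v0)[k k0 ->]; rewrite dehomZ.
Qed.

Lemma chartK B : B \in unitmx -> cancel (chart B) (unchart B).
Proof. by move=> Bu u; rewrite unchart_pt ?aff_neq0// dehom_aff. Qed.

Lemma continuous_unchart B u : B \in unitmx -> {for chart B u, continuous (unchart B)}.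
Proof.
move=> Bu U; rewrite chartK// => Uu; apply/nbhs_pt; first exact: aff_neq0.
have n2 : \forall w \near aff B u, U (dehom B w).
  apply: continuous_dehom; rewrite ?dehom_aff//.
  by rewrite hcoord_aff// vec3E oner_neq0.
apply: filterS (filterI (nbhs_neq0 (aff_neq0 u Bu)) n2) => w [w0 Uw] /=.
by rewrite unchart_pt.
Qed.

Lemma homeomorphic_chart B N1 N2 (D : set R) :
  B \in unitmx -> gauge N1 -> gauge N2 ->
  homeomorphic_sets (N1 @^-1` D) (chart B @` (N2 @^-1` D)).
Proof.
move=> Bu g1 g2.
apply: (@homeomorphic_on _ _ _ _ (chart B \o gauge_map N1 N2)
  (gauge_map N2 N1 \o unchart B)).
- move=> u Du; exists (gauge_map N1 N2 u) => //.
  by rewrite /preimage /= gauge_mapE.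
- by move=> _ [u Du <-] /=; rewrite chartK// gauge_mapE.
- by move=> u _ /=; rewrite chartK// gauge_mapK.
- by move=> _ [u Du <-] /=; rewrite chartK// gauge_mapK.
- move=> u _; apply: continuous_comp; first exact: continuous_gauge_map.
  exact: continuous_chart.
- move=> _ [u Du <-]; apply: continuous_comp; first exact: continuous_unchart.
  exact: continuous_gauge_map.
Qed.

Lemma homeomorphic_sym (T U : topologicalType) (A : set T) (B : set U) :
  homeomorphic_sets A B -> homeomorphic_sets B A.
Proof. by move=> [f [g [? ? ? ?]]]; exists g, f. Qed.

End charts.

(** * Ovals in an affine chart *)

Section ovals.
Context {R : realType}.
Implicit Types (u w : R * R) (B : 'M[R]_3) (v : 'rV[R]_3) (N : R * R -> R).

Definition gdisc B N : set (RP2 R) := chart B @` [set u | N u < 1].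
Definition gcirc B N : set (RP2 R) := chart B @` [set u | N u = 1].

(** Near a point at infinity the affine coordinates are large, and so is the gauge
    since it dominates a multiple of the Euclidean norm. *)
Lemma closed_gdisc B N : B \in unitmx -> gauge N ->
  closed (gdisc B N `|` gcirc B N).
Proof.
move=> Bu gN; rewrite -openC; apply/open_RP2 => v v0.
have -> : gdisc B N `|` gcirc B N = chart B @` [set u | N u <= 1].
  apply/seteqP; split=> [_ [|] [u /= Nu <-]|_ [u /= Nu <-]].
  - by exists u => //=; exact: ltW.
  - by exists u => //=; rewrite Nu.
  - by move: Nu; rewrite le_eqVlt => /orP[/eqP|] Nu; [right|left]; exists u.
move=> cv; have {cv} nv : ~ (hcoord B v 0 0 != 0 /\ N (dehom B v) <= 1).
  by move=> /(chart_imageP [set u | N u <= 1] Bu v0).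
have [h0|h0] := eqVneq (hcoord B v 0 0) 0; last first.
  have Nv : 1 < N (dehom B v) by rewrite ltNge; apply/negP => ?; exact: nv.
  have n1 : \forall w \near v, 1 < N (dehom B w).
    apply: (@cts_lt _ _ (fun=> 1) (N \o dehom B)) => //; first exact: cts_cst.
    apply: continuous_comp; first exact: continuous_dehom.
    by case: gN => cN _ _; exact: cN.
  apply: filterS (filterI (nbhs_neq0 v0) n1) => w [w0 Nw].
  by move=> /(chart_imageP _ Bu w0)[_] /=; rewrite leNgt Nw.
have [m m0 mN] := gauge_bound gN.
pose a (w : 'rV[R]_3) := hcoord B w 0 1.
pose b (w : 'rV[R]_3) := hcoord B w 0 2.
have ab0 : (a v, b v) != (0, 0).
  apply: contra v0 => /eqP[a0 b0]; rewrite -(hcoordK v Bu).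
  have -> : hcoord B v = 0; last by rewrite mul0mx.
  rewrite [LHS]vec3_eta h0 -/(a v) -/(b v) a0 b0; apply/rowP => k.
  by rewrite !mxE; case: k => -[|[|[|//]]].
have n1 : \forall w \near v, `|hcoord B w 0 0| < m * enorm (a w, b w).
  apply: cts_lt; last by rewrite h0 normr0 mulr_gt0// enorm_gt0.
    apply: (@continuous_comp _ _ _ (fun w : 'rV[R]_3 => hcoord B w 0 0) (fun x => `|x|)).
      by apply: cts_coord; exact: continuous_hcoord.
    exact: norm_continuous.
  apply: ctsM; first exact: cts_cst.
  apply: (@continuous_comp _ _ _ (fun w : 'rV[R]_3 => (a w, b w)) enorm).
    by apply: cts_pair; apply: cts_coord; exact: continuous_hcoord.
  exact: continuous_enorm.
apply: filterS (filterI (nbhs_neq0 v0) n1) => w [w0 Nw].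
move=> /(chart_imageP _ Bu w0)[hw0 /(le_trans (mN _))].
have -> : dehom B w = scl (hcoord B w 0 0)^-1 (a w, b w).
  by rewrite /dehom /scl /= ![_^-1 * _]mulrC.
rewrite enorm_scl normfV mulrCA ler_pdivrMl ?normr_gt0// mulr1.
by rewrite leNgt Nw.
Qed.

Lemma open_gdisc B N : B \in unitmx -> gauge N -> open (gdisc B N).
Proof.
move=> Bu [cN _ _]; apply: open_chart => //.
have -> : [set u | N u < 1] = N @^-1` [set x | x < 1] by [].
by move/continuousP: cN; apply; exact: open_lt.
Qed.

Lemma gdisc_gcirc B N x : B \in unitmx -> gdisc B N x -> gcirc B N x -> False.
Proof.
move=> Bu [u /= u1 <-] [w /= w1 /(chart_inj Bu) wu].
by move: u1; rewrite -wu w1 ltxx.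
Qed.

Lemma gdiscE B N : B \in unitmx ->
  gdisc B N = ~` gcirc B N `&` gdisc B N.
Proof.
move=> Bu; apply/seteqP; split=> x; last by case.
by move=> Ix; split=> // Ox; exact: gdisc_gcirc Ix Ox.
Qed.

Lemma gdiscE' B N : B \in unitmx ->
  gdisc B N = ~` gcirc B N `&` (gdisc B N `|` gcirc B N).
Proof.
move=> Bu; apply/seteqP; split=> x; last by case=> ? [].
by move=> Ix; split=> [Ox|]; [exact: gdisc_gcirc Ix Ox|left].
Qed.

Lemma gauge_lt1 N : gauge N -> N (0, 0) < 1.
Proof. by move=> gN; rewrite (gauge0 gN). Qed.

Lemma connected_gdisc B N : B \in unitmx -> gauge N -> connected (gdisc B N).
Proof.
move=> Bu gN; have [cN hN pN] := gN.
have -> : gdisc B N = \bigcup_(u in [set u | N u < 1])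
    ((fun s => chart B (scl s u)) @` `[0, 1]%classic).
  apply/seteqP; split=> [_ [u Nu <-]|_ [u Nu [s /= s01 <-]]].
    exists u => //; exists 1; last by rewrite scl1.
    by rewrite /= in_itv /= ler01 lexx.
  exists (scl s u) => //=; move: s01; rewrite in_itv /= => /andP[s0 s1].
  by rewrite hN//; apply: le_lt_trans Nu; rewrite ler_piMl// gauge_ge0.
apply: bigcup_connected.
  exists (chart B (0, 0)) => u _; exists 0; last by rewrite scl0.
  by rewrite /= in_itv /= ler01 lexx.
move=> u _; apply: connected_continuous_connected; first exact: segment_connected.
apply: continuous_subspaceT => s; apply: continuous_comp; first exact: continuous_ray.
exact: continuous_chart.
Qed.

Lemma chart_infty B N : B \in unitmx -> ~ (gdisc B N `|` gcirc B N) (pt (row 1 B)).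
Proof.
move=> Bu.
have hr : hcoord B (row 1 B) = row 1 1%:M by rewrite /hcoord -row_mul mulmxV.
have r0 : row 1 B != 0.
  apply/eqP => r0; move: hr; rewrite r0 /hcoord mul0mx => /rowP/(_ 1).
  by rewrite !mxE eqxx => /eqP; rewrite eq_sym oner_eq0.
have h0 : hcoord B (row 1 B) 0 0 = 0 by rewrite hr !mxE.
by case=> /(chart_imageP _ Bu r0)[]; rewrite h0 eqxx.
Qed.

(** The disc is open and closed in the complement of the circle, and misses a
    point at infinity. *)
Lemma oval_gcirc B N : B \in unitmx -> gauge N -> oval (gcirc B N).
Proof.
move=> Bu gN; split.
  rewrite unit_circle_enorm.
  exact: (@homeomorphic_chart _ _ _ _ [set 1] Bu gauge_enorm gN).
move=> /(_ (gdisc B N)) H.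
have /(congr1 (fun A => A (pt (row 1 B)))) : gdisc B N = ~` gcirc B N.
  apply: H.
  - by exists (chart B (0, 0)); exists (0, 0) => //=; exact: gauge_lt1.
  - by exists (gdisc B N); [exact: open_gdisc|exact: gdiscE].
  - by exists (gdisc B N `|` gcirc B N); [exact: closed_gdisc|exact: gdiscE'].
have := chart_infty Bu => /(_ N) n e; apply: n; left; rewrite e => O.
by apply: (chart_infty Bu (N := N)); right.
Qed.

Lemma component_gdisc B N x : B \in unitmx -> gauge N -> gdisc B N x ->
  connected_component (~` gcirc B N) x = gdisc B N.
Proof.
move=> Bu gN Ix; apply/seteqP; split; last first.
  apply: connected_component_max => //; last exact: connected_gdisc.
  by move=> y Iy Oy; exact: gdisc_gcirc Iy Oy.
set C := connected_component _ _.
have CO : C `<=` ~` gcirc B N by exact: connected_component_sub.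
suff <- : C `&` gdisc B N = C by move=> y [].
apply: (@component_connected _ (~` gcirc B N) x).
- exists x; split=> //; apply: connected_component_refl.
  by move=> Ox; exact: gdisc_gcirc Ix Ox.
- by exists (gdisc B N) => //; exact: open_gdisc.
- exists (gdisc B N `|` gcirc B N); first exact: closed_gdisc.
  apply/seteqP; split=> y [Cy]; first by move=> Iy; split=> //; left.
  by case=> // /(CO _ Cy).
Qed.

(** The disc is connected, and both open and closed in the complement of the circle,
    so it is one of the components of that complement. *)
Lemma gdisc_interior B N : B \in unitmx -> gauge N ->
  gdisc B N `<=` oval_interior (gcirc B N).
Proof.
move=> Bu gN x Ix; split; first by move=> Ox; exact: gdisc_gcirc Ix Ox.
rewrite component_gdisc// open_disc_enorm.
apply: homeomorphic_sym.
exact: (@homeomorphic_chart _ _ _ _ [set x | x < 1] Bu gauge_enorm gN).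
Qed.

End ovals.

(** * A disc in the projective plane contains no line *)
Local Open Scope quotient_scope.

Section projectors.
Context {R : realType}.
Implicit Types (u v w : 'rV[R]_3).

Definition dotp u v : R := u 0 0 * v 0 0 + u 0 1 * v 0 1 + u 0 2 * v 0 2.

(** Orthogonal projector onto the line spanned by v. *)
Definition projector v : 'M[R]_3 := \matrix_(i, j) (v 0 i * v 0 j / dotp v v).

Lemma dotpp_gt0 v : v != 0 -> 0 < dotp v v.
Proof.
move=> v0; rewrite lt0r; apply/andP; split; last first.
  by rewrite /dotp; nra.
apply: contra v0 => /eqP v0; rewrite [v]vec3_eta.
suff: v 0 0 = 0 /\ v 0 1 = 0 /\ v 0 2 = 0.
  move=> [-> [-> ->]]; apply/eqP/rowP => i; rewrite !mxE.
  by case: i => -[|[|[|//]]].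
by move: v0; rewrite /dotp => v0; split; [nra|split; nra].
Qed.

Lemma mul_projector u v : u *m projector v = (dotp u v / dotp v v) *: v.
Proof.
apply/rowP => j; rewrite !mxE !big_ord_recl big_ord0 !mxE /dotp.
have -> : lift ord0 ord0 = 1 :> 'I_3 by exact: val_inj.
have -> : lift ord0 (lift ord0 ord0) = 2 :> 'I_3 by exact: val_inj.
have -> : ord0 = 0 :> 'I_3 by exact: val_inj.
by ring.
Qed.

Lemma projector_fix v : v != 0 -> v *m projector v = v.
Proof. by move=> v0; rewrite mul_projector divff ?scale1r// gt_eqF// dotpp_gt0. Qed.

Lemma projectorZ k v : k != 0 -> projector (k *: v) = projector v.
Proof.
move=> k0; have [->|v0] := eqVneq v 0; first by rewrite scaler0.
apply/matrixP => i j; rewrite !mxE.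
have -> : dotp (k *: v) (k *: v) = k ^+ 2 * dotp v v by rewrite /dotp !mxE; ring.
have := dotpp_gt0 v0; move: (dotp v v) => d d0.
by field; rewrite k0 gt_eqF.
Qed.

Lemma projector_idem u v : v != 0 -> u *m projector v *m projector v = u *m projector v.
Proof.
by move=> v0; rewrite [in LHS](mul_projector u v) -scalemxAl projector_fix// mul_projector.
Qed.

Definition line_projector (x : RP2 R) := projector (\val (repr x)).

Lemma line_projector_pt v : v != 0 -> line_projector (pt v) = projector v.
Proof.
move=> v0; rewrite /line_projector; set w := \val (repr (pt v)).
have w0 : w != 0 by exact: val_punctured_neq0.
have : pt w = pt v by rewrite -proj_pointE /proj_point reprK.
by move=> /(pt_eqP w0 v0)[k k0 ->]; rewrite projectorZ.
Qed.

Lemma cts_dotp (T : topologicalType) (f g : T -> 'rV[R]_3) x :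
  {for x, continuous f} -> {for x, continuous g} ->
  {for x, continuous (fun y => dotp (f y) (g y))}.
Proof. by move=> cf cg; rewrite /dotp; cts. Qed.

Lemma continuous_line_projector : continuous line_projector.
Proof.
move=> x; have [v v0 ->] := pt_surj x; move=> U.
rewrite line_projector_pt// => Uv; apply/nbhs_pt => //.
have c : {for v, continuous projector}.
  apply: cts_mx => i j.
  have -> : (fun y => projector y i j) = (fun y => y 0 i * y 0 j * (dotp y y)^-1).
    by apply/funext => y; rewrite mxE.
  apply: ctsM; first by cts.
  apply: ctsV; last by rewrite gt_eqF// dotpp_gt0.
  by apply: cts_dotp; exact: cvg_id.
apply: filterS (filterI (nbhs_neq0 v0) (c _ Uv)) => w [w0 Uw].
by rewrite /= line_projector_pt.
Qed.

(** Such a u killed by the second projector would satisfy u = u (projector v - projector w),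
    and the difference has norm less than 1. *)
Lemma projector_far v w u : v != 0 -> w != 0 -> u != 0 ->
  u *m projector v = u ->
  (forall i j, `|projector v i j - projector w i j| < 4^-1) ->
  u *m projector w != 0.
Proof.
move=> v0 w0 u0 uv vw; apply/negP => /eqP uw.
have e j : u 0 j = u 0 0 * (projector v 0 j - projector w 0 j)
   + u 0 1 * (projector v 1 j - projector w 1 j)
   + u 0 2 * (projector v 2 j - projector w 2 j).
  have : u 0 j = (u *m (projector v - projector w)) 0 j by rewrite mulmxBr uv uw subr0.
  rewrite mxE !big_ord_recl big_ord0 !mxE.
  have -> : lift ord0 ord0 = 1 :> 'I_3 by exact: val_inj.
  have -> : lift ord0 (lift ord0 ord0) = 2 :> 'I_3 by exact: val_inj.
  have -> : ord0 = 0 :> 'I_3 by exact: val_inj.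
  by move=> ->; ring.
pose m := `|u 0 0| + `|u 0 1| + `|u 0 2|.
have b j : `|u 0 j| <= 4^-1 * m.
  rewrite {1}e; apply: le_trans (ler_normD _ _) _.
  apply: le_trans (lerD (ler_normD _ _) (lexx _)) _.
  rewrite !normrM /m !mulrDr ![4^-1 * _]mulrC.
  by apply: lerD; first apply: lerD; apply: ler_wpM2l => //; exact: ltW.
have m0 : m <= 4^-1 * m + 4^-1 * m + 4^-1 * m.
  by rewrite {1}/m; apply: lerD => //; apply: lerD.
have {}m0 : m = 0.
  apply/eqP; rewrite eq_le; apply/andP; split; last by rewrite !addr_ge0.
  by lra.
suff: u = 0 by move/eqP; rewrite (negbTE u0).
apply/rowP => j; rewrite mxE; apply/eqP; rewrite -normr_le0.
by apply: le_trans (b j) _; rewrite m0 mulr0.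
Qed.

End projectors.

Section moebius.
Context {R : realType}.
Implicit Types (s t : R).

Definition clamp s : R := Num.max 0 (Num.min 1 s).

Lemma clamp01 s : 0 <= clamp s <= 1.
Proof. by rewrite /clamp le_max lexx /= ge_max ler01 ge_min lexx. Qed.

Lemma clamp_id s : 0 <= s <= 1 -> clamp s = s.
Proof. by rewrite /clamp => /andP[h1 h2]; rewrite (min_idPr h2) (max_idPr h1). Qed.

Lemma continuous_clamp : continuous clamp.
Proof.
move=> s; apply: continuous_max; first exact: cvg_cst.
by apply: continuous_min; [exact: cvg_cst|exact: cvg_id].
Qed.

(** Half a turn on a great circle: its end points are antipodal, so it projects
    to a closed curve, a projective line. *)
Definition halfturn (a b : 'rV[R]_3) t : 'rV[R]_3 := (1 - 2 * t) *: a + (t * (1 - t)) *: b.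

Lemma continuous_halfturn a b : continuous (halfturn a b).
Proof.
move=> t; apply: cts_mx => i j.
have -> : (fun y => halfturn a b y i j) = (fun y => (1 + - (2 * y)) * a i j + (y * (1 + - y)) * b i j).
  by apply/funext => y; rewrite !mxE.
by cts.
Qed.

Lemma halfturn1 a b : halfturn a b 1 = - halfturn a b 0.
Proof. by apply/rowP => j; rewrite !mxE; ring. Qed.

(** A lift of a loop of lines to a loop of nonzero vectors on these lines, that is, to a
    loop in the double cover of the projective plane. *)
Definition closed_lift (Q : R -> 'M[R]_3) := exists v : R -> 'rV[R]_3,
  [/\ continuous v, forall t, 0 <= t <= 1 -> v t != 0 /\ v t *m Q t = v t & v 0 = v 1].

(** The lift of a loop projects to a lift of any nearby loop. *)
Lemma closed_lift_perturb (x y : R -> RP2 R) : continuous y -> y 0 = y 1 ->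
  (forall t, 0 <= t <= 1 -> forall i j,
     `|line_projector (x t) i j - line_projector (y t) i j| < 4^-1) ->
  closed_lift (line_projector \o x) -> closed_lift (line_projector \o y).
Proof.
move=> cy y01 xy [v [cv vP v01]].
exists (fun t => v t *m line_projector (y t)); split; last by rewrite y01 v01.
- move=> t; apply: cts_mx => i j.
  have cp : {for t, continuous (line_projector \o y)}.
    by apply: continuous_comp; [exact: cy|exact: continuous_line_projector].
  have -> : (fun t => (v t *m line_projector (y t)) i j) =
     (fun t => v t i 0 * line_projector (y t) 0 j + (v t i 1 * line_projector (y t) 1 j
        + v t i 2 * line_projector (y t) 2 j)).
    apply/funext => z; rewrite mxE !big_ord_recl big_ord0 addr0.
    by congr (v z _ _ * line_projector _ _ _ + (v z _ _ * line_projector _ _ _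
      + v z _ _ * line_projector _ _ _)); exact: val_inj.
  by have cvt := cv t; cts.
- move=> t t01; have [vt0 /= vt] := vP t t01; have h := xy t t01.
  have [p p0 xp] := pt_surj (x t); have [q q0 yq] := pt_surj (y t).
  move: vt h; rewrite xp yq !line_projector_pt// => vt h.
  split; first exact: projector_far vt h.
  by rewrite /= ?yq ?line_projector_pt// projector_idem.
Qed.

(** The component of a lift along the half turn changes sign between the end points, so
    it vanishes somewhere in between. *)
Lemma halfturn_no_closed_lift (a b : 'rV[R]_3) :
  (forall t, halfturn a b t != 0) ->
  ~ closed_lift (line_projector \o (fun t => pt (halfturn a b t))).
Proof.
move=> w0 [v [cv vP v01]]; pose w := halfturn a b.
have vw t : 0 <= t <= 1 -> v t = (dotp (v t) (w t) / dotp (w t) (w t)) *: w t.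
  move=> t01; have [_ /=] := vP t t01.
  by rewrite line_projector_pt// mul_projector.
pose k t := dotp (v t) (w t).
have ck : continuous k.
  by move=> t; apply: cts_dotp; [exact: cv|exact: continuous_halfturn].
have t0 : 0 <= (0 : R) <= 1 by rewrite lexx ler01.
have t1 : 0 <= (1 : R) <= 1 by rewrite lexx ler01.
have w1 : w 1 = - w 0 by exact: halfturn1.
have k1 : k 1 = - k 0.
  by rewrite /k -v01 w1 /dotp !mxE; ring.
have [z z01 kz] : exists2 z, z \in `[0, 1] & k z = 0.
  apply: IVT => //; first exact: continuous_subspaceT.
  rewrite k1 ge_min le_max oppr_le0 oppr_ge0.
  by case: (leP (k 0) 0) => h; rewrite ?orbT//= ?(ltW h) ?orbT.
have {}z01 : 0 <= z <= 1 by move: z01; rewrite in_itv.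
have [/eqP[]] := vP z z01.
by rewrite vw// -/(k z) kz mul0r scale0r.
Qed.

(** If X were a disc, shrinking the disc radially would contract the projective
    line inside X; a closed lift to the double cover exists for the constant
    loop, and having one is a clopen property of the contraction parameter. *)
Lemma line_not_disc (X : set (RP2 R)) (a b : 'rV[R]_3) :
  (forall t, halfturn a b t != 0) ->
  (forall t, X (pt (halfturn a b t))) ->
  ~ homeomorphic_sets X (open_disc R).
Proof.
move=> w0 Xw [f [g [fg gf cf cg]]].
pose L t : X := exist (fun x => x \in X) _ (mem_set (Xw t)).
have cL : continuous L.
  apply: (@continuous_comp_initial _ _ _ set_val) => t U.
  by move=> /(nbhs_pt _ (w0 t)) h; have := @continuous_halfturn a b t _ h.
pose gam t : R * R := set_val (f (L t)).
have cgam : continuous gam.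
  move=> t; apply: (@continuous_comp _ _ _ (f \o L) set_val).
    by apply: continuous_comp; [exact: cL|exact: cf].
  exact: initial_continuous.
have gamD t : enorm (gam t) < 1.
  have e u : open_disc R u = (enorm u < 1) :> Prop by rewrite open_disc_enorm.
  by rewrite -e; exact: set_mem (valP (f (L t))).
have HD s t : open_disc R (scl (clamp s) (gam t)).
  rewrite open_disc_enorm /= enorm_scl; have /andP[c0 c1] := clamp01 s.
  by rewrite ger0_norm//; apply: le_lt_trans (gamD t); rewrite ler_piMl// enorm_ge0.
pose H (u : R * R) : open_disc R := exist (fun x => x \in open_disc R) _ (mem_set (HD u.1 u.2)).
have cH : continuous H.
  apply: (@continuous_comp_initial _ _ _ set_val) => u.
  apply: (@continuous_scl _ _ (clamp \o fst) (gam \o snd)).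
    apply: continuous_comp; last exact: continuous_clamp.
    exact: cvg_fst.
  by apply: continuous_comp; [exact: cvg_snd|exact: cgam].
(* the projective line shrunk by the factor s inside the disc *)
pose y s t : RP2 R := set_val (g (H (s, t))).
have cQ : continuous (fun u : R * R => line_projector (y u.1 u.2)).
  move=> u; apply: continuous_comp; last exact: continuous_line_projector.
  have -> : (fun u : R * R => y u.1 u.2) = set_val \o (g \o H).
    by apply/funext => -[].
  apply: continuous_comp; last exact: initial_continuous.
  by apply: continuous_comp; [exact: cH|exact: cg].
have cy s : continuous (y s).
  move=> t; apply: (@continuous_comp _ _ _ (g \o (fun t => H (s, t))) set_val).
    apply: continuous_comp; last exact: cg.
    apply: (@continuous_comp _ _ _ (fun t => (s, t)) H); last exact: cH.
    by apply: cts_pair; [exact: cvg_cst|exact: cvg_id].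
  exact: initial_continuous.
have gam01 : gam 0 = gam 1.
  congr (set_val (f _)); apply: val_inj => /=.
  rewrite halfturn1 -scaleN1r.
  by rewrite ptZ// oppr_eq0 oner_neq0.
have y01 s : y s 0 = y s 1.
  by congr (set_val (g _)); apply: val_inj; rewrite /= gam01.
pose P s := closed_lift (line_projector \o y s).
have loc s0 : \forall s \near s0, P s0 <-> P s.
  have nc : near_covering (`[0, 1]%classic : set R).
    by apply/compact_near_coveringP; exact: segment_compact.
  have close : \forall s \near s0, (`[0, 1]%classic : set R) `<=` (fun t => forall i j,
     `|line_projector (y s0 t) i j - line_projector (y s t) i j| < 4^-1).
    apply: (nc R (nbhs s0) (fun s t : R => forall i j,
     `|line_projector (y s0 t) i j - line_projector (y s t) i j| < 4^-1)) => t0 _.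
    have h8 : 0 < (8^-1 : R) by rewrite invr_gt0.
    have /cvg_ballP/(_ _ h8) c := cQ (s0, t0).
    have d : \forall t \near t0, ball (line_projector (y s0 t0)) 8^-1 (line_projector (y s0 t)).
      have c' : {for t0, continuous (line_projector \o y s0)}.
        by apply: continuous_comp; [exact: cy|exact: continuous_line_projector].
      by have /cvg_ballP/(_ _ h8) := c'.
    case: c => -[A B] /= [nA nB] AB.
    exists (B `&` [set t | ball (line_projector (y s0 t0)) 8^-1 (line_projector (y s0 t))], A).
      by split=> //; exact: filterI.
    move=> [t s] /= [[Bt [_ h2]] As] i j.
    have [_ h1] := AB (s, t) (conj As Bt).
    have := h1 i j; have := h2 i j; rewrite /ball /= !ltr_norml => /andP[? ?] /andP[? ?].
    by apply/andP; split; lra.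
  apply: filterS close => s close; split.
    apply: (closed_lift_perturb (cy s) (y01 s)) => t t01 i j.
    by have /close : `[0, 1]%classic t by rewrite /= in_itv.
  apply: (closed_lift_perturb (cy s0) (y01 s0)) => t t01 i j.
  have /close : `[0, 1]%classic t by rewrite /= in_itv.
  by move=> /(_ i j); rewrite distrC.
have P0 : P 0.
  have [v v0 yv] := pt_surj (y 0 0).
  exists (fun=> v); split => //; first by move=> t; exact: cvg_cst.
  move=> t _; split => //=.
  have -> : y 0 t = y 0 0.
    by congr (set_val (g _)); apply: val_inj; rewrite /= clamp_id ?lexx ?ler01// !scl0.
  by rewrite yv line_projector_pt// projector_fix.
have PP : `[0, 1] `&` P = `[0, 1]%classic :> set R.
  apply: (@segment_connected R 0 1).
  - by exists 0; split => //; rewrite /= in_itv /= lexx ler01.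
  - exists P => //; rewrite openE => s Ps; apply: filterS (loc s) => z [h _]; exact: h.
  - exists P => //; rewrite -openC openE => s Ps; apply: filterS (loc s) => z [_ h] Pz.
    exact/Ps/h.
apply: (halfturn_no_closed_lift w0).
have : P 1.
  have : (`[0, 1] `&` P) 1 by rewrite PP /= in_itv /= lexx ler01.
  by case.
have e : y 1 = (fun t => pt (halfturn a b t)).
  apply/funext => t; rewrite /y.
  have -> : H (1, t) = f (L t).
    by apply: val_inj; rewrite /= clamp_id ?lexx ?ler01// scl1.
  by rewrite fg.
by rewrite /P e.
Unshelve. all: by end_near. Qed.

End moebius.

Section line_outside.
Context {R : realType}.

(** A projective line is connected, so the component that contains one of its points
    contains all of it and is not a disc. *)
Lemma line_not_interior (O : set (RP2 R)) (a b : 'rV[R]_3) t0 :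
  (forall t, halfturn a b t != 0) ->
  (forall t, ~ O (pt (halfturn a b t))) ->
  ~ oval_interior O (pt (halfturn a b t0)).
Proof.
move=> w0 Ow [_]; apply: (line_not_disc w0) => t.
pose w t := pt (halfturn a b t).
have cw : continuous w.
  by move=> s U /(nbhs_pt _ (w0 s)) h; have := @continuous_halfturn R a b s _ h.
have : (w @` [set: R]) `<=` connected_component (~` O) (w t0).
  apply: connected_component_max; first by exists t0.
    by move=> _ [s _ <-]; exact: Ow.
  apply: connected_continuous_connected; last exact: continuous_subspaceT.
  by apply/connected_intervalP => x y _ _ z _.
by apply; exists t.
Qed.

End line_outside.

(** * Persistence of simple zeros of plane maps *)
(** Completeness of the plane, for the contraction principle. *)
HB.instance Definition _ (R : realType) :=
  Uniform_isComplete.Build 'rV[R]_2 cauchy_cvg.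

Section local_root.
Context {R : realType} {X : topologicalType}.
Implicit Types (u w : R * R).

Definition box (r : R) : set (R * R) := [set u | `|u.1| <= r /\ `|u.2| <= r].

Lemma rV2_norm_le (y : 'rV[R]_2) (r : R) : 0 <= r ->
  `|y| <= r <-> `|y 0 0| <= r /\ `|y 0 1| <= r.
Proof.
move=> r0; rewrite [`|y|]mx_normrE; split.
  by move=> /bigmax_leP[_ h]; split; [exact: (h (0, 0))|exact: (h (0, 1))].
move=> [h0 h1]; apply/bigmax_leP; split => // -[i j] _ /=; rewrite ord1.
case: j => -[|[|//]] j2.
  by rewrite (_ : Ordinal j2 = 0)//; exact: val_inj.
by rewrite (_ : Ordinal j2 = 1)//; exact: val_inj.
Qed.

(** Newton iteration with a frozen Jacobian contracts a small box. *)
Lemma local_root (F1 F2 : X -> R * R -> R)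
    (a11 a12 a21 a22 : X * ((R * R) * (R * R)) -> R) (x0 : X) :
  (forall x u w, F1 x u - F1 x w =
     (u.1 - w.1) * a11 (x, (u, w)) + (u.2 - w.2) * a21 (x, (u, w))) ->
  (forall x u w, F2 x u - F2 x w =
     (u.1 - w.1) * a12 (x, (u, w)) + (u.2 - w.2) * a22 (x, (u, w))) ->
  let o : R * R := (0, 0) in let z := (x0, (o, o)) in
  {for z, continuous a11} -> {for z, continuous a12} ->
  {for z, continuous a21} -> {for z, continuous a22} ->
  {for x0, continuous (F1 ^~ o)} -> {for x0, continuous (F2 ^~ o)} ->
  F1 x0 o = 0 -> F2 x0 o = 0 ->
  a11 z * a22 z - a12 z * a21 z != 0 ->
  \forall r \near (0 : R)^'+, \forall x \near x0,
    exists u, [/\ box r u, F1 x u = 0, F2 x u = 0 &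
      forall w, box r w -> F1 x w = 0 -> F2 x w = 0 -> w = u].
Proof.
move=> dF1 dF2 o z c11 c12 c21 c22 cF1 cF2 F10 F20 det0.
set D := a11 z * a22 z - a12 z * a21 z in det0.
(* T x u = u - J^-1 F x u, where J is the Jacobian matrix at z *)
pose T1 x (u : R * R) := u.1 - (F1 x u * a22 z - F2 x u * a21 z) / D.
pose T2 x (u : R * R) := u.2 - (F2 x u * a11 z - F1 x u * a12 z) / D.
(* divided differences of T, which vanish at z *)
pose m11 y := 1 - (a11 y * a22 z - a12 y * a21 z) / D.
pose m12 y := - ((a12 y * a11 z - a11 y * a12 z) / D).
pose m21 y := - ((a21 y * a22 z - a22 y * a21 z) / D).
pose m22 y := 1 - (a22 y * a11 z - a21 y * a12 z) / D.
have dT1 x u w : T1 x u - T1 x w =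
    (u.1 - w.1) * m11 (x, (u, w)) + (u.2 - w.2) * m21 (x, (u, w)).
  rewrite /T1 /m11 /m21.
  have -> : F1 x u = F1 x w + ((u.1 - w.1) * a11 (x, (u, w)) + (u.2 - w.2) * a21 (x, (u, w))).
    by rewrite -dF1; ring.
  have -> : F2 x u = F2 x w + ((u.1 - w.1) * a12 (x, (u, w)) + (u.2 - w.2) * a22 (x, (u, w))).
    by rewrite -dF2; ring.
  by ring.
have dT2 x u w : T2 x u - T2 x w =
    (u.1 - w.1) * m12 (x, (u, w)) + (u.2 - w.2) * m22 (x, (u, w)).
  rewrite /T2 /m12 /m22.
  have -> : F1 x u = F1 x w + ((u.1 - w.1) * a11 (x, (u, w)) + (u.2 - w.2) * a21 (x, (u, w))).
    by rewrite -dF1; ring.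
  have -> : F2 x u = F2 x w + ((u.1 - w.1) * a12 (x, (u, w)) + (u.2 - w.2) * a22 (x, (u, w))).
    by rewrite -dF2; ring.
  by ring.
have q4 : 0 < 4^-1 :> R by rewrite invr_gt0.
have small (m : X * ((R * R) * (R * R)) -> R) : {for z, continuous m} -> m z = 0 ->
    \forall y \near z, `|m y| <= 4^-1.
  move=> cm m0; have /cvgr0Pnorm_le : m y @[y --> z] --> 0 by rewrite -m0; exact: cm.
  exact.
have s11 : \forall y \near z, `|m11 y| <= 4^-1.
  apply: small; first by rewrite /m11; cts.
  by rewrite /m11 -/D divff// subrr.
have s12 : \forall y \near z, `|m12 y| <= 4^-1.
  apply: small; first by rewrite /m12; cts.
  by rewrite /m12; ring.
have s21 : \forall y \near z, `|m21 y| <= 4^-1.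
  apply: small; first by rewrite /m21; cts.
  by rewrite /m21; ring.
have s22 : \forall y \near z, `|m22 y| <= 4^-1.
  apply: small; first by rewrite /m22; cts.
  have -> : m22 z = 1 - D / D by rewrite /m22 /D; ring.
  by rewrite divff// subrr.
have := filterI (filterI s11 s12) (filterI s21 s22).
case=> -[UX V] /= [nU [[V1 V2] /= [nV1 nV2] V12]] UV.
have nV : nbhs o (V1 `&` V2) by exact: filterI.
have boxV : \forall r \near (0 : R)^'+, box r `<=` V1 `&` V2.
  have /nbhs_ballP[e /= e0 eV] := nV.
  near=> r => u [u1 u2]; apply: eV; split; rewrite /ball /= sub0r normrN.
    by apply: le_lt_trans u1 _; near: r; exact: nbhs_right_lt.
  by apply: le_lt_trans u2 _; near: r; exact: nbhs_right_lt.
near=> r.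
have r0 : 0 < r by near: r; exact: nbhs_right_gt.
have rV : box r `<=` V1 `&` V2 by near: r.
have t1 : \forall x \near x0, `|T1 x o| <= r / 2.
  have : T1 x o @[x --> x0] --> 0.
    have -> : 0 = T1 x0 o by rewrite /T1 F10 F20 /=; ring.
    by apply: (_ : {for x0, continuous (T1 ^~ o)}); rewrite /T1; cts.
  by move/cvgr0Pnorm_le; apply; exact: divr_gt0.
have t2 : \forall x \near x0, `|T2 x o| <= r / 2.
  have : T2 x o @[x --> x0] --> 0.
    have -> : 0 = T2 x0 o by rewrite /T2 F10 F20 /=; ring.
    by apply: (_ : {for x0, continuous (T2 ^~ o)}); rewrite /T2; cts.
  by move/cvgr0Pnorm_le; apply; exact: divr_gt0.
apply: filterS (filterI nU (filterI t1 t2)) => x [Ux [t1x t2x]].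
have ms u w : box r u -> box r w -> [/\ `|m11 (x, (u, w))| <= 4^-1,
    `|m12 (x, (u, w))| <= 4^-1, `|m21 (x, (u, w))| <= 4^-1 & `|m22 (x, (u, w))| <= 4^-1].
  move=> /rV[u1 _] /rV[_ w2].
  by have [/= [? ?] [? ?]] := UV (x, (u, w)) (conj Ux (V12 (u, w) (conj u1 w2))).
have lip u w (d : R) : box r u -> box r w -> `|u.1 - w.1| <= d -> `|u.2 - w.2| <= d ->
    `|T1 x u - T1 x w| <= d / 2 /\ `|T2 x u - T2 x w| <= d / 2.
  move=> bu bw d1 d2; have [h11 h12 h21 h22] := ms u w bu bw.
  have key (p q p' q' : R) : `|p| <= d -> `|q| <= d -> `|p'| <= 4^-1 -> `|q'| <= 4^-1 ->
      `|p * p' + q * q'| <= d / 2.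
    move=> hp hq hp' hq'; apply: le_trans (ler_normD _ _) _; rewrite !normrM.
    have -> : d / 2 = d * 4^-1 + d * 4^-1 by field.
    by apply: lerD; apply: ler_pM.
  by rewrite dT1 dT2; split; apply: key.
have root u : T1 x u = u.1 -> T2 x u = u.2 -> F1 x u = 0 /\ F2 x u = 0.
  rewrite /T1 /T2 => e1 e2.
  have {}e1 : F1 x u * a22 z - F2 x u * a21 z = 0.
    by have := divfK det0 (F1 x u * a22 z - F2 x u * a21 z); nra.
  have {}e2 : F2 x u * a11 z - F1 x u * a12 z = 0.
    by have := divfK det0 (F2 x u * a11 z - F1 x u * a12 z); nra.
  have g1 : F1 x u * D = 0.
    have -> : F1 x u * D = (F1 x u * a22 z - F2 x u * a21 z) * a11 z +
      (F2 x u * a11 z - F1 x u * a12 z) * a21 z by rewrite /D; ring.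
    by rewrite e1 e2; ring.
  have g2 : F2 x u * D = 0.
    have -> : F2 x u * D = (F1 x u * a22 z - F2 x u * a21 z) * a12 z +
      (F2 x u * a11 z - F1 x u * a12 z) * a22 z by rewrite /D; ring.
    by rewrite e1 e2; ring.
  by move/eqP: g1; move/eqP: g2; rewrite !mulf_eq0 (negbTE det0) !orbF => /eqP-> /eqP->.
have fixed u : F1 x u = 0 -> F2 x u = 0 -> T1 x u = u.1 /\ T2 x u = u.2.
  by rewrite /T1 /T2 => -> ->; split; ring.
have box0 : box r o by rewrite /box /= normr0; split; exact: ltW.
have Tbox u : box r u -> box r (T1 x u, T2 x u).
  move=> bu; have [b1 b2] := bu.
  have [] := lip u o r bu box0; rewrite ?subr0// => l1 l2.
  split => /=.
    have -> : T1 x u = (T1 x u - T1 x o) + T1 x o by ring.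
    by apply: le_trans (ler_normD _ _) _; lra.
  have -> : T2 x u = (T2 x u - T2 x o) + T2 x o by ring.
  by apply: le_trans (ler_normD _ _) _; lra.
have [u bu fu] : exists2 u, box r u & u = (T1 x u, T2 x u).
  pose p (y : 'rV[R]_2) : R * R := (y 0 0, y 0 1).
  pose f (y : 'rV[R]_2) : 'rV[R]_2 := \row_k [tuple T1 x (p y); T2 x (p y)]`_k.
  pose U := [set y : 'rV[R]_2 | `|y| <= r].
  have Ubox y : U y -> box r (p y) by move=> /(rV2_norm_le _ (ltW r0)).
  have funf : set_fun U U f.
    by move=> y /Ubox/Tbox[? ?]; apply/(rV2_norm_le _ (ltW r0)); rewrite !mxE.
  pose ff : {fun U >-> U} := HB.pack f (isFun.Build _ _ _ _ f funf).
  have [|||y Uy fy] := @banach_fixed_point R ('rV[R]_2 : completeNormedModType R) U ff.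
  - exists (2^-1)%:nng; split=> /=; first by rewrite invf_lt1 ?ltr1n.
    move=> [u w] /= [/Ubox bu /Ubox bw]; rewrite mulrC.
    apply/rV2_norm_le; first by rewrite divr_ge0.
    rewrite !mxE /=; apply: lip => //; by have [/(_ (lexx _))[]] := rV2_norm_le (u - w) (normr_ge0 (u - w)); rewrite !mxE.
  - rewrite (_ : U = closed_ball_ Num.Def.normr (0 : 'rV[R]_2) r); first exact: closed_closed_ball_.
    by apply/seteqP; split=> y; rewrite /closed_ball_ /= sub0r normrN.
  - by exists 0; rewrite /U /= normr0 ltW.
  exists (p y); first exact: Ubox.
  by rewrite {1}/p {1 2}fy /= !mxE.
exists u.
have [F1u F2u] : F1 x u = 0 /\ F2 x u = 0.
  by apply: root; rewrite {2}fu.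
split => // w bw F1w F2w.
have [e1 e2] := fixed w F1w F2w; have [f1 f2] := fixed u F1u F2u.
pose d := `|w - u|.
have [] := lip w u d bw bu.
- by rewrite /d prod_normE le_max lexx.
- by rewrite /d prod_normE le_max lexx orbT.
rewrite e1 e2 f1 f2 => l1 l2.
have : d <= d / 2 by rewrite {1}/d prod_normE ge_max l1 l2.
have d0 : 0 <= d by exact: normr_ge0.
move=> dd; have {dd d0} : d = 0 by lra.
by move=> /normr0_eq0/eqP; rewrite subr_eq0 => /eqP.
Unshelve. all: by end_near. Qed.

End local_root.

(** * Gradients and divided differences of quartics *)
Section gradients.
Context {R : realType}.
Implicit Types (c : 'rV[R]_15) (u v w d e p : 'rV[R]_3) (s t : R).

Definition cross u v : 'rV[R]_3 :=
  vec3 (u 0 1 * v 0 2 - u 0 2 * v 0 1) (u 0 2 * v 0 0 - u 0 0 * v 0 2)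
       (u 0 0 * v 0 1 - u 0 1 * v 0 0).

(** The three partial derivatives of a quartic, as linear functions of the cubic
    monomials m i j k. *)
Definition cubics c (m : 'I_3 -> 'I_3 -> 'I_3 -> R) : 'rV[R]_3 :=
  vec3
  (4 * cf c 0 * m 0 0 0 + 3 * cf c 1 * m 0 0 1 + 3 * cf c 2 * m 0 0 2
   + 2 * cf c 3 * m 0 1 1 + 2 * cf c 4 * m 0 1 2 + 2 * cf c 5 * m 0 2 2
   + cf c 6 * m 1 1 1 + cf c 7 * m 1 1 2 + cf c 8 * m 1 2 2 + cf c 9 * m 2 2 2)
  (cf c 1 * m 0 0 0 + 2 * cf c 3 * m 0 0 1 + cf c 4 * m 0 0 2
   + 3 * cf c 6 * m 0 1 1 + 2 * cf c 7 * m 0 1 2 + cf c 8 * m 0 2 2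
   + 4 * cf c 10 * m 1 1 1 + 3 * cf c 11 * m 1 1 2 + 2 * cf c 12 * m 1 2 2
   + cf c 13 * m 2 2 2)
  (cf c 2 * m 0 0 0 + cf c 4 * m 0 0 1 + 2 * cf c 5 * m 0 0 2
   + cf c 7 * m 0 1 1 + 2 * cf c 8 * m 0 1 2 + 3 * cf c 9 * m 0 2 2
   + cf c 11 * m 1 1 1 + 2 * cf c 12 * m 1 1 2 + 3 * cf c 13 * m 1 2 2
   + 4 * cf c 14 * m 2 2 2).

(** Telescoping the product v i * v j * v k - w i * w j * w k gives a divided
    difference that is linear in the increment d. *)
Definition divdiff v w d (i j k : 'I_3) : R :=
  d 0 i * v 0 j * v 0 k + w 0 i * d 0 j * v 0 k + w 0 i * w 0 j * d 0 k.

Definition dgrad c v w d := cubics c (divdiff v w d).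
Definition hess c p d := dgrad c p p d.

Lemma gradE c v : grad c v = cubics c (fun i j k => v 0 i * v 0 j * v 0 k).
Proof.
rewrite [LHS]vec3_eta !mxE /= /qx /qy /qz /cubics.
by congr vec3; ring.
Qed.

Lemma cubicsB c m m' : cubics c m - cubics c m' = cubics c (fun i j k => m i j k - m' i j k).
Proof. by rewrite [LHS]vec3_eta !mxE /= /cubics; congr vec3; ring. Qed.

Lemma cubicsD2 c m m' s t : s *: cubics c m + t *: cubics c m' =
  cubics c (fun i j k => s * m i j k + t * m' i j k).
Proof. by rewrite [LHS]vec3_eta !mxE /= /cubics; congr vec3; ring. Qed.

Lemma eq_cubics c m m' : (forall i j k, m i j k = m' i j k) -> cubics c m = cubics c m'.
Proof. by move=> mm; rewrite /cubics !mm. Qed.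

Lemma gradB c v w : grad c v - grad c w = dgrad c v w (v - w).
Proof.
rewrite !gradE cubicsB; apply: eq_cubics => i j k.
by rewrite /divdiff !mxE; ring.
Qed.

Lemma dgrad_linear c v w d e s t : dgrad c v w (s *: d + t *: e) =
  s *: dgrad c v w d + t *: dgrad c v w e.
Proof.
rewrite cubicsD2; apply: eq_cubics => i j k.
by rewrite /divdiff !mxE; ring.
Qed.

(** The field v x grad f(v), whose zeros are the eigenvectors. *)
Definition eigfield c v := cross v (grad c v).
(** Its divided differences, exact because the gradient is a polynomial. *)
Definition deigfield c v w d := cross d (grad c v) + cross w (dgrad c v w d).

Lemma crossBl u v w : cross (u - v) w = cross u w - cross v w.
Proof. by rewrite [LHS]vec3_eta [RHS]vec3_eta !mxE /=; congr vec3; ring. Qed.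
Lemma crossBr u v w : cross w (u - v) = cross w u - cross w v.
Proof. by rewrite [LHS]vec3_eta [RHS]vec3_eta !mxE /=; congr vec3; ring. Qed.
Lemma crossD2l s t u v w : cross (s *: u + t *: v) w = s *: cross u w + t *: cross v w.
Proof. by rewrite [LHS]vec3_eta [RHS]vec3_eta !mxE /=; congr vec3; ring. Qed.
Lemma crossD2r s t u v w : cross w (s *: u + t *: v) = s *: cross w u + t *: cross w v.
Proof. by rewrite [LHS]vec3_eta [RHS]vec3_eta !mxE /=; congr vec3; ring. Qed.

Lemma eigfieldB c v w : eigfield c v - eigfield c w = deigfield c v w (v - w).
Proof.
rewrite /eigfield /deigfield -gradB crossBl crossBr.
by rewrite addrA addrNK.
Qed.

Lemma deigfield_linear c v w d e s t : deigfield c v w (s *: d + t *: e) =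
  s *: deigfield c v w d + t *: deigfield c v w e.
Proof.
rewrite /deigfield dgrad_linear crossD2l crossD2r !scalerDr.
by rewrite addrACA.
Qed.

Lemma cross_eq0P u v : u != 0 -> cross u v = 0 <-> exists k, v = k *: u.
Proof.
move=> u0; split; last first.
  by move=> [k ->]; rewrite [LHS]vec3_eta [RHS]vec3_eta !mxE /=; congr vec3; ring.
move=> /rowP e; exists (dotp u v / dotp u u).
have D0 := dotpp_gt0 u0; have := e 0; have := e 1; have := e 2.
rewrite !mxE /= => e2 e1 e0.
rewrite [LHS]vec3_eta [RHS]vec3_eta !mxE.
have key (j : 'I_3) : v 0 j * dotp u u = dotp u v * u 0 j ->
    v 0 j = dotp u v / dotp u u * u 0 j.
  by move=> h; rewrite mulrAC -h mulfK// gt_eqF.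
have rot (x y : R) : x - y = 0 -> x = y by move/eqP; rewrite subr_eq0 => /eqP.
congr vec3; apply: key; apply: rot; rewrite /dotp.
- transitivity (u 0 2 * (u 0 2 * v 0 0 - u 0 0 * v 0 2)
    - u 0 1 * (u 0 0 * v 0 1 - u 0 1 * v 0 0)); first by ring.
  by rewrite e1 e2; ring.
- transitivity (u 0 0 * (u 0 0 * v 0 1 - u 0 1 * v 0 0)
    - u 0 2 * (u 0 1 * v 0 2 - u 0 2 * v 0 1)); first by ring.
  by rewrite e2 e0; ring.
- transitivity (u 0 1 * (u 0 1 * v 0 2 - u 0 2 * v 0 1)
    - u 0 0 * (u 0 2 * v 0 0 - u 0 0 * v 0 2)); first by ring.
  by rewrite e1 e0; ring.
Qed.

End gradients.

(** * Frames *)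
Section frames.
Context {R : realType}.
Implicit Types (B : 'M[R]_3) (u w : R * R) (g p v : 'rV[R]_3).

Lemma row3 g B : g *m B = g 0 0 *: row 0 B + g 0 1 *: row 1 B + g 0 2 *: row 2 B.
Proof.
apply/rowP => j; rewrite !mxE !big_ord_recl big_ord0 addr0 addrA.
by congr (g _ _ * B _ _ + g _ _ * B _ _ + g _ _ * B _ _); exact: val_inj.
Qed.

Lemma affE B u : aff B u = row 0 B + u.1 *: row 1 B + u.2 *: row 2 B.
Proof. by rewrite /aff row3 !vec3E scale1r. Qed.

Lemma affB B u w : aff B u - aff B w = (u.1 - w.1) *: row 1 B + (u.2 - w.2) *: row 2 B.
Proof. by rewrite !affE; apply/rowP => j; rewrite !mxE; ring. Qed.

Lemma aff0 B : aff B (0, 0) = row 0 B.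
Proof. by rewrite affE !scale0r !addr0. Qed.

Lemma unitmx_inj B : (forall v, v *m B = 0 -> v = 0) -> B \in unitmx.
Proof.
move=> h; rewrite -row_free_unit -kermx_eq0; apply/rowV0P => v /sub_kermxP.
exact: h.
Qed.

Definition rows3 (p a b : 'rV[R]_3) : 'M[R]_3 := \matrix_(i, j) ([:: p; a; b]`_i) 0 j.

Lemma row_rows3 p a b :
  (row 0 (rows3 p a b) = p) * (row 1 (rows3 p a b) = a) * (row 2 (rows3 p a b) = b).
Proof. by do ![split]; apply/rowP => j; rewrite !mxE. Qed.

Lemma rows3_unit p a b :
  (forall x y z : R, x *: p + y *: a + z *: b = 0 -> x = 0 /\ y = 0 /\ z = 0) ->
  rows3 p a b \in unitmx.
Proof.
move=> h; apply: unitmx_inj => v; rewrite row3 !row_rows3 => /h[v0 [v1 v2]].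
rewrite [v]vec3_eta v0 v1 v2; apply/rowP => j; rewrite !mxE.
by case: j => -[|[|[|//]]].
Qed.

Lemma frame_exists p : p != 0 -> exists2 B, B \in unitmx & row 0 B = p.
Proof.
move=> p0.
have co (x y z : R) (a b : 'rV[R]_3) : x *: p + y *: a + z *: b = 0 -> [/\
   x * p 0 0 + y * a 0 0 + z * b 0 0 = 0, x * p 0 1 + y * a 0 1 + z * b 0 1 = 0 &
   x * p 0 2 + y * a 0 2 + z * b 0 2 = 0].
  by move=> /rowP e; split; [have := e 0|have := e 1|have := e 2]; rewrite !mxE.
have key (a b : 'rV[R]_3) : (forall x y z : R,
    x * p 0 0 + y * a 0 0 + z * b 0 0 = 0 -> x * p 0 1 + y * a 0 1 + z * b 0 1 = 0 ->
    x * p 0 2 + y * a 0 2 + z * b 0 2 = 0 -> x = 0 /\ y = 0 /\ z = 0) ->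
    exists2 B, B \in unitmx & row 0 B = p.
  move=> h; exists (rows3 p a b); last by rewrite row_rows3.
  by apply: rows3_unit => x y z /co[? ? ?]; exact: h.
have z0 (x t : R) : t != 0 -> x * t = 0 -> x = 0.
  by move=> t0 /eqP; rewrite mulf_eq0 (negbTE t0) orbF => /eqP.
have [p00|p00] := eqVneq (p 0 0) 0; last first.
  apply: (key (vec3 0 1 0) (vec3 0 0 1)) => x y z; rewrite !vec3E.
  rewrite !mulr0 !mulr1 !addr0 => /(z0 _ _ p00) ->; rewrite !mul0r !add0r => ->.
  by move=> ->.
have [p01|p01] := eqVneq (p 0 1) 0; last first.
  apply: (key (vec3 1 0 0) (vec3 0 0 1)) => x y z; rewrite !vec3E.
  rewrite !mulr0 !mulr1 !addr0 => + /(z0 _ _ p01) x0; rewrite x0 !mul0r !add0r => ->.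
  by move=> ->.
have p02 : p 0 2 != 0.
  apply: contra p0 => /eqP p02; rewrite [p]vec3_eta p00 p01 p02.
  by apply/eqP/rowP => j; rewrite !mxE; case: j => -[|[|[|//]]].
apply: (key (vec3 1 0 0) (vec3 0 1 0)) => x y z; rewrite !vec3E.
rewrite !mulr0 !mulr1 !addr0 => + + /(z0 _ _ p02) x0; rewrite x0 !mul0r !add0r => -> ->.
by [].
Qed.

Lemma frame_dotp0 B g u : B \in unitmx -> dotp g (aff B u) = 0 ->
  dotp g (row 1 B) = 0 -> dotp g (row 2 B) = 0 -> g = 0.
Proof.
move=> Bu g0 g1 g2.
have {}g0 : dotp g (row 0 B) = 0.
  transitivity (dotp g (aff B u) - u.1 * dotp g (row 1 B) - u.2 * dotp g (row 2 B)).
    by rewrite affE /dotp !mxE; ring.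
  by rewrite g0 g1 g2; ring.
have : g *m B^T = 0.
  rewrite [g *m _]vec3_eta; apply/rowP => j; rewrite [RHS]mxE.
  have e i : (g *m B^T) 0 i = dotp g (row i B).
    rewrite mxE !big_ord_recl big_ord0 addr0 addrA /dotp !mxE.
    by congr (g _ _ * B _ _ + g _ _ * B _ _ + g _ _ * B _ _); exact: val_inj.
  by rewrite mxE !e g0 g1 g2; case: j => -[|[|[|//]]].
move=> /(congr1 (fun x => x *m invmx B^T)); rewrite mulmxK ?unitmx_tr// mul0mx.
by [].
Qed.

Lemma frame_indep B : B \in unitmx -> forall k x y : R,
  x *: row 1 B + y *: row 2 B = k *: row 0 B -> x = 0 /\ y = 0.
Proof.
move=> Bu k x y e.
have : vec3 (- k) x y *m B = 0.
  rewrite row3 !vec3E -addrA e.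
  by rewrite scaleNr addNr.
move=> /(congr1 (fun z => z *m invmx B)); rewrite mulmxK// mul0mx => /rowP e'.
by split; [have := e' 1|have := e' 2]; rewrite !mxE.
Qed.

End frames.

Section continuity_lemmas.
Context {R : realType} {T : topologicalType}.
Implicit Types (x : T).

Lemma cts_vec3 (a b d : T -> R) x : {for x, continuous a} -> {for x, continuous b} ->
  {for x, continuous d} -> {for x, continuous (fun y => vec3 (a y) (b y) (d y))}.
Proof.
move=> ca cb cd; apply: cts_mx => i j.
have -> : (fun y => vec3 (a y) (b y) (d y) i j) =
   [:: a; b; d]`_j.
  by apply/funext => y; rewrite mxE; case: j => -[|[|[|//]]].
by case: j => -[|[|[|//]]] j3.
Qed.

Lemma cts_cross (f g : T -> 'rV[R]_3) x :
  {for x, continuous f} -> {for x, continuous g} ->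
  {for x, continuous (fun y => cross (f y) (g y))}.
Proof. by move=> cf cg; apply: cts_vec3; cts. Qed.

Lemma cts_cf (c : T -> 'rV[R]_15) k x : {for x, continuous c} ->
  {for x, continuous (fun y => cf (c y) k)}.
Proof. by move=> cc; rewrite /cf; cts. Qed.

Lemma cts_cubics (c : T -> 'rV[R]_15) (m : T -> 'I_3 -> 'I_3 -> 'I_3 -> R) x :
  {for x, continuous c} -> (forall i j k, {for x, continuous (fun y => m y i j k)}) ->
  {for x, continuous (fun y => cubics (c y) (m y))}.
Proof.
move=> cc cm; have ccf k := cts_cf (k := k) cc.
apply: cts_vec3; repeat apply: ctsD;
  (apply: ctsM; last exact: cm); try (apply: ctsM; first exact: cts_cst); exact: ccf.
Qed.

Lemma cts_grad (c : T -> 'rV[R]_15) (v : T -> 'rV[R]_3) x :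
  {for x, continuous c} -> {for x, continuous v} ->
  {for x, continuous (fun y => grad (c y) (v y))}.
Proof.
move=> cc cv.
have -> : (fun y => grad (c y) (v y)) =
   (fun y => cubics (c y) (fun i j k => v y 0 i * v y 0 j * v y 0 k)).
  by apply/funext => y; rewrite gradE.
by apply: cts_cubics => // i j k; cts.
Qed.

Lemma cts_dgrad (c : T -> 'rV[R]_15) (v w d : T -> 'rV[R]_3) x :
  {for x, continuous c} -> {for x, continuous v} -> {for x, continuous w} ->
  {for x, continuous d} ->
  {for x, continuous (fun y => dgrad (c y) (v y) (w y) (d y))}.
Proof.
move=> cc cv cw cd; apply: (@cts_cubics c (fun y => divdiff (v y) (w y) (d y))) => // i j k.
by rewrite /divdiff; cts.
Qed.

Lemma ctsDmx (f g : T -> 'rV[R]_3) x :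
  {for x, continuous f} -> {for x, continuous g} ->
  {for x, continuous (fun y => f y + g y)}.
Proof. exact: cvgD. Qed.

Lemma cts_eigfield (c : T -> 'rV[R]_15) (v : T -> 'rV[R]_3) x :
  {for x, continuous c} -> {for x, continuous v} ->
  {for x, continuous (fun y => eigfield (c y) (v y))}.
Proof. by move=> cc cv; apply: cts_cross => //; exact: cts_grad. Qed.

Lemma cts_deigfield (c : T -> 'rV[R]_15) (v w d : T -> 'rV[R]_3) x :
  {for x, continuous c} -> {for x, continuous v} -> {for x, continuous w} ->
  {for x, continuous d} ->
  {for x, continuous (fun y => deigfield (c y) (v y) (w y) (d y))}.
Proof.
move=> cc cv cw cd; apply: ctsDmx; apply: cts_cross => //; first exact: cts_grad.
exact: cts_dgrad.
Qed.

End continuity_lemmas.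

(** * Nondegenerate eigenvectors *)
Section eigenpoints.
Context {R : realType}.
Implicit Types (c : 'rV[R]_15) (p u v w : 'rV[R]_3).

Definition eigen c v := exists l : R, grad c v = l *: v.

Lemma dotpBl u v w : dotp (u - v) w = dotp u w - dotp v w.
Proof. by rewrite /dotp !mxE; ring. Qed.

Lemma dotpD2l (s t : R) u v w : dotp (s *: u + t *: v) w = s * dotp u w + t * dotp v w.
Proof. by rewrite /dotp !mxE; ring. Qed.

Lemma dotp0l w : dotp 0 w = 0.
Proof. by rewrite /dotp !mxE; ring. Qed.

Lemma cross_swapZ l u v : cross u (l *: v) = - cross v (l *: u).
Proof. by rewrite [LHS]vec3_eta [RHS]vec3_eta !mxE /= ?mxE; congr vec3; ring. Qed.

Lemma eigfield_eq0 c v : v != 0 -> eigfield c v = 0 <-> eigen c v.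
Proof. by move=> v0; exact: cross_eq0P. Qed.

Lemma gradZ c k v : grad c (k *: v) = k ^+ 3 *: grad c v.
Proof.
rewrite [LHS]vec3_eta [RHS]vec3_eta !mxE /= ?mxE /qx /qy /qz.
by congr vec3; ring.
Qed.

Lemma eigenZ c k v : eigen c v -> eigen c (k *: v).
Proof.
move=> [l e]; exists (k ^+ 2 * l); rewrite gradZ e !scalerA; congr (_ *: _).
by ring.
Qed.

(** Nondegeneracy of an eigenvector as a critical point of the form on the
    sphere, in Lagrange multiplier form. *)
Definition nondegenerate_eigen c p := forall (l : R), grad c p = l *: p ->
  forall (d : 'rV[R]_3) (m : R), hess c p d = l *: d + m *: p -> exists k, d = k *: p.

Definition eigenset c : set (RP2 R) :=
  [set x | exists v, [/\ v != 0, eigen c v & x = pt v]].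

Lemma det2_kernel (a11 a12 a21 a22 : R) : a11 * a22 - a12 * a21 = 0 ->
  exists s t, [/\ (s != 0) || (t != 0), s * a11 + t * a21 = 0 & s * a12 + t * a22 = 0].
Proof.
move=> d0.
have [a210|a210] := eqVneq a21 0; last first.
  exists a21, (- a11); rewrite a210; split => //; first by ring.
  by rewrite -[RHS]oppr0 -d0; ring.
have [a110|a110] := eqVneq a11 0; last first.
  exists 0, 1; rewrite oner_neq0 orbT a210; split => //; first by ring.
  move: d0; rewrite a210 mulr0 subr0 => /eqP; rewrite mulf_eq0 (negbTE a110) /=.
  by move=> /eqP->; ring.
have [a220|a220] := eqVneq a22 0; last first.
  by exists a22, (- a12); rewrite a220 a110 a210; split => //; ring.
have [a120|a120] := eqVneq a12 0.
  by exists 1, 0; rewrite oner_neq0 a110 a210 a120 a220; split => //; ring.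
by exists 0, 1; rewrite oner_neq0 orbT a210 a220; split => //; ring.
Qed.

Section at_eigenvector.
Context (B : 'M[R]_3) (c0 : 'rV[R]_15) (Bu : B \in unitmx)
  (e0 : eigen c0 (row 0 B)) (nd : nondegenerate_eigen c0 (row 0 B)).

Let F (j : 'I_3) c (u : R * R) := dotp (eigfield c (aff B u)) (row j B).
Let A (i j : 'I_3) (y : 'rV[R]_15 * ((R * R) * (R * R))) :=
  dotp (deigfield y.1 (aff B y.2.1) (aff B y.2.2) (row i B)) (row j B).

Lemma cts_aff (T : topologicalType) (f : T -> R * R) x :
  {for x, continuous f} -> {for x, continuous (fun y => aff B (f y))}.
Proof.
by move=> cf; apply: (@continuous_comp _ _ _ f (aff B) x cf); exact: continuous_aff.
Qed.

Let cA i j z : {for z, continuous (A i j)}.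
Proof.
have c1 : {for z, continuous (fun y : 'rV[R]_15 * ((R * R) * (R * R)) => aff B y.2.1)}.
  by apply: cts_aff; cts.
have c2 : {for z, continuous (fun y : 'rV[R]_15 * ((R * R) * (R * R)) => aff B y.2.2)}.
  by apply: cts_aff; cts.
have c3 : {for z, continuous (fun y : 'rV[R]_15 * ((R * R) * (R * R)) => y.1)} by cts.
have c4 := @cts_deigfield R _ fst (fun y => aff B y.2.1) (fun y => aff B y.2.2)
  (fun=> row i B) z c3 c1 c2 (@cts_cst _ _ (row i B) z).
exact: (@cts_dotp R _ _ (fun=> row j B) z c4 (@cts_cst _ _ (row j B) z)).
Qed.

Let cF j x : {for x, continuous (fun c => F j c (0, 0))}.
Proof.
have c1 := @cts_eigfield R _ id (fun=> aff B (0, 0)) x (@cvg_id _ _) (@cts_cst _ _ _ x).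
exact: (@cts_dotp R _ _ (fun=> row j B) x c1 (@cts_cst _ _ (row j B) x)).
Qed.

Let dF j c (u w : R * R) : F j c u - F j c w =
  (u.1 - w.1) * A 1 j (c, (u, w)) + (u.2 - w.2) * A 2 j (c, (u, w)).
Proof.
by rewrite /F -dotpBl eigfieldB affB deigfield_linear dotpD2l.
Qed.

Lemma eigfield_orth c v : dotp (eigfield c v) v = 0.
Proof. by rewrite /eigfield; move: (grad c v) => g; rewrite /dotp !mxE /=; ring. Qed.

Let F0 c (u : R * R) : F 1 c u = 0 -> F 2 c u = 0 -> eigen c (aff B u).
Proof.
move=> F1 F2; apply/eigfield_eq0; first exact: aff_neq0.
by apply: (frame_dotp0 (u := u) Bu) => //; exact: eigfield_orth.
Qed.

Let det0 : A 1 1 (c0, ((0, 0), (0, 0))) * A 2 2 (c0, ((0, 0), (0, 0)))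
         - A 1 2 (c0, ((0, 0), (0, 0))) * A 2 1 (c0, ((0, 0), (0, 0))) != 0.
Proof.
apply/negP => /eqP /det2_kernel[s [t [st0 h1 h2]]].
have [l gl] := e0; pose p := row 0 B; pose d := s *: row 1 B + t *: row 2 B.
have h (j : 'I_3) : dotp (deigfield c0 p p d) (row j B) =
    s * A 1 j (c0, ((0, 0), (0, 0))) + t * A 2 j (c0, ((0, 0), (0, 0))).
  by rewrite /A /= !aff0 deigfield_linear -/p dotpD2l.
have e : deigfield c0 p p d = cross p (hess c0 p d - l *: d).
  rewrite /deigfield -/(hess c0 p d) gl crossBr.
  have -> : cross p (l *: d) = - cross d (l *: p).
    exact: cross_swapZ.
  by rewrite opprK addrC.
have p0 : p != 0 by rewrite /p -aff0 aff_neq0.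
have : deigfield c0 p p d = 0.
  apply: (frame_dotp0 (u := (0, 0)) Bu); rewrite ?h ?h1 ?h2// aff0 -/p e.
  by move: (_ - _) => x; rewrite /dotp !mxE /=; ring.
rewrite e => /(cross_eq0P _ p0)[m hm].
have [k dk] : exists k, d = k *: p.
  by apply: (nd gl (m := m)); rewrite -hm addrC subrK.
have [s0 t0] := frame_indep Bu dk.
by move: st0; rewrite s0 t0 eqxx.
Qed.

(** In an affine chart two components of v x grad f(v) suffice to detect eigenvectors,
    because the field is orthogonal to v. Their Jacobian at the base point is invertible
    exactly when the Hessian condition of nondegeneracy holds. *)
Lemma eigen_persist : \forall r \near (0 : R)^'+, \forall c \near c0,
  exists u : R * R, [/\ box r u, eigen c (aff B u) &
    forall w : R * R, box r w -> eigen c (aff B w) -> w = u].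
Proof.
have F00 j : F j c0 (0, 0) = 0.
  rewrite /F aff0; have -> : eigfield c0 (row 0 B) = 0.
    by apply/eigfield_eq0 => //; rewrite -aff0 aff_neq0.
  exact: dotp0l.
have := @local_root R _ (F 1) (F 2) (A 1 1) (A 1 2) (A 2 1) (A 2 2) c0
  (dF 1) (dF 2) (@cA 1 1 _) (@cA 1 2 _) (@cA 2 1 _) (@cA 2 2 _)
  (@cF 1 _) (@cF 2 _) (F00 1) (F00 2) det0.
apply: filterS => r; apply: filterS => c [u [bu F1 F2 uu]].
exists u; split => //; first exact: F0.
move=> w bw /(eigfield_eq0 _ (aff_neq0 w Bu)) ew; apply: uu => //;
  by rewrite /F ew dotp0l.
Qed.

End at_eigenvector.

End eigenpoints.

(** * Stability of the number of eigenpoints *)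
Section stable_count.
Context {R : realType}.
Implicit Types (c : 'rV[R]_15) (p u v w : 'rV[R]_3) (B : 'M[R]_3).

Lemma compact_sphere : compact [set v : 'rV[R]_3 | `|v| = 1].
Proof.
apply: bounded_closed_compact.
  exists 1; split; first exact: num_real.
  by move=> M M1 v /= ->; exact: ltW.
have /continuous_closedP h : continuous (fun v : 'rV[R]_3 => `|v|).
  by move=> v; exact: norm_continuous.
apply: (h [set 1]); exact/accessible_closed_set1/hausdorff_accessible/norm_hausdorff.
Qed.

(** The cone of directions close to the origin of a chart. *)
Definition in_cone B (r : R) v := hcoord B v 0 0 != 0 /\ box r (dehom B v).

Lemma near_cone B r k : B \in unitmx -> 0 < r -> k != 0 ->
  \forall v \near k *: row 0 B, in_cone B r v.
Proof.
move=> Bu r0 k0.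
have h0 : hcoord B (k *: row 0 B) 0 0 != 0.
  by rewrite hcoordZ -aff0 hcoord_aff// vec3E mulr1.
have n1 : \forall v \near k *: row 0 B, hcoord B v 0 0 != 0.
  by apply: cts_neq0 => //; apply: cts_coord; exact: continuous_hcoord.
have n2 : \forall v \near k *: row 0 B, box r (dehom B v).
  apply: (continuous_dehom h0); rewrite dehomZ// -aff0 dehom_aff//.
  apply/nbhs_ballP; exists r => // u [/=]; rewrite /ball /= !sub0r !normrN => h1 h2.
  by split; exact: ltW.
by apply: filterS (filterI n1 n2) => v [].
Qed.

Lemma in_coneP B r v : B \in unitmx -> in_cone B r v ->
  exists2 k, k != 0 & v = k *: aff B (dehom B v).
Proof.
move=> Bu [h0 _]; exists (hcoord B v 0 0) => //; exact: aff_dehom.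
Qed.

(** The sphere is compact, so a closed homogeneous condition satisfied for c0 only on
    finitely many lines is satisfied for c near c0 only in cones around them. *)
Lemma cone_cover (E : 'rV[R]_15 -> 'rV[R]_3 -> Prop) n (B : 'I_n -> 'M[R]_3) c0 (r : R) :
  (forall c k v, E c v -> E c (k *: v)) ->
  (forall v, v != 0 -> ~ E c0 v -> \forall y \near (v, c0), ~ E y.2 y.1) ->
  (forall i, B i \in unitmx) -> 0 < r ->
  (forall v, v != 0 -> E c0 v -> exists i k, v = k *: row 0 (B i)) ->
  \forall c \near c0, forall v, v != 0 -> E c v -> exists i, in_cone (B i) r v.
Proof.
move=> EZ Ecl Bu r0 ex.
have nc : near_covering [set v : 'rV[R]_3 | `|v| = 1].
  by apply/compact_near_coveringP; exact: compact_sphere.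
have : \forall c \near c0, [set v : 'rV[R]_3 | `|v| = 1] `<=`
    (fun v => E c v -> exists i, in_cone (B i) r v).
  apply: (nc _ (nbhs c0) (fun c v => E c v -> exists i, in_cone (B i) r v)) => v /= v1.
  have v0 : v != 0 by rewrite -normr_eq0 v1 oner_eq0.
  have [ev|nev] := pselect (E c0 v); last first.
    by apply: filterS (Ecl v v0 nev) => -[v' c] /= h /h.
  have [i [k vk]] := ex v v0 ev.
  have k0 : k != 0 by apply: contra v0 => /eqP k0; rewrite vk k0 scale0r.
  exists (in_cone (B i) r, setT); last by move=> [v' c] /= [h _] _; exists i.
  by split; [rewrite vk; exact: near_cone|exact: filterT].
apply: filterS => c h v v0 ev.
have n0 : `|v|^-1 != 0 by rewrite invr_eq0 normr_eq0.
have /h : [set v : 'rV[R]_3 | `|v| = 1] (`|v|^-1 *: v).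
  by rewrite /= normrZ normfV normr_id mulVf// normr_eq0.
move=> /(_ (EZ _ _ _ ev))[i [hi bi]]; exists i; split.
  by move: hi; rewrite hcoordZ mulf_eq0 negb_or => /andP[].
by move: bi; rewrite dehomZ.
Qed.

Lemma eigen_closed c0 v : v != 0 -> ~ eigen c0 v ->
  \forall y \near (v, c0), ~ eigen y.2 y.1.
Proof.
move=> v0 nev; have nf : eigfield c0 v != 0 by apply/eqP => /(eigfield_eq0 _ v0).
have c1 : {for (v, c0), continuous (fun y : 'rV[R]_3 * 'rV[R]_15 => y.1)} by cts.
have c2 : {for (v, c0), continuous (fun y : 'rV[R]_3 * 'rV[R]_15 => y.2)} by cts.
have : \forall y \near (v, c0), eigfield y.2 y.1 != 0.
  exact: (@cts_eigfield R _ snd fst (v, c0) c2 c1 _ (nbhs_neq0 nf)).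
apply: filterS => -[v' c] /= /eqP h [l e]; apply: h; rewrite /eigfield e.
by rewrite [LHS]vec3_eta [RHS]vec3_eta !mxE /=; congr vec3; ring.
Qed.

Lemma cones_disjoint B B' : B \in unitmx -> B' \in unitmx ->
  cross (row 0 B) (row 0 B') != 0 ->
  \forall r \near (0 : R)^'+, forall v, in_cone B r v -> in_cone B' r v -> False.
Proof.
move=> Bu Bu' x0; pose o : R * R := (0, 0).
have cc : {for (o, o), continuous (fun y : (R * R) * (R * R) => cross (aff B y.1) (aff B' y.2))}.
  have c1 : {for (o, o), continuous (fun y : (R * R) * (R * R) => aff B y.1)}.
    by apply: (@cts_aff R B _ fst); exact: cvg_fst.
  have c2 : {for (o, o), continuous (fun y : (R * R) * (R * R) => aff B' y.2)}.
    by apply: (@cts_aff R B' _ snd); exact: cvg_snd.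
  exact: (cts_cross c1 c2).
have : nbhs (cross (aff B o) (aff B' o)) [set w | w != 0].
  by rewrite !aff0; exact: nbhs_neq0.
move=> /cc/nbhs_ballP[e /= e0 he].
near=> r => v v1 v2.
have [k k0 vk] := in_coneP Bu v1; have [l l0 vl] := in_coneP Bu' v2.
have re : r < e by near: r; exact: nbhs_right_lt.
have bb (u : R * R) : box r u -> ball o e u.
  by move=> [h1 h2]; split; rewrite /ball /= sub0r normrN; apply: le_lt_trans re.
have /negP := he (dehom B v, dehom B' v) (conj (bb _ v1.2) (bb _ v2.2)); apply.
apply/eqP/cross_eq0P; first exact: aff_neq0.
exists (l^-1 * k); by rewrite /= -scalerA -vk [in RHS]vl scalerA mulVf// scale1r.
Unshelve. all: by end_near. Qed.

(** Each nondegenerate eigenvector persists and stays unique in a small cone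
    around it; outside of these cones compactness excludes eigenvectors. *)
Theorem stable_count n (P : 'I_n -> 'rV[R]_3) c0 :
  (forall i, P i != 0) -> (forall i j, i != j -> cross (P i) (P j) != 0) ->
  (forall i, eigen c0 (P i)) ->
  (forall i, nondegenerate_eigen c0 (P i)) ->
  (forall v, v != 0 -> eigen c0 v -> exists i k, v = k *: P i) ->
  \forall c \near c0, (eigenset c #= `I_n)%card.
Proof.
move=> P0 Pij Pe Pn ex.
have [B BP] : exists B : 'I_n -> 'M[R]_3, forall i, B i \in unitmx /\ row 0 (B i) = P i.
  have /choice[B BP] : forall i, exists B, B \in unitmx /\ row 0 B = P i.
    by move=> i; have [B Bu Bp] := frame_exists (P0 i); exists B.
  by exists B.
have Bu i : B i \in unitmx by have [] := BP i.
have Bp i : row 0 (B i) = P i by have [] := BP i.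
have h1 : \forall r \near (0 : R)^'+, forall i, \forall c \near c0,
    exists u : R * R, [/\ box r u, eigen c (aff (B i) u) &
    forall w : R * R, box r w -> eigen c (aff (B i) w) -> w = u].
  by apply: filter_forall => i; apply: eigen_persist; rewrite ?Bp.
have h2 : \forall r \near (0 : R)^'+, forall i j, i != j ->
    forall v, in_cone (B i) r v -> in_cone (B j) r v -> False.
  apply: filter_forall => i; apply: filter_forall => j.
  have [ij|ij] := eqVneq i j; first by near=> r.
  have := @cones_disjoint (B i) (B j) (Bu i) (Bu j); rewrite !Bp => /(_ (Pij i j ij)).
  by apply: filterS => r h _.
near (0 : R)^'+ => r.
have r0 : 0 < r by near: r; exact: nbhs_right_gt.
have g1 : forall i, \forall c \near c0, exists u : R * R, [/\ box r u, eigen c (aff (B i) u) &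
    forall w : R * R, box r w -> eigen c (aff (B i) w) -> w = u] by near: r.
have g2 : forall i j, i != j ->
    forall v, in_cone (B i) r v -> in_cone (B j) r v -> False by near: r.
have h3 : \forall c \near c0, forall v, v != 0 -> eigen c v -> exists i, in_cone (B i) r v.
  apply: cone_cover => //; [by move=> c k v; exact: eigenZ|exact: eigen_closed|].
  by move=> v v0 /(ex v v0)[i [k ->]]; exists i, k; rewrite Bp.
have {}g1 := @filter_forall _ _ _ (nbhs c0) (nbhs_filter c0) g1.
apply: filterS (filterI g1 h3) => c [/choice[u uP] cov].
have cone_aff i (w : R * R) : box r w -> in_cone (B i) r (aff (B i) w).
  by move=> bw; split; rewrite ?dehom_aff// hcoord_aff// vec3E oner_neq0.
have -> : eigenset c = (fun i => pt (aff (B i) (u i))) @` [set: 'I_n].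
  apply/seteqP; split => [x [v [v0 ev ->]]|_ [i _ <-]]; last first.
    exists (aff (B i) (u i)); split => //; first exact: aff_neq0.
    by have [] := uP i.
  have [i iv] := cov v v0 ev; exists i => //.
  have [bu eu uu] := uP i; have [k k0 vk] := in_coneP (Bu i) iv.
  have <- : dehom (B i) v = u i.
    apply: uu; first by have [] := iv.
    have -> : aff (B i) (dehom (B i) v) = k^-1 *: v by rewrite [in RHS]vk scalerA mulVf// scale1r.
    exact: eigenZ.
  by rewrite [in RHS]vk ptZ// aff_neq0.
apply: card_eq_trans (card_esym card_II).
apply: inj_card_eq => i j _ _ /(pt_eqP (aff_neq0 _ (Bu i)) (aff_neq0 _ (Bu j)))[k k0 e].
apply/eqP/negPn/negP => ij.
have [bi _ _] := uP i; have [bj _ _] := uP j.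
apply: (g2 i j ij (aff (B i) (u i))); first exact: cone_aff.
have [] := cone_aff j (u j) bj => hj bj'; rewrite e; split.
  by rewrite hcoordZ mulf_neq0.
by rewrite dehomZ.
Unshelve. all: by end_near. Qed.

End stable_count.

(** * Zeros of functions along rays *)
Section taylor.
Context {R : realType}.
Implicit Types (c : 'rV[R]_15) (p d v : 'rV[R]_3) (u w : R * R).

Lemma ev_taylor c p d s : ev c (p + s *: d) =
  ev c p + s * dotp (grad c p) d + s ^+ 2 * (dotp (hess c p d) d / 2)
  + s ^+ 3 * dotp (grad c d) p + s ^+ 4 * ev c d.
Proof.
rewrite /ev /dotp /hess /dgrad /cubics /divdiff !mxE /= /qform /qx /qy /qz.
by field.
Qed.

Lemma evZ c k v : ev c (k *: v) = k ^+ 4 * ev c v.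
Proof. by rewrite /ev /qform !mxE; ring. Qed.

Lemma ev_grad c v : dotp (grad c v) v = 4 * ev c v.
Proof. by rewrite /ev /dotp !mxE /= /qform /qx /qy /qz; ring. Qed.

Lemma hess_sym c p d e : dotp (hess c p d) e = dotp (hess c p e) d.
Proof. by rewrite /hess /dgrad /cubics /divdiff /dotp !mxE /=; ring. Qed.

Lemma cts_ev (T : topologicalType) (c : T -> 'rV[R]_15) (v : T -> 'rV[R]_3) x :
  {for x, continuous c} -> {for x, continuous v} ->
  {for x, continuous (fun y => ev (c y) (v y))}.
Proof.
move=> cc cv.
have -> : (fun y => ev (c y) (v y)) = (fun y => 4^-1 * dotp (grad (c y) (v y)) (v y)).
  by apply/funext => y; rewrite ev_grad mulrA mulVf ?mul1r// pnatr_eq0.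
apply: ctsM; first exact: cts_cst.
by apply: cts_dotp => //; exact: cts_grad.
Qed.

End taylor.

Section planar.
Context {R : realType}.
Implicit Types (u w : R * R) (h : R * R -> R).

Lemma sign_change (g : R -> R) (a b : R) : a < b -> continuous g -> g a < 0 -> 0 < g b ->
  (forall s t, a < s < b -> a < t < b -> g s = 0 -> g t = 0 -> s = t) ->
  exists s0, [/\ a < s0 < b, g s0 = 0, forall s, a <= s < s0 -> g s < 0 &
    forall s, s0 < s <= b -> 0 < g s].
Proof.
move=> ab cg ga gb un.
have ivt x y : a <= x -> x <= y -> y <= b -> g x <= 0 -> 0 <= g y ->
    exists2 z, x <= z <= y & g z = 0.
  move=> ax xy yb gx gy.
  have h0 : Num.min (g x) (g y) <= 0 <= Num.max (g x) (g y).
    by rewrite ge_min gx le_max gy orbT.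
  have [z] := @IVT R g x y 0 xy (continuous_subspaceT cg) h0.
  by rewrite in_itv => zxy gz; exists z.
have interior z : a <= z <= b -> g z = 0 -> a < z < b.
  move=> /andP[az zb] gz; rewrite !lt_neqAle az zb !andbT; apply/andP; split.
    by apply/eqP => e; move: ga; rewrite e gz ltxx.
  by apply/eqP => e; move: gb; rewrite -e gz ltxx.
have [s0 s0i g0] := ivt a b (lexx _) (ltW ab) (lexx _) (ltW ga) (ltW gb).
have s0ab := interior s0 s0i g0; have /andP[as0 s0b] := s0ab.
exists s0; split => // s /andP[h1 h2].
- rewrite ltNge; apply/negP => gs.
  have sb : s <= b by apply/ltW/(lt_trans h2).
  have [z /andP[z1 z2] gz] := ivt a s (lexx _) h1 sb (ltW ga) gs.
  have zi : a < z < b by apply: interior => //; rewrite z1 (le_trans z2).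
  have := un z s0 zi s0ab gz g0 => zs.
  by move: h2; rewrite -zs ltNge z2.
- rewrite ltNge; apply/negP => gs.
  have as_ : a <= s by apply/ltW/(lt_trans as0).
  have [z /andP[z1 z2] gz] := ivt s b as_ h2 (lexx _) gs (ltW gb).
  have zi : a < z < b by apply: interior => //; rewrite (le_trans as_ z1).
  have := un z s0 zi s0ab gz g0 => zs.
  by move: h1; rewrite -zs ltNge z1.
Qed.

Lemma open_below h (b : R) : continuous h -> open [set u | h u < b].
Proof. by move/continuousP/(_ [set x | x < b]); apply; exact: open_lt. Qed.

Lemma open_above h (b : R) : continuous h -> open [set u | b < h u].
Proof. by move/continuousP/(_ [set x | b < x]); apply; exact: open_gt. Qed.

Let enorm_ray (s : R) w : enorm w = 1 -> 0 <= s -> enorm (scl s w) = s.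
Proof. by move=> w1 s0; rewrite enorm_scl w1 mulr1 ger0_norm. Qed.

Let cts_ray h w : continuous h -> continuous (fun s => h (scl s w)).
Proof. by move=> ch s; apply: continuous_comp; [exact: continuous_ray|exact: ch]. Qed.

(** By the intermediate value theorem there is exactly one zero on each radius; the zeros
    form the unit sphere of the gauge of the region where h is negative. *)
Lemma star_small h r : 0 < r -> continuous h -> h (0, 0) < 0 ->
  (forall u, enorm u = r -> 0 < h u) ->
  (forall w, enorm w = 1 -> forall s t, 0 < s < r -> 0 < t < r ->
     h (scl s w) = 0 -> h (scl t w) = 0 -> s = t) ->
  exists N, [/\ gauge N, forall u, N u < 1 <-> enorm u < r /\ h u < 0 &
     forall u, N u = 1 <-> enorm u < r /\ h u = 0].
Proof.
move=> r0 ch h0 hr un.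
pose I := [set u | enorm u < r /\ h u < 0].
pose J := [set u | r < enorm u \/ 0 < h u].
have oI : open I by apply: openI; apply: open_below => //; exact: continuous_enorm.
have oJ : open J by apply: openU; apply: open_above => //; exact: continuous_enorm.
have IJ u : I u -> ~ J u.
  by move=> [h1 h2] []; apply/negP; rewrite -leNgt ltW.
have [w w1|N [gN NI N1]] := star_gauge oI oJ IJ.
  have [||s0 [/andP[s00 s0r] _ sl sr]] :=
      sign_change r0 (cts_ray (w := w) ch) _ _ (un w w1).
  - by rewrite scl0.
  - by apply: hr; rewrite enorm_ray// ltW.
  exists s0; split => // [s /andP[s1 s2]|s s1].
    split; first by rewrite enorm_ray// (lt_trans s2).
    by apply: sl; rewrite s1.
  rewrite /J /= enorm_ray//; last by apply/ltW/(lt_trans s00).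
  case: (leP s r) => s2; last by left.
  by right; apply: sr; rewrite s1.
exists N; split => // u; rewrite N1 /I /J /=; split => [[n1 n2]|[h1 ->]]; last first.
  rewrite ltxx; split; first by case.
  by case=> //; rewrite ltNge (ltW h1).
have ur : enorm u <= r by rewrite leNgt; apply/negP => ?; apply: n2; left.
have hu : h u <= 0 by rewrite leNgt; apply/negP => ?; apply: n2; right.
have ur' : enorm u < r.
  by rewrite lt_neqAle ur andbT; apply/eqP => /hr; rewrite ltNge hu.
split => //; apply/eqP; rewrite eq_le hu /= leNgt; apply/negP => hu'.
by apply: n1.
Qed.

(** The same argument outside the unit disc; the region of the gauge contains that disc. *)
Lemma star_large h : continuous h ->
  (forall w, enorm w = 1 -> h w < 0) ->
  (forall w, enorm w = 1 -> exists b, forall s, b < s -> 0 < h (scl s w)) ->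
  (forall w, enorm w = 1 -> forall s t, 1 < s -> 1 < t ->
     h (scl s w) = 0 -> h (scl t w) = 0 -> s = t) ->
  exists N, [/\ gauge N, forall u, N u < 1 <-> enorm u < 1 \/ h u < 0 &
     forall u, N u = 1 <-> 1 < enorm u /\ h u = 0].
Proof.
move=> ch h1 hb un.
pose I := [set u | enorm u < 1 \/ h u < 0].
pose J := [set u | 1 < enorm u /\ 0 < h u].
have oI : open I by apply: openU; apply: open_below => //; exact: continuous_enorm.
have oJ : open J by apply: openI; apply: open_above => //; exact: continuous_enorm.
have IJ u : I u -> ~ J u.
  by move=> [] g1 [g2 g3]; [move: g2|move: g3]; apply/negP; rewrite -leNgt ltW.
have [w w1|N [gN NI N1]] := star_gauge oI oJ IJ.
  have [b gb] := hb w w1; pose M := Num.max b 1 + 1.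
  have bM : b < M by rewrite /M ltr_pwDr// le_max lexx.
  have M1 : 1 < M by rewrite /M ltr_pwDr// le_max lexx orbT.
  have [|||s0 [/andP[s01 s0M] _ sl sr]] := sign_change M1 (cts_ray (w := w) ch).
  - by rewrite scl1; exact: h1.
  - exact: gb.
  - by move=> s t /andP[s1 _] /andP[t1 _]; exact: un.
  have s00 : 0 < s0 by apply: lt_trans s01.
  exists s0; split => // [s /andP[s1 s2]|s s1].
    rewrite /I /= enorm_ray//; case: (ltP s 1) => s3; first by left.
    by right; apply: sl; rewrite s3.
  rewrite /J /= enorm_ray//; last by apply/ltW/(lt_trans s00).
  split; first exact: lt_trans s1.
  case: (leP s M) => s3; first by apply: sr; rewrite s1.
  by apply: gb; exact: lt_trans s3.
exists N; split => // u; rewrite N1 /I /J /=; split => [[n1 n2]|[k1 ->]]; last first.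
  rewrite ltxx; split; last by case.
  by case=> //; rewrite ltNge (ltW k1).
have ur : 1 <= enorm u by rewrite leNgt; apply/negP => ?; apply: n1; left.
have hu : 0 <= h u by rewrite leNgt; apply/negP => ?; apply: n1; right.
have ur' : 1 < enorm u.
  by rewrite lt_neqAle ur andbT; apply/eqP => e; move: (h1 u (esym e)); rewrite ltNge hu.
split => //; apply/eqP; rewrite eq_le hu andbT leNgt; apply/negP => hu'.
by apply: n2.
Qed.

End planar.

(** * Small ovals around the zeros of nonnegative forms *)
Section nonnegative_forms.
Context {R : realType}.
Implicit Types (c g : 'rV[R]_15) (p d v e : 'rV[R]_3) (u w : R * R) (B : 'M[R]_3).

(** Let s tend to 0. *)
Lemma poly_ge0_const (a b b' b'' : R) :
  (forall s, 0 < s -> s <= 1 -> 0 <= a + s * b + s ^+ 2 * b' + s ^+ 3 * b'') -> 0 <= a.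
Proof.
move=> h; rewrite leNgt; apply/negP => a0.
pose K := `|b| + `|b'| + `|b''| + 1.
have K0 : 0 < K by rewrite /K ltr_wpDl// !addr_ge0.
pose s := Num.min 1 (- a / (2 * K)).
have s0 : 0 < s by rewrite lt_min ltr01 divr_gt0 ?oppr_gt0 ?mulr_gt0.
have s1 : s <= 1 by rewrite ge_min lexx.
have s2 : s * (2 * K) <= - a.
  by rewrite -ler_pdivlMr ?mulr_gt0// ge_min lexx orbT.
have := h s s0 s1; apply/negP; rewrite -ltNge.
have t2 : s ^+ 2 <= s by rewrite expr2; apply: ler_piMl => //; exact: ltW.
have t3 : s ^+ 3 <= s by rewrite exprS; apply: ler_piMr; [exact: ltW|exact: le_trans t2 s1].
have t20 : 0 <= s ^+ 2 by exact: sqr_ge0.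
have t30 : 0 <= s ^+ 3 by rewrite exprn_ge0// ltW.
have m (x y : R) : 0 <= y -> y <= s -> y * x <= s * `|x|.
  move=> y0 ys; apply: le_trans (ler_norm _) _; rewrite normrM ger0_norm//.
  by rewrite ler_wpM2r.
have := m b s (ltW s0) (lexx _); have := m b' _ t20 t2; have := m b'' _ t30 t3.
by move: s2; rewrite /K; nra.
Qed.

Definition dir B w : 'rV[R]_3 := w.1 *: row 1 B + w.2 *: row 2 B.

Lemma aff_scl B s w : aff B (scl s w) = row 0 B + s *: dir B w.
Proof. by rewrite affE /dir scalerDr !scalerA addrA. Qed.

Lemma dir_nparallel B w k : B \in unitmx -> w != (0, 0) -> dir B w = k *: row 0 B -> False.
Proof. by move=> Bu w0 /(frame_indep Bu)[w1 w2]; move: w0; rewrite [w]surjective_pairing w1 w2 eqxx. Qed.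

Section zero.
Context (g : 'rV[R]_15) (p : 'rV[R]_3).
Context (g0 : forall v, 0 <= ev g v) (gp : ev g p = 0).

Lemma psd_grad0 : grad g p = 0.
Proof.
have h d : 0 <= dotp (grad g p) d.
  apply: (@poly_ge0_const _ (dotp (hess g p d) d / 2) (dotp (grad g d) p) (ev g d)) => s s0 s1.
  have := g0 (p + s *: d); rewrite ev_taylor gp.
  set a := dotp _ d; set b := _ / 2; set b' := dotp _ p; set b'' := ev g d => ge0.
  have : 0 <= s * (a + s * b + s ^+ 2 * b' + s ^+ 3 * b'').
    by apply: le_trans ge0 _; rewrite le_eqVlt; apply/orP; left; apply/eqP; ring.
  by rewrite pmulr_rge0.
apply/eqP/negPn/negP => n0; have := h (- grad g p).
have := dotpp_gt0 n0; have -> : dotp (grad g p) (- grad g p) = - dotp (grad g p) (grad g p).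
  by move: (grad g p) => x; rewrite /dotp !mxE; ring.
by lra.
Qed.

Lemma psd_hess_ge0 d : 0 <= dotp (hess g p d) d.
Proof.
suff : 0 <= dotp (hess g p d) d / 2 by lra.
apply: (@poly_ge0_const _ (dotp (grad g d) p) (ev g d) 0) => s s0 s1.
have := g0 (p + s *: d); rewrite ev_taylor gp psd_grad0 dotp0l.
set b := _ / 2; set b' := dotp _ p; set b'' := ev g d => ge0.
have : 0 <= s ^+ 2 * (b + s * b' + s ^+ 2 * b'' + s ^+ 3 * 0).
  by apply: le_trans ge0 _; rewrite le_eqVlt; apply/orP; left; apply/eqP; ring.
by rewrite pmulr_rge0// exprn_gt0.
Qed.

(** A vector isotropic for the semidefinite Hessian lies in its kernel, so it is
    radial by nondegeneracy. *)
Lemma psd_hess_gt0 d : nondegenerate_eigen g p -> (forall k, d <> k *: p) ->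
  0 < dotp (hess g p d) d.
Proof.
move=> nd dp; rewrite lt_neqAle psd_hess_ge0 andbT; apply/eqP => d0.
have h e : 0 <= dotp (hess g p d) e.
  suff : 0 <= 2 * dotp (hess g p d) e by lra.
  apply: (@poly_ge0_const _ (dotp (hess g p e) e) 0 0) => s s0 s1.
  have := psd_hess_ge0 (1 *: d + s *: e).
  rewrite {1}/hess dgrad_linear -!/(hess _ _ _).
  have -> : dotp (1 *: hess g p d + s *: hess g p e) (1 *: d + s *: e) =
     dotp (hess g p d) d + s * dotp (hess g p d) e + s * dotp (hess g p e) d
       + s ^+ 2 * dotp (hess g p e) e.
    move: (hess g p d) (hess g p e) => x y.
    by rewrite /dotp !mxE; ring.
  rewrite -d0 (hess_sym g p e d) => ge0.
  have : 0 <= s * (2 * dotp (hess g p d) e + s * dotp (hess g p e) e + s ^+ 2 * 0 + s ^+ 3 * 0).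
    by apply: le_trans ge0 _; rewrite le_eqVlt; apply/orP; left; apply/eqP; ring.
  by rewrite pmulr_rge0.
have H0 : hess g p d = 0.
  apply/eqP/negPn/negP => n0; have := h (- hess g p d).
  have := dotpp_gt0 n0; have -> : dotp (hess g p d) (- hess g p d) = - dotp (hess g p d) (hess g p d).
    by move: (hess g p d) => x; rewrite /dotp !mxE; ring.
  by lra.
have [k dk] : exists k, d = k *: p.
  by apply: (nd 0 _ d 0); rewrite ?psd_grad0 ?scale0r ?H0 ?addr0.
exact: (dp k).
Qed.

End zero.

(** The divided difference of s |-> (f(p + s d) - f(p)) / s. Where it is positive and
    f(p) < 0, the quotient f(p + s d) / s is increasing in s > 0. *)
Definition slope c p d (s t : R) : R := dotp (hess c p d) d / 2
  + (s + t) * dotp (grad c d) p + (s ^+ 2 + s * t + t ^+ 2) * ev c d.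

Lemma slopeE c p d s t :
  s * ev c (p + t *: d) - t * ev c (p + s *: d) =
  (t - s) * (s * t * slope c p d s t - ev c p).
Proof. by rewrite !ev_taylor /slope; ring. Qed.

Lemma cts_hess (T : topologicalType) (c : T -> 'rV[R]_15) (v d : T -> 'rV[R]_3) x :
  {for x, continuous c} -> {for x, continuous v} ->
  {for x, continuous d} ->
  {for x, continuous (fun y => hess (c y) (v y) (d y))}.
Proof. by move=> cc cv cd; exact: (@cts_dgrad R T c v v d x cc cv cv cd). Qed.

Lemma cts_slope (T : topologicalType) (c : T -> 'rV[R]_15) p (d : T -> 'rV[R]_3)
    (s t : T -> R) x :
  {for x, continuous c} -> {for x, continuous d} -> {for x, continuous s} ->
  {for x, continuous t} ->
  {for x, continuous (fun y => slope (c y) p (d y) (s y) (t y))}.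
Proof.
move=> cc cd cs ct; rewrite /slope.
have cp : {for x, continuous (fun _ : T => p)} by exact: cts_cst.
have h1 := cts_dotp (cts_hess cc cp cd) cd.
have h2 := cts_dotp (cts_grad cc cd) cp.
have h3 := cts_ev cc cd.
apply: (@ctsD _ _ (fun y => dotp (hess (c y) p (d y)) (d y) / 2
  + (s y + t y) * dotp (grad (c y) (d y)) p)
  (fun y => (s y ^+ 2 + s y * t y + t y ^+ 2) * ev (c y) (d y))).
  apply: (@ctsD _ _ (fun y => dotp (hess (c y) p (d y)) (d y) / 2)).
    by apply: (@ctsM _ _ (fun y => dotp (hess (c y) p (d y)) (d y))) => //; exact: cts_cst.
  apply: (@ctsM _ _ (fun y => s y + t y)) => //.
  exact: ctsD.
apply: (@ctsM _ _ (fun y => s y ^+ 2 + s y * t y + t y ^+ 2)) => //.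
by cts.
Qed.

Lemma cts_dir (T : topologicalType) B (f : T -> R * R) x : {for x, continuous f} ->
  {for x, continuous (fun y => dir B (f y))}.
Proof.
move=> cf; apply: cts_mx => i j.
have -> : (fun y => dir B (f y) i j) = (fun y => (f y).1 * B 1 j + (f y).2 * B 2 j).
  by apply/funext => y; rewrite !mxE.
by cts.
Qed.

(** At s = t = 0 and for the form g itself, the slope is half of the Hessian in a
    tangent direction, hence positive; the circle of directions is compact. *)
Lemma zero_local g B : B \in unitmx -> (forall v, 0 <= ev g v) -> ev g (row 0 B) = 0 ->
  nondegenerate_eigen g (row 0 B) ->
  \forall r \near (0 : R)^'+, \forall c \near g,
    (forall w, enorm w = 1 -> 0 < ev c (aff B (scl r w))) /\
    (forall w s t, enorm w = 1 -> 0 <= s <= r -> 0 <= t <= r ->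
       0 < slope c (row 0 B) (dir B w) s t).
Proof.
move=> Bu g0 gp nd; set p := row 0 B.
have nc := @compact_unit_circle R; move/compact_near_coveringP in nc.
have dirn w : enorm w = 1 -> forall k, dir B w <> k *: p.
  move=> w1 k; apply: dir_nparallel => //; rewrite -enorm_eq0 w1; exact: oner_neq0.
have S : \forall y \near (g, ((0, 0) : R * R)), unit_circle R `<=`
    (fun w => 0 < slope y.1 p (dir B w) y.2.1 y.2.2).
  apply: (nc _ (nbhs (g, ((0, 0) : R * R))) (fun y w => 0 < slope y.1 p (dir B w) y.2.1 y.2.2)) => w.
  rewrite unit_circle_enorm /= => w1.
  have : \forall z \near (w, (g, ((0, 0) : R * R))),
      0 < slope z.2.1 p (dir B z.1) z.2.2.1 z.2.2.2.
    apply: (@cts_lt _ _ (fun=> 0)).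
    - exact: cts_cst.
    - apply: (@cts_slope _ (fun z => z.2.1) p (fun z => dir B z.1)
        (fun z => z.2.2.1) (fun z => z.2.2.2)); [cts| |cts|cts].
      by apply: (@cts_dir _ B fst); exact: cvg_fst.
    rewrite /slope /= expr0n /= !(addr0, mulr0, mul0r).
    by rewrite divr_gt0//; apply: psd_hess_gt0 => //; exact: dirn.
  by [].
case: S => -[U V] /= [nU nV] UV.
have /nbhs_ballP[e /= e0 eV] := nV.
near=> r.
have r0 : 0 < r by near: r; exact: nbhs_right_gt.
have re : r < e by near: r; exact: nbhs_right_lt.
have sl c : U c -> forall w s t, enorm w = 1 -> 0 <= s <= r -> 0 <= t <= r ->
    0 < slope c p (dir B w) s t.
  move=> Uc w s t w1 /andP[s0 sr] /andP[t0 tr].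
  have := UV (c, (s, t)); apply; last by rewrite unit_circle_enorm.
  split => //=; apply: eV; split; rewrite /ball /= sub0r normrN ger0_norm//.
    exact: le_lt_trans re.
  exact: le_lt_trans re.
have rim : \forall c \near g, unit_circle R `<=` (fun w => 0 < ev c (aff B (scl r w))).
  apply: (nc _ (nbhs g) (fun c w => 0 < ev c (aff B (scl r w)))) => w.
  rewrite unit_circle_enorm /= => w1.
  have : \forall z \near (w, g), 0 < ev z.2 (aff B (scl r z.1)).
    apply: (@cts_lt _ _ (fun=> 0)).
    - exact: cts_cst.
    - apply: (@cts_ev _ _ snd (fun z => aff B (scl r z.1))); first exact: cvg_snd.
      apply: (@cts_aff _ B _ (fun z => scl r z.1)).
      by apply: (@continuous_scl _ _ (fun=> r) fst); [exact: cts_cst|exact: cvg_fst].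
    have h : 0 < slope g p (dir B w) r 0.
      by apply: sl => //; rewrite ?lexx ?(ltW r0)//; exact: nbhs_singleton nU.
    move: h; rewrite /= aff_scl -/p ev_taylor gp psd_grad0// dotp0l /slope.
    rewrite expr0n /= !(addr0, add0r, mulr0) => h.
    set a := _ / 2 in h *; set b := dotp _ p in h *; set b' := ev g _ in h *.
    have -> : r ^+ 2 * a + r ^+ 3 * b + r ^+ 4 * b' = r ^+ 2 * (a + r * b + r ^+ 2 * b') by ring.
    by rewrite mulr_gt0// exprn_gt0.
  by [].
have nU' : \forall c \near g, U c by [].
apply: filterS (filterI nU' rim) => c [Uc rimc]; split; last exact: sl.
by move=> w w1; apply: rimc; rewrite unit_circle_enorm.
Unshelve. all: by end_near. Qed.

(** On each ray f(p + s d) / s is increasing for 0 < s <= r, so f has at most one zero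
    there; its sign at p and on the rim shows that there is one. *)
Lemma small_oval c B r : B \in unitmx -> 0 < r -> ev c (row 0 B) < 0 ->
  (forall w, enorm w = 1 -> 0 < ev c (aff B (scl r w))) ->
  (forall w s t, enorm w = 1 -> 0 <= s <= r -> 0 <= t <= r ->
       0 < slope c (row 0 B) (dir B w) s t) ->
  exists N, gauge N /\ forall u, N u = 1 <-> enorm u < r /\ ev c (aff B u) = 0.
Proof.
move=> Bu r0 cp rim sl.
have [||||N [gN _ N1]] := @star_small R (fun u => ev c (aff B u)) r r0; last by exists N.
- move=> u; apply: (@cts_ev _ _ (fun=> c) (aff B)); first exact: cts_cst.
  exact: continuous_aff.
- by rewrite aff0.
- move=> u ur; have u0 : u != (0, 0) by rewrite -enorm_eq0 ur gt_eqF.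
  by have [w w1 ->] := unit_dir u0; rewrite ur; exact: rim.
move=> w w1 s t /andP[s0 sr] /andP[t0 tr]; rewrite !aff_scl => hs ht.
have := slopeE c (row 0 B) (dir B w) s t; rewrite hs ht !mulr0 subrr => /esym/eqP.
have st := sl w s t w1; rewrite (ltW s0) (ltW sr) (ltW t0) (ltW tr) in st.
have {}st := st isT isT.
rewrite mulf_eq0 => /orP[|]; first by rewrite subr_eq0 => /eqP.
have : 0 < s * t * slope c (row 0 B) (dir B w) s t - ev c (row 0 B).
  by rewrite subr_gt0; apply: lt_trans cp _; rewrite !mulr_gt0.
by move=> /gt_eqF ->.
Qed.

End nonnegative_forms.

(** * Stability of arrangements of non nested ovals *)
Section stable_ovals.
Context {R : realType}.
Implicit Types (c g : 'rV[R]_15) (p d v e : 'rV[R]_3) (u w : R * R) (B : 'M[R]_3).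

Definition zeroset c : set (RP2 R) :=
  [set x | exists v, [/\ v != 0, ev c v = 0 & x = pt v]].

Lemma enorm_coord u : `|u.1| <= enorm u /\ `|u.2| <= enorm u.
Proof. by rewrite -!sqrtr_sqr /enorm !ler_wsqrtr// ?lerDl ?lerDr sqr_ge0. Qed.

Lemma enorm_box r u : enorm u <= r -> box r u.
Proof. by move=> ur; have [h1 h2] := enorm_coord u; split; exact: le_trans ur. Qed.

Lemma box_enorm r u : 0 < r -> box (r / 2) u -> enorm u < r.
Proof.
move=> r0 [h1 h2]; rewrite -[X in _ < X](ger0_norm (ltW r0)) -sqrtr_sqr /enorm ltr_sqrt ?exprn_gt0//.
move: h1 h2; rewrite !ler_norml => /andP[? ?] /andP[? ?]; nra.
Qed.

(** One of the two coordinate lines through the origin of the chart B misses the origin of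
    the chart B', hence also a small box around it. *)
Lemma separating_line B B' : B \in unitmx -> B' \in unitmx ->
  cross (row 0 B) (row 0 B') != 0 ->
  \forall r \near (0 : R)^'+, exists2 w, w != (0, 0) &
    forall u, box r u -> dotp (cross (row 0 B) (dir B w)) (aff B' u) != 0.
Proof.
move=> Bu Bu' x0.
have [w w0 wz] : exists2 w, w != (0, 0) & dotp (cross (row 0 B) (dir B w)) (row 0 B') != 0.
  have e1 : dir B (1, 0) = row 1 B by rewrite /dir scale1r scale0r addr0.
  have e2 : dir B (0, 1) = row 2 B by rewrite /dir scale1r scale0r add0r.
  have tri (a b d : 'rV[R]_3) : dotp (cross a b) d = - dotp (cross a d) b.
    by rewrite /dotp !mxE /=; ring.
  have [h1|h1] := eqVneq (dotp (cross (row 0 B) (row 1 B)) (row 0 B')) 0; last first.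
    by exists (1, 0); rewrite ?e1// xpair_eqE oner_eq0.
  exists (0, 1); first by rewrite xpair_eqE oner_eq0 andbF.
  rewrite e2; apply: contra x0 => /eqP h2; apply/eqP.
  apply: (frame_dotp0 (u := (0, 0)) Bu).
  - by rewrite aff0 /dotp !mxE /=; ring.
  - by apply/eqP; rewrite -oppr_eq0 -tri h1.
  - by apply/eqP; rewrite -oppr_eq0 -tri h2.
have : \forall u \near ((0, 0) : R * R), dotp (cross (row 0 B) (dir B w)) (aff B' u) != 0.
  apply: cts_neq0; last by rewrite aff0.
  apply: (@cts_dotp _ _ (fun=> cross (row 0 B) (dir B w)) (aff B')); first exact: cts_cst.
  exact: continuous_aff.
move=> /nbhs_ballP[e /= e0 he]; near=> r; exists w => // u [u1 u2]; apply: he.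
have re : r < e by near: r; exact: nbhs_right_lt.
by split; rewrite /ball /= sub0r normrN; exact: le_lt_trans re.
Unshelve. all: by end_near. Qed.

Lemma dotp_cross (a b : 'rV[R]_3) : (dotp (cross a b) a = 0) * (dotp (cross a b) b = 0).
Proof. by rewrite /dotp !mxE /=; split; ring. Qed.

Lemma dotpD2r (s t : R) (a x y : 'rV[R]_3) : dotp a (s *: x + t *: y) = s * dotp a x + t * dotp a y.
Proof. by rewrite /dotp !mxE; ring. Qed.

(** The line through the origin of the chart in the direction w meets the circle of N
    and misses O. *)
Lemma outside_interior B w N (O : set (RP2 R)) : B \in unitmx -> gauge N -> w != (0, 0) ->
  (forall v, O (pt v) -> v != 0 -> dotp (cross (row 0 B) (dir B w)) v != 0) ->
  ~ gcirc B N `<=` oval_interior O.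
Proof.
move=> Bu gN w0 Ov; have [_ hN pN] := gN.
pose u := scl (N w)^-1 w; have Nw := pN w w0.
have Nu : N u = 1 by rewrite /u hN ?invr_ge0 ?ltW// mulVf// gt_eqF.
pose a := aff B u; pose b := row 0 B.
have aE : a = b + (N w)^-1 *: dir B w by rewrite /a /u aff_scl.
have hE t : halfturn a b t = (1 - 2 * t + t * (1 - t)) *: b + ((1 - 2 * t) / N w) *: dir B w.
  by rewrite /halfturn aE; apply/rowP => j; rewrite !mxE; ring.
have ht0 t : halfturn a b t != 0.
  apply/eqP; rewrite hE => e.
  have [h1 h2] : (1 - 2 * t) / N w * w.1 = 0 /\ (1 - 2 * t) / N w * w.2 = 0.
    apply: (frame_indep Bu (k := - (1 - 2 * t + t * (1 - t)))).
    rewrite scaleNr; apply/eqP; rewrite -subr_eq0 opprK addrC -e; apply/eqP.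
    by rewrite /dir scalerDr !scalerA.
  have t2 : 1 - 2 * t = 0.
    apply/eqP/negPn/negP => n0.
    have k0 : (1 - 2 * t) / N w != 0 by apply: mulf_neq0 => //; rewrite invr_neq0// gt_eqF.
    move: w0; rewrite [w]surjective_pairing; move/eqP: h1; move/eqP: h2.
    by rewrite !(mulf_eq0 ((1 - 2 * t) / N w)) !(negbTE k0) /= => /eqP-> /eqP->; rewrite eqxx.
  move: e; rewrite t2 mul0r scale0r addr0 add0r.
  have -> : t * (1 - t) = 4^-1 by rewrite (_ : t = 2^-1); [field|lra].
  by move/eqP; rewrite scaler_eq0 invr_eq0 pnatr_eq0 /= /b -aff0 (negbTE (aff_neq0 _ Bu)).
have line t : ~ O (pt (halfturn a b t)).
  move=> /Ov/(_ (ht0 t))/eqP; apply; rewrite hE dotpD2r.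
  by rewrite !dotp_cross !mulr0 addr0.
move=> sub; apply: (@line_not_interior R O a b 0 ht0 line).
have -> : halfturn a b 0 = a by rewrite /halfturn mulr0 subr0 mul0r scale1r scale0r addr0.
by apply: sub; exists u.
Qed.

(** Near each zero of g the zero set of c is a small oval, and compactness of the sphere
    excludes other zeros. An oval is not inside another one because it meets a line
    that misses the other one. *)
Theorem stable_ovals n (Z : 'I_n -> 'rV[R]_3) g :
  (forall v, 0 <= ev g v) ->
  (forall i, Z i != 0) -> (forall i j, i != j -> cross (Z i) (Z j) != 0) ->
  (forall i, ev g (Z i) = 0) ->
  (forall v, v != 0 -> ev g v = 0 -> exists i k, v = k *: Z i) ->
  (forall i, nondegenerate_eigen g (Z i)) ->
  \forall c \near g, (forall i, ev c (Z i) < 0) ->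
    exists O : 'I_n -> set (RP2 R),
      [/\ forall i, oval (O i), trivIset setT O, zeroset c = \bigcup_i O i &
        forall i j, i != j -> ~ nested (O i) (O j)].
Proof.
move=> g0 Z0 Zij Zg ex nd.
have [B BP] : exists B : 'I_n -> 'M[R]_3, forall i, B i \in unitmx /\ row 0 (B i) = Z i.
  have /choice[B BP] : forall i, exists B, B \in unitmx /\ row 0 B = Z i.
    by move=> i; have [B Bu Bp] := frame_exists (Z0 i); exists B.
  by exists B.
have Bu i : B i \in unitmx by have [] := BP i.
have Bp i : row 0 (B i) = Z i by have [] := BP i.
pose good r i c := (forall w, enorm w = 1 -> 0 < ev c (aff (B i) (scl r w))) /\
    (forall w s t, enorm w = 1 -> 0 <= s <= r -> 0 <= t <= r ->
       0 < slope c (row 0 (B i)) (dir (B i) w) s t).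
have h1 : \forall r \near (0 : R)^'+, forall i, \forall c \near g, good r i c.
  by apply: filter_forall => i; apply: zero_local; rewrite ?Bp.
have h2 : \forall r \near (0 : R)^'+, forall i j, i != j ->
    forall v, in_cone (B i) r v -> in_cone (B j) r v -> False.
  apply: filter_forall => i; apply: filter_forall => j.
  have [ij|ij] := eqVneq i j; first by near=> r.
  have := @cones_disjoint R (B i) (B j) (Bu i) (Bu j); rewrite !Bp => /(_ (Zij i j ij)).
  by apply: filterS => r h _.
have h3 : \forall r \near (0 : R)^'+, forall i j, i != j -> exists2 w, w != (0, 0) &
    forall u, box r u -> dotp (cross (row 0 (B i)) (dir (B i) w)) (aff (B j) u) != 0.
  apply: filter_forall => i; apply: filter_forall => j.
  have [ij|ij] := eqVneq i j; first by near=> r.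
  have := @separating_line (B i) (B j) (Bu i) (Bu j); rewrite !Bp => /(_ (Zij i j ij)).
  by apply: filterS => r h _.
near (0 : R)^'+ => r.
have r0 : 0 < r by near: r; exact: nbhs_right_gt.
have g1 : forall i, \forall c \near g, good r i c by near: r.
have g2 : forall i j, i != j ->
    forall v, in_cone (B i) r v -> in_cone (B j) r v -> False by near: r.
have g3 : forall i j, i != j -> exists2 w, w != (0, 0) &
    forall u, box r u -> dotp (cross (row 0 (B i)) (dir (B i) w)) (aff (B j) u) != 0 by near: r.
have g4 : \forall c \near g, forall v, v != 0 -> ev c v = 0 -> exists i, in_cone (B i) (r / 2) v.
  apply: (@cone_cover R (fun c v => ev c v = 0)) => //.
  - by move=> c k v v_0; rewrite evZ v_0 mulr0.
  - move=> v _ /eqP nev; have : \forall y \near (v, g), ev y.2 y.1 != 0.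
      apply: cts_neq0 => //.
      by apply: (@cts_ev _ _ snd fst); [exact: cvg_snd|exact: cvg_fst].
    by apply: filterS => y /eqP.
  - exact: divr_gt0.
  - by move=> v v0 /(ex v v0)[i [k ->]]; exists i, k; rewrite Bp.
have {}g1 := @filter_forall _ _ _ (nbhs g) (nbhs_filter g) g1.
apply: filterS (filterI g1 g4) => c [gc cov] cZ.
have /choice[N NP] : forall i, exists N, gauge N /\
    forall u, N u = 1 <-> enorm u < r /\ ev c (aff (B i) u) = 0.
  move=> i; have [rim sl] := gc i.
  by apply: (small_oval (Bu i) r0 _ rim sl); rewrite Bp.
have gN i : gauge (N i) by have [] := NP i.
have NE i u : N i u = 1 <-> enorm u < r /\ ev c (aff (B i) u) = 0 by have [] := NP i.
pose O i := gcirc (B i) (N i).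
have Ocone i v : v != 0 -> O i (pt v) -> in_cone (B i) r v.
  move=> v0 /(chart_imageP _ (Bu i) v0)[hv /NE[/ltW/enorm_box bv _]].
  by split.
exists O; split.
- by move=> i; exact: oval_gcirc.
- apply/trivIsetP => i j _ _ ij; apply/seteqP; split => // x [Oi Oj].
  have [v v0 xv] := pt_surj x; move: Oi Oj; rewrite xv => /(Ocone _ _ v0) ci /(Ocone _ _ v0) cj.
  exact: (g2 i j ij v).
- apply/seteqP; split => [x [v [v0 v_0 ->]]|x [i _ [u /NE[_ u_0] <-]]].
    have [i [hi bi]] := cov v v0 v_0; exists i => //.
    apply/(chart_imageP _ (Bu i) v0); split => //; apply/NE.
    split; first exact: box_enorm.
    have [k k0 vk] : exists2 k, k != 0 & v = k *: aff (B i) (dehom (B i) v).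
      by exists (hcoord (B i) v 0 0) => //; exact: aff_dehom.
    move: v_0; rewrite {1}vk evZ => /eqP; rewrite mulf_eq0 expf_eq0 /= (negbTE k0) /=.
    by move=> /eqP.
  by exists (aff (B i) u); split => //; exact: aff_neq0.
have out i j : i != j -> ~ O i `<=` oval_interior (O j).
  move=> ij; have [w w0 wj] := g3 i j ij.
  apply: (@outside_interior (B i) w (N i) (O j)) => // v Ov v0.
  have cj := Ocone j v v0 Ov; have [k k0 vk] := in_coneP (Bu j) cj.
  have := wj _ cj.2; rewrite vk dehomZ// dehom_aff//.
  apply: contra => /eqP; move: (dehom _ _) => z.
  have -> (a b : 'rV[R]_3) : dotp a (k *: b) = k * dotp a b by rewrite /dotp !mxE; ring.
  by move/eqP; rewrite mulf_eq0 (negbTE k0).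
move=> i j ij [|]; first exact: out.
by apply: out; rewrite eq_sym.
Unshelve. all: by end_near. Qed.

End stable_ovals.

(** * Nested ovals *)
Section nested_ovals.
Context {R : realType}.
Implicit Types (c g : 'rV[R]_15) (u w : R * R) (B : 'M[R]_3).

Section radial_quartic.
Context (f0 f1 f2 f3 f4 : R) (h3 : `|f3| < f4) (h0 : `|f3| < f0).

Let phi (s : R) := f0 + s * f1 + s ^+ 2 * f2 + s ^+ 3 * f3 + s ^+ 4 * f4.

(** The second divided difference of phi(s) / s, cleared of denominators: under
    the assumptions on f3 the function phi(s) / s is convex on s > 0. *)
Lemma phi_divdiff x y z :
  y * z * (z - y) * phi x - x * z * (z - x) * phi y + x * y * (y - x) * phi z =
  (y - x) * (z - x) * (z - y) * (f4 * (x + y + z) * (x * y * z) + f3 * (x * y * z) + f0).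
Proof. by rewrite /phi; ring. Qed.

Lemma phi_convex x y z : 0 < x -> x < y -> y < z ->
  0 < y * z * (z - y) * phi x - x * z * (z - x) * phi y + x * y * (y - x) * phi z.
Proof.
move=> x0 xy yz; rewrite phi_divdiff.
have y0 : 0 < y by exact: lt_trans xy.
have z0 : 0 < z by exact: lt_trans yz.
rewrite !mulr_gt0 ?subr_gt0//; first exact: lt_trans yz.
have m0 : 0 < x * y * z by rewrite !mulr_gt0.
move: h3 h0; rewrite !ltr_norml => /andP[h3l h3r] /andP[h0l h0r].
have [S1|S1] := leP 1 (x + y + z).
  have : 0 <= (f4 * (x + y + z) + f3) * (x * y * z).
    apply: mulr_ge0; last exact: ltW.
    have : f4 * 1 <= f4 * (x + y + z) by apply: ler_wpM2l => //; lra.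
    by lra.
  by rewrite mulrDl; lra.
have m1 : x * y * z < 1.
  have xy1 : x * y < 1 by apply: (@lt_trans _ _ (1 * y)); [rewrite ltr_pM2r//; lra|lra].
  by apply: (@lt_trans _ _ (1 * z)); [rewrite ltr_pM2r//; lra|lra].
have t1 : 0 <= f4 * (x + y + z) * (x * y * z).
  by rewrite !mulr_ge0// ?ltW//; lra.
have t2 : - f0 < f3 * (x * y * z).
  have [f30|f30] := leP 0 f3.
    have : 0 <= f3 * (x * y * z) by rewrite mulr_ge0// ltW.
    by lra.
  have : f3 * 1 < f3 * (x * y * z) by rewrite ltr_nM2l.
  by lra.
by lra.
Qed.

Lemma phi_eventually : exists b, forall s, b < s -> 0 < phi s.
Proof.
have f40 : 0 < f4 by exact: le_lt_trans h3.
pose K := `|f0| + `|f1| + `|f2| + `|f3|.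
have K0 : 0 <= K by rewrite /K !addr_ge0.
exists (1 + K / f4) => s sb.
have s1 : 1 < s by apply: le_lt_trans sb; rewrite lerDl divr_ge0// ltW.
have s0 : 0 < s by exact: lt_trans s1.
have sK : K < s * f4 by rewrite -ltr_pdivrMr//; apply: lt_trans sb; rewrite ltrDr.
have s2 : 1 <= s ^+ 2 by rewrite expr_ge1 // ltW.
have s3 : 1 <= s ^+ 3 by rewrite expr_ge1 // ltW.
have s30 : 0 < s ^+ 3 by exact: exprn_gt0.
have lo (t f : R) : 0 <= t -> t <= s ^+ 3 -> - (s ^+ 3 * `|f|) <= t * f.
  move=> t0 ts; rewrite lerNl; apply: le_trans (ler_norm _) _.
  by rewrite normrN normrM (ger0_norm t0) ler_wpM2r.
have a0 := lo 1 f0 ler01 s3.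
have a1 : - (s ^+ 3 * `|f1|) <= s * f1.
  by apply: lo; rewrite ?ltW// ltr_eXnr.
have a2 : - (s ^+ 3 * `|f2|) <= s ^+ 2 * f2.
  by apply: lo; rewrite ?sqr_ge0// ler_weXn2l// ltW.
have a3 := lo (s ^+ 3) f3 (ltW s30) (lexx _).
have a4 : s ^+ 3 * K < s ^+ 4 * f4 by rewrite (exprSr s 3) -mulrA ltr_pM2l.
move: a0 a1 a2 a3 a4; rewrite /phi /K !mulrDr mul1r.
move: (s ^+ 3 * `|f0|) (s ^+ 3 * `|f1|) (s ^+ 3 * `|f2|) (s ^+ 3 * `|f3|).
move: (s ^+ 4 * f4) (s ^+ 3 * f3) (s ^+ 2 * f2) (s * f1) => *; lra.
Qed.

End radial_quartic.

(** Writing f(p + s d) = F0 + F1 s + F2 s^2 + F3 s^3 + F4 s^4 for the unit directions d at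
    p = row 0 B, the conditions are F0 > 0, |F3| < F4, |F3| < F0 and f(p + d) < 0. *)
Definition nested_cond c B := 0 < ev c (row 0 B) /\
  forall w, enorm w = 1 -> [/\ `|dotp (grad c (dir B w)) (row 0 B)| < ev c (dir B w),
    `|dotp (grad c (dir B w)) (row 0 B)| < ev c (row 0 B) & ev c (aff B w) < 0].

Lemma nested_cond_near g B : B \in unitmx -> nested_cond g B ->
  \forall c \near g, nested_cond c B.
Proof.
move=> Bu [p0 H]; set p := row 0 B in p0 H *.
have n0 : \forall c \near g, 0 < ev c p.
  apply: (@cts_lt _ _ (fun=> 0) (fun c => ev c p)) => //; first exact: cts_cst.
  by apply: (@cts_ev _ _ id (fun=> p)); [exact: cvg_id|exact: cts_cst].
have nc := @compact_unit_circle R; move/compact_near_coveringP in nc.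
have n1 : \forall c \near g, unit_circle R `<=` (fun w => [/\
    `|dotp (grad c (dir B w)) p| < ev c (dir B w),
    `|dotp (grad c (dir B w)) p| < ev c p & ev c (aff B w) < 0]).
  apply: (nc _ (nbhs g) (fun c w => [/\
    `|dotp (grad c (dir B w)) p| < ev c (dir B w),
    `|dotp (grad c (dir B w)) p| < ev c p & ev c (aff B w) < 0])) => w.
  rewrite unit_circle_enorm => /H[k1 k2 k3].
  have cc : {for (w, g), continuous (@snd (R * R) 'rV[R]_15)} by exact: cvg_snd.
  have cw : {for (w, g), continuous (@fst (R * R) 'rV[R]_15)} by exact: cvg_fst.
  have cp : {for (w, g), continuous (fun _ : (R * R) * 'rV[R]_15 => p)} by exact: cts_cst.
  have cd := cts_dir (B := B) cw; have ca := cts_aff (B := B) cw.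
  have c3 := cts_dotp (cts_grad cc cd) cp.
  have c3n : {for (w, g), continuous (fun y : (R * R) * 'rV[R]_15 =>
      `|dotp (grad y.2 (dir B y.1)) p|)}.
    by apply: (continuous_comp c3); exact: norm_continuous.
  have m1 := cts_lt c3n (cts_ev cc cd) k1.
  have m2 := cts_lt c3n (cts_ev cc cp) k2.
  have m3 := @cts_lt _ _ _ (fun=> 0) _ (cts_ev cc ca) (@cts_cst _ _ 0 _) k3.
  by apply: filterS (filterI m1 (filterI m2 m3)) => -[w' c] [? []].
by apply: filterS (filterI n0 n1) => c [c0 c1]; split => // w w1; apply: c1;
  rewrite unit_circle_enorm.
Qed.

(** On each ray from p the function f(p + s d) / s is convex, positive for small and
    for large s and negative at s = 1: it has one zero on each side of 1. The zeros with
    s < 1 form the inner oval, those with s > 1 the outer one; F4 > 0 excludes zeros at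
    infinity. *)
Theorem nested_ovals c B : B \in unitmx -> nested_cond c B ->
  exists O : 'I_2 -> set (RP2 R),
      [/\ forall i, oval (O i), trivIset setT O, zeroset c = \bigcup_i O i &
        forall i j, i != j -> nested (O i) (O j)].
Proof.
move=> Bu [p0 H]; pose h u := ev c (aff B u).
have ch : continuous h.
  move=> u; apply: (@cts_ev _ _ (fun=> c) (aff B)); first exact: cts_cst.
  exact: continuous_aff.
have hE w s : h (scl s w) = ev c (row 0 B) + s * dotp (grad c (row 0 B)) (dir B w)
    + s ^+ 2 * (dotp (hess c (row 0 B) (dir B w)) (dir B w) / 2)
    + s ^+ 3 * dotp (grad c (dir B w)) (row 0 B) + s ^+ 4 * ev c (dir B w).
  by rewrite /h aff_scl ev_taylor.
have conv w x y z : enorm w = 1 -> 0 < x -> x < y -> y < z ->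
    0 < y * z * (z - y) * h (scl x w) - x * z * (z - x) * h (scl y w)
        + x * y * (y - x) * h (scl z w).
  by move=> /H[k1 k2 _] x0 xy yz; rewrite !hE; exact: phi_convex.
have h1 w : enorm w = 1 -> h w < 0 by move=> /H[].
have inner w (x y : R) : enorm w = 1 -> 0 < x -> x < y -> y < 1 ->
    h (scl x w) = 0 -> h (scl y w) = 0 -> False.
  move=> w1 x0 xy y1 hx hy; have := conv w x y 1 w1 x0 xy y1.
  rewrite hx hy !mulr0 subrr add0r scl1 ltNge => /negP; apply.
  by rewrite nmulr_lle0 ?h1// !mulr_ge0 ?subr_ge0 ?ltW// (lt_trans x0).
have outer w (y z : R) : enorm w = 1 -> 1 < y -> y < z ->
    h (scl y w) = 0 -> h (scl z w) = 0 -> False.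
  move=> w1 y1 yz hy hz; have := conv w 1 y z w1 ltr01 y1 yz.
  rewrite hy hz !mulr0 subr0 addr0 scl1 ltNge => /negP; apply.
  have y0 : 0 < y by exact: lt_trans y1.
  have z0 : 0 < z by exact: lt_trans yz.
  by rewrite nmulr_lle0 ?h1// !mulr_ge0 ?subr_ge0 ?ltW.
have [||||N1 [gN1 N1l N1e]] := @star_small R (fun u => - h u) 1 ltr01.
- by move=> u; apply: ctsN; exact: ch.
- by rewrite /h aff0 oppr_lt0.
- by move=> u u1; rewrite oppr_gt0 h1.
- move=> w w1 s t /andP[s0 s1] /andP[t0 t1] /eqP; rewrite oppr_eq0 => /eqP hs.
  move=> /eqP; rewrite oppr_eq0 => /eqP ht.
  have [st|st|//] := ltgtP s t.
    by case: (inner w s t).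
  by case: (inner w t s).
have [||N2 [gN2 N2l N2e]] := @star_large R h ch h1.
- move=> w w1; have [k1 k2 _] := H w w1.
  have [b bP] := phi_eventually (ev c (row 0 B)) (dotp (grad c (row 0 B)) (dir B w))
    (dotp (hess c (row 0 B) (dir B w)) (dir B w) / 2) k1.
  by exists b => s /bP; rewrite hE.
- move=> w w1 s t s1 t1 hs ht; have [st|st|//] := ltgtP s t.
    by case: (outer w s t).
  by case: (outer w t s).
pose O (i : 'I_2) := if i == 0 then gcirc B N1 else gcirc B N2.
have N12 u : N1 u = 1 -> N2 u < 1 by move=> /N1e[u1 _]; apply/N2l; left.
have O12 : O 0 `<=` oval_interior (O 1).
  move=> _ [u u1 <-]; apply: gdisc_interior => //.
  by exists u => //; exact: N12.
have e0 (i2 : (0 < 2)%N) : Ordinal i2 = 0 by exact: val_inj.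
have e1 (i2 : (1 < 2)%N) : Ordinal i2 = 1 by exact: val_inj.
exists O; split.
- by move=> i; rewrite /O; case: ifP => _; exact: oval_gcirc.
- have disj : O 0 `&` O 1 = set0.
    apply/seteqP; split => // _ [[u /= u1 <-] [w /= w1 /(chart_inj Bu) wu]].
    by have := N12 u u1; rewrite -wu w1 ltxx.
  by apply/trivIsetP => -[[|[|//]] i2] [[|[|//]] j2] _ _ // _; rewrite ?e0 ?e1// setIC.
- apply/seteqP; split => [x [v [v0 v_0 ->]]|x [i _ Oi]].
    have [hv|hv] := eqVneq (hcoord B v 0 0) 0.
      pose u := (hcoord B v 0 1, hcoord B v 0 2).
      have vE : v = dir B u by rewrite -(hcoordK v Bu) row3 hv scale0r add0r.
      have u0 : u != (0, 0).
        by apply: contra v0 => /eqP u0; rewrite vE u0 /dir !scale0r addr0.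
      have [w w1 uw] := unit_dir u0; have [k1 _ _] := H w w1.
      have e : v = enorm u *: dir B w by rewrite vE {1}uw /dir /= scalerDr !scalerA.
      move: v_0; rewrite e evZ => /eqP; rewrite mulf_eq0 expf_eq0 /= enorm_eq0 (negbTE u0) /=.
      by move=> /eqP v_0; move: k1; rewrite v_0 ltNge normr_ge0.
    have vk := aff_dehom Bu hv.
    have {v_0} h_0 : h (dehom B v) = 0.
      move: v_0; rewrite {1}vk evZ => /eqP; rewrite mulf_eq0 expf_eq0 /= (negbTE hv) /=.
      by move=> /eqP.
    have [u1|u1|u1] := ltgtP (enorm (dehom B v)) 1.
    + exists 0 => //; apply/(chart_imageP _ Bu v0); split => //; apply/N1e.
      by rewrite h_0 oppr0.
    + by exists 1 => //; apply/(chart_imageP _ Bu v0); split => //; apply/N2e.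
    + by have := h1 _ u1; rewrite h_0 ltxx.
  have [u hu <-] : exists2 u, h u = 0 & chart B u = x.
    move: Oi; rewrite /O; case: ifP => _ [u /= Nu <-]; exists u => //.
      by have [_ /eqP] := (N1e u).1 Nu; rewrite oppr_eq0 => /eqP.
    by have [_ ] := (N2e u).1 Nu.
  by exists (aff B u); split => //; exact: aff_neq0.
- move=> -[[|[|//]] i2] [[|[|//]] j2] // _; rewrite ?e0 ?e1; [left|right]; exact: O12.
Qed.

End nested_ovals.

(** * Eigenvectors of even quartics *)
Section even_forms.
Context {R : realType}.

Definition coefs (s : seq R) : 'rV[R]_15 := \row_k s`_k.

Lemma cf_coefs s k : (k < 15)%N -> cf (coefs s) k = s`_k.
Proof. by move=> k15; rewrite /cf mxE inordK. Qed.

Context (a11 a12 a13 a22 a23 a33 : R).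

(** The quartic q(x^2, y^2, z^2) of the ternary quadratic form q with matrix a. *)
Definition even_form := coefs [:: a11; 0; 0; 2 * a12; 0; 2 * a13; 0; 0; 0; 0;
   a22; 0; 2 * a23; 0; a33].

Let A1 (v : 'rV[R]_3) := a11 * v 0 0 ^+ 2 + a12 * v 0 1 ^+ 2 + a13 * v 0 2 ^+ 2.
Let A2 (v : 'rV[R]_3) := a12 * v 0 0 ^+ 2 + a22 * v 0 1 ^+ 2 + a23 * v 0 2 ^+ 2.
Let A3 (v : 'rV[R]_3) := a13 * v 0 0 ^+ 2 + a23 * v 0 1 ^+ 2 + a33 * v 0 2 ^+ 2.

Lemma ev_even v : ev even_form v = let X := v 0 0 ^+ 2 in let Y := v 0 1 ^+ 2 in
  let Z := v 0 2 ^+ 2 in a11 * X ^+ 2 + a22 * Y ^+ 2 + a33 * Z ^+ 2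
  + 2 * a12 * (X * Y) + 2 * a13 * (X * Z) + 2 * a23 * (Y * Z).
Proof. by rewrite /ev /qform !cf_coefs //=; ring. Qed.

Lemma grad_even v : grad even_form v =
  vec3 (4 * v 0 0 * A1 v) (4 * v 0 1 * A2 v) (4 * v 0 2 * A3 v).
Proof.
rewrite [LHS]vec3_eta !mxE /= /qx /qy /qz !cf_coefs //= /A1 /A2 /A3.
by congr vec3; ring.
Qed.

Lemma hess_even v d : hess even_form v d =
  let D1 := v 0 0 * d 0 0 in let D2 := v 0 1 * d 0 1 in let D3 := v 0 2 * d 0 2 in
  vec3 (8 * v 0 0 * (a11 * D1 + a12 * D2 + a13 * D3) + 4 * A1 v * d 0 0)
       (8 * v 0 1 * (a12 * D1 + a22 * D2 + a23 * D3) + 4 * A2 v * d 0 1)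
       (8 * v 0 2 * (a13 * D1 + a23 * D2 + a33 * D3) + 4 * A3 v * d 0 2).
Proof.
rewrite /hess /dgrad /cubics /divdiff !cf_coefs //= /A1 /A2 /A3.
by congr vec3; ring.
Qed.

Let w1 := a22 * a33 - a23 ^+ 2 - a12 * (a33 - a23) - a13 * (a22 - a23).
Let w2 := a11 * a33 - a13 ^+ 2 - a12 * (a33 - a13) - a23 * (a11 - a13).
Let w3 := a11 * a22 - a12 ^+ 2 - a13 * (a22 - a12) - a23 * (a11 - a12).

(** With X = (x^2, y^2, z^2) an eigenvector satisfies (a X)_i = mu for each i with X_i <> 0.
    When all X_i are nonzero, X is proportional to the vector w of row sums of the
    adjugate of a; when only X_i and X_j are, it is proportional to
    (a_jj - a_ij, a_ii - a_ij). Such a solution is realized by real coordinates when its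
    entries have the same sign. *)
Definition even_generic := [/\ [&& a11 != a12, a22 != a12 & a11 != a13],
  [&& a33 != a13, a22 != a23 & a33 != a23] & [&& w1 != 0, w2 != 0 & w3 != 0]].

Definition edge12 := 0 < (a11 - a12) * (a22 - a12).
Definition edge13 := 0 < (a11 - a13) * (a33 - a13).
Definition edge23 := 0 < (a22 - a23) * (a33 - a23).
Definition face := (0 < w1 * w2) && (0 < w1 * w3).

(** Eigenvectors are indexed by the signs of their coordinates. *)
Definition signs := (int * int * int)%type.

Definition even_cond (s : signs) : bool :=
  match s.1.1 != 0, s.1.2 != 0, s.2 != 0 with
  | true, true, true => face
  | true, true, false => edge12
  | true, false, true => edge13
  | false, true, true => edge23
  | _, _, _ => true
  end.

(** The absolute value makes the formulas for eigenvectors independent of the common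
    sign of the solution of the linear system. *)
Definition absqrt (x : R) := Num.sqrt `|x|.

Definition even_point (s : signs) : 'rV[R]_3 :=
  vec3 (s.1.1%:~R * (if s.1.2 != 0 then if s.2 != 0 then absqrt w1 else absqrt (a22 - a12)
                     else if s.2 != 0 then absqrt (a33 - a13) else 1))
       (s.1.2%:~R * (if s.1.1 != 0 then if s.2 != 0 then absqrt w2 else absqrt (a11 - a12)
                     else if s.2 != 0 then absqrt (a33 - a23) else 1))
       (s.2%:~R * (if s.1.1 != 0 then if s.1.2 != 0 then absqrt w3 else absqrt (a11 - a13)
                     else if s.1.2 != 0 then absqrt (a22 - a23) else 1)).

Definition sgz3 (v : 'rV[R]_3) : signs := (sgz (v 0 0), sgz (v 0 1), sgz (v 0 2)).

Context (gen : even_generic).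

Lemma absqrt_gt0 x : x != 0 -> 0 < absqrt x.
Proof. by move=> x0; rewrite sqrtr_gt0 normr_gt0. Qed.

Lemma sqr_absqrt x : absqrt x ^+ 2 = `|x|.
Proof. by rewrite sqr_sqrtr. Qed.

Let gens : [/\ [/\ a11 - a12 != 0, a22 - a12 != 0 & a11 - a13 != 0],
  [/\ a33 - a13 != 0, a22 - a23 != 0 & a33 - a23 != 0] & [/\ w1 != 0, w2 != 0 & w3 != 0]].
Proof.
have ne (x y : R) : x != y -> x - y != 0 by rewrite subr_eq0.
case: gen => /and3P[h1 h2 h3] /and3P[h4 h5 h6] /and3P[? ? ?].
by split; split => //; exact: ne.
Qed.

Let sgz_pos (i : int) (r : R) : 0 < r -> sgz (i%:~R * r) = sgz i.
Proof. by move=> r0; rewrite sgzM (gtr0_sgz r0) mulr1 sgz_int. Qed.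

Lemma sgz3_even_point s : sgz3 (even_point s) = (sgz s.1.1, sgz s.1.2, sgz s.2).
Proof.
have [[? ? ?] [? ? ?] [? ? ?]] := gens.
by rewrite /sgz3 !vec3E !sgz_pos//; do 2 case: ifP => _ //; exact: absqrt_gt0.
Qed.

(** The ratio of the squares determines (x, y) up to a positive factor and signs, and
    forces p and q to have the same sign. *)
Let sqrt_ratio (x y p q : R) : p != 0 -> q != 0 -> x != 0 -> y != 0 ->
  x ^+ 2 * q = y ^+ 2 * p ->
  0 < p * q /\ exists k, [/\ 0 < k, x = k * ((sgz x)%:~R * absqrt p) &
    y = k * ((sgz y)%:~R * absqrt q)].
Proof.
move=> p0 q0 x0 y0 e.
have X0 : 0 < x ^+ 2 by rewrite lt0r sqrf_eq0 x0 sqr_ge0.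
have Y0 : 0 < y ^+ 2 by rewrite lt0r sqrf_eq0 y0 sqr_ge0.
have pq : 0 < p * q.
  have : 0 < (x ^+ 2 * q) * (y ^+ 2 * p).
    by rewrite -e -expr2 lt0r sqrf_eq0 sqr_ge0 andbT mulf_neq0// gt_eqF.
  have -> : (x ^+ 2 * q) * (y ^+ 2 * p) = (x ^+ 2 * y ^+ 2) * (p * q) by ring.
  by rewrite pmulr_rgt0// mulr_gt0.
split => //; exists (`|x| / absqrt p).
have rp := absqrt_gt0 p0; have rq := absqrt_gt0 q0.
have sg (t : R) : t = (sgz t)%:~R * `|t| by rewrite -sgrEz -numEsg.
split; first by rewrite divr_gt0 ?normr_gt0.
  by rewrite [LHS]sg mulrCA divfK ?gt_eqF.
rewrite [LHS]sg mulrCA; congr (_ * _).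
have h : `|y| * absqrt p = `|x| * absqrt q.
  apply/eqP; rewrite -(@eqrXn2 _ 2)// ?mulr_ge0 ?sqrtr_ge0//.
  rewrite !exprMn !sqr_absqrt !real_normK ?num_real//.
  have [q1|q1] := ltP 0 q.
    have p1 : 0 < p by rewrite -(pmulr_lgt0 _ q1).
    by rewrite !gtr0_norm// e.
  have q2 : q < 0 by rewrite lt_neqAle q0.
  have p2 : p < 0 by rewrite -(nmulr_lgt0 _ q2).
  by rewrite !ltr0_norm// !mulrN e.
by rewrite mulrAC -h mulfK// gt_eqF.
Qed.

Lemma even_eigenP v : eigen even_form v <-> exists mu,
  [/\ v 0 0 * (A1 v - mu) = 0, v 0 1 * (A2 v - mu) = 0 & v 0 2 * (A3 v - mu) = 0].
Proof.
split=> [[l /rowP e]|[mu [e0 e1 e2]]].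
  exists (l / 4); have := e 0; have := e 1; have := e 2.
  rewrite grad_even !mxE /= => h2 h1 h0.
  by split; rewrite mulrBr; [move: h0|move: h1|move: h2] => h; lra.
exists (4 * mu); rewrite grad_even [RHS]vec3_eta !mxE; congr vec3; lra.
Qed.

Let mul_eq0r (x y : R) : x != 0 -> x * y = 0 -> y = 0.
Proof. by move=> x0 /eqP; rewrite mulf_eq0 (negbTE x0) => /eqP. Qed.

Let sgn_sq (i : int) (x : R) : i \in [:: -1; 1] -> (i%:~R * absqrt x) ^+ 2 = `|x|.
Proof.
by rewrite !inE => /orP[] /eqP->; rewrite exprMn sqr_absqrt ?sqrrN expr1n mul1r.
Qed.

(** By even_cond the entries of the solution of the linear system have a common sign, so
    the absolute values in absqrt only rescale it. *)
Lemma even_point_eigen s : s.1.1 \in [:: -1; 0; 1] -> s.1.2 \in [:: -1; 0; 1] ->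
  s.2 \in [:: -1; 0; 1] -> even_cond s -> eigen even_form (even_point s).
Proof.
have nz (i : int) : i \in [:: -1; 0; 1] -> i = 0 \/ (i != 0 /\ i \in [:: -1; 1]).
  by rewrite !inE => /or3P[] /eqP->; [right|left|right].
have abs2 (x y : R) : 0 < x * y -> exists e, `|x| = e * x /\ `|y| = e * y.
  move=> xy; have [x0|x0] := ltP 0 x.
    have y0 : 0 < y by rewrite -(pmulr_rgt0 _ x0).
    by exists 1; rewrite !mul1r !gtr0_norm.
  have {}x0 : x < 0.
    by rewrite lt_neqAle x0 andbT; apply/eqP => e; move: xy; rewrite e mul0r ltxx.
  have y0 : y < 0 by rewrite -(nmulr_rgt0 _ x0).
  by exists (-1); rewrite !mulN1r !ltr0_norm.
case: s => -[i j] k /= /nz[->|[i0 i1]] /nz[->|[j0 j1]] /nz[->|[k0 k1]];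
  rewrite /even_cond /= ?i0 ?j0 ?k0 ?eqxx /= => cond; apply/even_eigenP;
  rewrite /A1 /A2 /A3 /even_point !vec3E /= ?i0 ?j0 ?k0 ?eqxx /= ?mul0r ?expr0n /=.
- by exists 0; split; ring.
- by exists (a33 * k%:~R ^+ 2); split; ring.
- by exists (a22 * j%:~R ^+ 2); split; ring.
- have [e [e1 e2]] := abs2 _ _ cond; rewrite !sgn_sq// e1 e2.
  by exists (e * (a22 * a33 - a23 ^+ 2)); split; ring.
- by exists (a11 * i%:~R ^+ 2); split; ring.
- have [e [e1 e2]] := abs2 _ _ cond; rewrite !sgn_sq// e1 e2.
  by exists (e * (a11 * a33 - a13 ^+ 2)); split; ring.
- have [e [e1 e2]] := abs2 _ _ cond; rewrite !sgn_sq// e1 e2.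
  by exists (e * (a11 * a22 - a12 ^+ 2)); split; ring.
- have /andP[c2 c3] := cond.
  have [e [e1 e2]] := abs2 _ _ c2; have [e' [e1' e3]] := abs2 _ _ c3.
  have [_ _ [w10 w20 w30]] := gens.
  have ee : e = e' by apply: (mulIf w10); rewrite -e1 -e1'.
  rewrite !sgn_sq// e1 e2 e3 -ee /w1 /w2 /w3.
  exists (e * (a11 * (a22 * a33 - a23 ^+ 2) - a12 * (a12 * a33 - a13 * a23)
    + a13 * (a12 * a23 - a13 * a22))).
  by split; ring.
Qed.

Let edge_ratio (a b e X Y : R) : a * X + b * Y = b * X + e * Y ->
  X * (a - b) = Y * (e - b).
Proof. by move=> h; lra. Qed.

(** The squares of the nonzero coordinates solve the linear system of the support, whose
    solution is unique up to a factor. *)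
Lemma even_eigen_point v : v != 0 -> eigen even_form v ->
  even_cond (sgz3 v) /\ exists2 k, 0 < k & v = k *: even_point (sgz3 v).
Proof.
move=> v0 /even_eigenP[mu []].
have [[h12 h21 h13] [h31 h23 h32] [w10 w20 w30]] := gens.
rewrite /even_cond /sgz3 /= !sgz_eq0.
have vE := vec3_eta v.
have [x0|x0] := eqVneq (v 0 0) 0; have [y0|y0] := eqVneq (v 0 1) 0;
  have [z0|z0] := eqVneq (v 0 2) 0 => e1 e2 e3 /=.
- case/negP: v0; rewrite vE x0 y0 z0; apply/eqP/rowP => j; rewrite !mxE.
  by case: j => -[|[|[|//]]].
- split => //; exists `|v 0 2|; first by rewrite normr_gt0.
  rewrite /even_point /= !sgz_eq0 x0 y0 z0 eqxx /= {1}vE x0 y0 [RHS]vec3_eta !mxE /=.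
  by rewrite !sgz0 !mul0r !mulr0 mulr1; congr vec3; rewrite mulrC -sgrEz -numEsg.
- split => //; exists `|v 0 1|; first by rewrite normr_gt0.
  rewrite /even_point /= !sgz_eq0 x0 y0 z0 eqxx /= {1}vE x0 z0 [RHS]vec3_eta !mxE /=.
  by rewrite !sgz0 !mul0r !mulr0 mulr1; congr vec3; rewrite mulrC -sgrEz -numEsg.
- move: e2 e3 => /(mul_eq0r y0) e2 /(mul_eq0r z0) e3.
  have [|c [k [k0 yk zk]]] := @sqrt_ratio (v 0 1) (v 0 2) (a33 - a23) (a22 - a23) h32 h23 y0 z0.
    apply: edge_ratio; have := subr0_eq e2; rewrite -(subr0_eq e3) /A2 /A3 x0.
    by rewrite expr0n /= !mulr0 ?add0r ?addr0.
  split; first by rewrite /edge23 mulrC.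
  exists k => //; rewrite /even_point /= !sgz_eq0 x0 y0 z0 eqxx /= {1}vE [RHS]vec3_eta !mxE /=.
  by rewrite x0 sgz0 mul0r mulr0 -yk -zk.
- split => //; exists `|v 0 0|; first by rewrite normr_gt0.
  rewrite /even_point /= !sgz_eq0 x0 y0 z0 eqxx /= {1}vE y0 z0 [RHS]vec3_eta !mxE /=.
  by rewrite !sgz0 !mul0r !mulr0 mulr1; congr vec3; rewrite mulrC -sgrEz -numEsg.
- move: e1 e3 => /(mul_eq0r x0) e1 /(mul_eq0r z0) e3.
  have [|c [k [k0 xk zk]]] := @sqrt_ratio (v 0 0) (v 0 2) (a33 - a13) (a11 - a13) h31 h13 x0 z0.
    apply: edge_ratio; have := subr0_eq e1; rewrite -(subr0_eq e3) /A1 /A3 y0.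
    by rewrite expr0n /= !mulr0 ?add0r ?addr0.
  split; first by rewrite /edge13 mulrC.
  exists k => //; rewrite /even_point /= !sgz_eq0 x0 y0 z0 eqxx /= {1}vE [RHS]vec3_eta !mxE /=.
  by rewrite y0 sgz0 mul0r mulr0 -xk -zk.
- move: e1 e2 => /(mul_eq0r x0) e1 /(mul_eq0r y0) e2.
  have [|c [k [k0 xk yk]]] := @sqrt_ratio (v 0 0) (v 0 1) (a22 - a12) (a11 - a12) h21 h12 x0 y0.
    apply: edge_ratio; have := subr0_eq e1; rewrite -(subr0_eq e2) /A1 /A2 z0.
    by rewrite expr0n /= !mulr0 ?add0r ?addr0.
  split; first by rewrite /edge12 mulrC.
  exists k => //; rewrite /even_point /= !sgz_eq0 x0 y0 z0 eqxx /= {1}vE [RHS]vec3_eta !mxE /=.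
  by rewrite z0 sgz0 mul0r mulr0 -xk -yk.
- move: e1 e2 e3 => /(mul_eq0r x0) e1 /(mul_eq0r y0) e2 /(mul_eq0r z0) e3.
  (* two linear equations in the squares, solved by their cross product w *)
  have E12 : A1 v - A2 v = 0 by rewrite (subr0_eq e1) (subr0_eq e2) subrr.
  have E13 : A1 v - A3 v = 0 by rewrite (subr0_eq e1) (subr0_eq e3) subrr.
  have r12 : v 0 0 ^+ 2 * w2 = v 0 1 ^+ 2 * w1.
    apply/eqP; rewrite -subr_eq0; apply/eqP.
    transitivity ((a13 - a23) * (A1 v - A3 v) - (a13 - a33) * (A1 v - A2 v)).
      by rewrite /w1 /w2 /A1 /A2 /A3; ring.
    by rewrite E12 E13; ring.
  have r13 : v 0 0 ^+ 2 * w3 = v 0 2 ^+ 2 * w1.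
    apply/eqP; rewrite -subr_eq0; apply/eqP.
    transitivity (- ((a12 - a22) * (A1 v - A3 v) - (a12 - a23) * (A1 v - A2 v))).
      by rewrite /w1 /w3 /A1 /A2 /A3; ring.
    by rewrite E12 E13; ring.
  have [c2 [k [k0 xk yk]]] := sqrt_ratio w10 w20 x0 y0 r12.
  have [c3 [k' [k'0 xk' zk]]] := sqrt_ratio w10 w30 x0 z0 r13.
  have kk : k = k'.
    have n0 : (sgz (v 0 0))%:~R * absqrt w1 != 0 :> R.
      by rewrite mulf_neq0// ?intr_eq0 ?sgz_eq0// gt_eqF// absqrt_gt0.
    by apply: (mulIf n0); rewrite -xk.
  split; first by rewrite /face c2 c3.
  exists k => //; rewrite /even_point /= !sgz_eq0 x0 y0 z0 /= {1}vE [RHS]vec3_eta !mxE /=.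
  by rewrite -xk -yk kk -zk.
Qed.

Let proportional_eq0 (p q x y e f : R) : p != 0 -> x != 0 -> p * (x * e) = q * (y * f) ->
  p * x ^+ 2 = q * y ^+ 2 -> x * f - y * e = 0.
Proof.
move=> p0 x0 k1 k2; apply: (@mul_eq0r (p * x)); first exact: mulf_neq0.
transitivity ((p * x ^+ 2) * f - y * (p * (x * e))); first by ring.
by rewrite k1 k2; ring.
Qed.

(** On a coordinate line both the squares of the coordinates and the products with
    the increment solve the same rank one system; the transversal eigenvalue
    differs from that of the line by a nonzero multiple of w. *)
Let edge_kernel (a b e p q x y d1 d2 d3 L M : R) : x != 0 -> y != 0 -> a - b != 0 ->
  a * e - b ^+ 2 - p * (e - b) - q * (a - b) != 0 ->
  a * x ^+ 2 + b * y ^+ 2 = L -> b * x ^+ 2 + e * y ^+ 2 = L ->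
  a * (x * d1) + b * (y * d2) = M -> b * (x * d1) + e * (y * d2) = M ->
  (p * x ^+ 2 + q * y ^+ 2 - L) * d3 = 0 -> d3 = 0 /\ x * d2 - y * d1 = 0.
Proof.
move=> x0 y0 ab w0 L1 L2 M1 M2 d30.
have E : (a - b) * x ^+ 2 = (e - b) * y ^+ 2 by rewrite -L2 in L1; lra.
split; last by apply: proportional_eq0 E => //; rewrite -M2 in M1; lra.
apply: (mul_eq0r _ d30); apply: contra w0 => /eqP k; apply/eqP.
apply: (@mul_eq0r (y ^+ 2)); first by rewrite sqrf_eq0.
transitivity ((p - a) * ((a - b) * x ^+ 2 - (e - b) * y ^+ 2)
  - (a - b) * (p * x ^+ 2 + q * y ^+ 2 - (a * x ^+ 2 + b * y ^+ 2))); first by ring.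
by rewrite E L1 k; ring.
Qed.

Let on_support (l m x A S e : R) : x != 0 -> 4 * x * A = l * x ->
  8 * x * S + 4 * A * e = l * e + m * x -> A = l / 4 /\ S = m / 8.
Proof.
move=> x0 g h; have lA : 4 * A = l by apply: (mulIf x0); rewrite -g; ring.
have mS : 8 * S = m by apply: (mulIf x0); move: h; rewrite lA [RHS]addrC => /addIr <-; ring.
by rewrite -lA -mS; split; field.
Qed.

Let off_support (l m A S e : R) : 8 * 0 * S + 4 * A * e = l * e + m * 0 -> (A - l / 4) * e = 0.
Proof. by move=> h; rewrite mulrBl; lra. Qed.

Let vertex_kernel (a b x e : R) : x != 0 -> a - b != 0 -> (b * x ^+ 2 - a * x ^+ 2) * e = 0 -> e = 0.
Proof.
by move=> x0 ab; apply: mul_eq0r; rewrite -mulrBl mulf_neq0 ?sqrf_eq0// -oppr_eq0 opprB.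
Qed.

(** Transversally to a coordinate subspace the Hessian is nonzero by
    genericity; along it the linear systems have a one-dimensional kernel. *)
Lemma even_nondegenerate v : v != 0 -> eigen even_form v -> nondegenerate_eigen even_form v.
Proof.
move=> v0 ev l gl d m hd; apply/(cross_eq0P d v0).
have [[h12 h21 h13] [h31 h23 h32] [w10 w20 w30]] := gens.
have := gl; rewrite grad_even => /rowP g; have := g 0; have := g 1; have := g 2.
have := hd; rewrite hess_even => /rowP h; have := h 0; have := h 1; have := h 2.
rewrite !mxE /=; clear g h hd gl; rewrite /cross.
have v0' : ~ [/\ v 0 0 = 0, v 0 1 = 0 & v 0 2 = 0].
  move=> [x0 y0 z0]; case/negP: v0; rewrite [v]vec3_eta x0 y0 z0.
  by apply/eqP/rowP => j; rewrite !mxE; case: j => -[|[|[|//]]].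
have z3 (x y z : R) : x = 0 -> y = 0 -> z = 0 -> vec3 x y z = 0.
  move=> -> -> ->; apply/rowP => j; rewrite !mxE.
  by case: j => -[|[|[|//]]].
move: (d 0 0) (d 0 1) (d 0 2) => d1 d2 d3; rewrite /A1 /A2 /A3.
move: (v 0 0) (v 0 1) (v 0 2) v0' => x y z v0'.
have sq0 : 0 ^+ 2 = 0 :> R by rewrite expr0n.
have s0 := (sq0, mulr0, mul0r, add0r, addr0, subr0, oppr0).
have [x0|x0] := eqVneq x 0; have [y0|y0] := eqVneq y 0;
  have [z0|z0] := eqVneq z 0 => H3 H2 H1 G3 G2 G1.
- by case: v0'.
- have [a3 _] := on_support z0 G3 H3; subst x y.
  move: (off_support H1) (off_support H2); rewrite -a3 !s0.
  move=> /(vertex_kernel z0 h31) -> /(vertex_kernel z0 h32) ->.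
  by apply: z3; ring.
- have [a2 _] := on_support y0 G2 H2; subst x z.
  move: (off_support H1) (off_support H3); rewrite -a2 !s0.
  move=> /(vertex_kernel y0 h21) -> /(vertex_kernel y0 h23) ->.
  by apply: z3; ring.
- have [a2 s2] := on_support y0 G2 H2; have [a3 s3] := on_support z0 G3 H3; subst x.
  move: (off_support H1) a2 s2 a3 s3; rewrite !s0 => k1 a2 s2 a3 s3.
  have [-> e] := edge_kernel y0 z0 h23 w10 a2 a3 s2 s3 k1.
  by apply: z3; [exact: e|ring|ring].
- have [a1 _] := on_support x0 G1 H1; subst y z.
  move: (off_support H2) (off_support H3); rewrite -a1 !s0.
  move=> /(vertex_kernel x0 h12) -> /(vertex_kernel x0 h13) ->.
  by apply: z3; ring.
- have [a1 s1] := on_support x0 G1 H1; have [a3 s3] := on_support z0 G3 H3; subst y.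
  move: (off_support H2) a1 s1 a3 s3; rewrite !s0 => k2 a1 s1 a3 s3.
  have [-> e] := edge_kernel x0 z0 h13 w20 a1 a3 s1 s3 k2.
  by apply: z3; [ring|rewrite -[RHS]oppr0 -e; ring|ring].
- have [a1 s1] := on_support x0 G1 H1; have [a2 s2] := on_support y0 G2 H2; subst z.
  move: (off_support H3) a1 s1 a2 s2; rewrite !s0 => k3 a1 s1 a2 s2.
  have [-> e] := edge_kernel x0 y0 h12 w30 a1 a2 s1 s2 k3.
  by apply: z3; [ring|ring|exact: e].
- have [a1 s1] := on_support x0 G1 H1; have [a2 s2] := on_support y0 G2 H2.
  have [a3 s3] := on_support z0 G3 H3.
  (* both the squares and the products v_i d_i are proportional to w *)
  have sys (X Y Z r : R) : a11 * X + a12 * Y + a13 * Z = r ->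
      a12 * X + a22 * Y + a23 * Z = r -> a13 * X + a23 * Y + a33 * Z = r ->
      w2 * X = w1 * Y /\ w3 * X = w1 * Z.
    move=> k1 k2 k3; split; apply/eqP; rewrite -subr_eq0; apply/eqP.
      transitivity ((a13 - a23) * ((a11 * X + a12 * Y + a13 * Z) - (a13 * X + a23 * Y + a33 * Z))
        - (a13 - a33) * ((a11 * X + a12 * Y + a13 * Z) - (a12 * X + a22 * Y + a23 * Z))).
        by rewrite /w1 /w2; ring.
      by rewrite k1 k2 k3; ring.
    transitivity (- ((a12 - a22) * ((a11 * X + a12 * Y + a13 * Z) - (a13 * X + a23 * Y + a33 * Z))
        - (a12 - a23) * ((a11 * X + a12 * Y + a13 * Z) - (a12 * X + a22 * Y + a23 * Z)))).
      by rewrite /w1 /w3; ring.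
    by rewrite k1 k2 k3; ring.
  have [p1 p2] := sys _ _ _ _ a1 a2 a3; have [q1 q2] := sys _ _ _ _ s1 s2 s3.
  have r1 := proportional_eq0 w20 x0 q1 p1.
  have r2 := proportional_eq0 w30 x0 q2 p2.
  apply: z3 => //.
    apply: (@mul_eq0r x) => //.
    transitivity (y * (x * d3 - z * d1) - z * (x * d2 - y * d1)); first by ring.
    by rewrite r1 r2; ring.
  by rewrite -[RHS]oppr0 -r2; ring.
Qed.

End even_forms.

(** * The number of eigenpoints of an even quartic *)

Lemma crossC (R : realType) (p q : 'rV[R]_3) : cross p q = - cross q p.
Proof. by apply/rowP => -[[|[|[|//]]] k3]; rewrite !mxE /=; ring. Qed.

Lemma pairwise_cross (R : realType) (s : seq 'rV[R]_3) n (i j : 'I_n) :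
  pairwise (fun p q => cross p q != 0) s -> size s = n -> i != j ->
  cross s`_i s`_j != 0.
Proof.
move=> /(pairwiseP 0) sC sn; have [ij _|ji _|/val_inj ->] := ltngtP i j.
- by apply: sC => //; rewrite sn; exact: ltn_ord.
- by rewrite crossC oppr_eq0; apply: sC => //; rewrite sn; exact: ltn_ord.
- by rewrite eqxx.
Qed.

Lemma stable_count_seq (R : realType) (s : seq 'rV[R]_3) c0 :
  {in s, forall p, [/\ p != 0, eigen c0 p & nondegenerate_eigen c0 p]} ->
  pairwise (fun p q => cross p q != 0) s ->
  (forall v, v != 0 -> eigen c0 v -> exists2 p, p \in s & exists k, v = k *: p) ->
  \forall c \near c0, (eigenset c #= `I_(size s))%card.
Proof.
move=> sP sC sE.
have sn (i : 'I_(size s)) : s`_i \in s by rewrite mem_nth.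
apply: (@stable_count R (size s) (fun i => s`_i)).
- by move=> i; have [] := sP _ (sn i).
- by move=> i j; exact: pairwise_cross.
- by move=> i; have [] := sP _ (sn i).
- by move=> i; have [] := sP _ (sn i).
- move=> v v0 /(sE v v0)[p ps [k vk]].
  have i3 : (index p s < size s)%N by rewrite index_mem.
  by exists (Ordinal i3), k; rewrite /= nth_index.
Qed.

(** One representative of each pair of opposite nonzero sign vectors. *)
Definition sign_classes : seq signs := [:: (1, 0, 0); (0, 1, 0); (0, 0, 1);
  (1, 1, 0); (1, -1, 0); (1, 0, 1); (1, 0, -1); (0, 1, 1); (0, 1, -1);
  (1, 1, 1); (1, 1, -1); (1, -1, 1); (1, -1, -1)].

Definition opp_signs (s : signs) : signs := (- s.1.1, - s.1.2, - s.2).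

Lemma sign_classesP (i j k : int) : i \in [:: -1; 0; 1] -> j \in [:: -1; 0; 1] ->
  k \in [:: -1; 0; 1] -> ~~ [&& i == 0, j == 0 & k == 0] ->
  ((i, j, k) \in sign_classes) || (opp_signs (i, j, k) \in sign_classes).
Proof.
by rewrite !inE => /or3P[] /eqP-> /or3P[] /eqP-> /or3P[] /eqP->.
Qed.

Section even_count.
Context {R : realType} (a11 a12 a13 a22 a23 a33 : R).
Hypothesis gen : even_generic a11 a12 a13 a22 a23 a33.
Let f := even_form a11 a12 a13 a22 a23 a33.
Let pnt := even_point a11 a12 a13 a22 a23 a33.
Let cond := even_cond a11 a12 a13 a22 a23 a33.

Lemma even_point_opp s : pnt (opp_signs s) = - pnt s.
Proof.
rewrite /pnt /even_point /= !oppr_eq0 !mulrNz; apply/rowP => k; rewrite !mxE.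
by case: k => -[|[|[|//]]] k3 /=; exact: mulNr.
Qed.

Lemma even_cond_opp s : cond (opp_signs s) = cond s.
Proof. by rewrite /cond /even_cond /= !oppr_eq0. Qed.

Let sgz_in (r : R) : sgz r \in [:: -1; 0; 1 : int].
Proof. by rewrite !inE; case: sgzP. Qed.

Lemma sign_class_entries s : s \in sign_classes ->
  [/\ s.1.1 \in [:: -1; 0; 1], s.1.2 \in [:: -1; 0; 1] & s.2 \in [:: -1; 0; 1]].
Proof.
move=> sc; suff /allP/(_ s sc)/and3P : all (fun s : signs => [&& s.1.1 \in [:: -1; 0; 1 : int],
  s.1.2 \in [:: -1; 0; 1 : int] & s.2 \in [:: -1; 0; 1 : int]]) sign_classes by [].
by [].
Qed.

Lemma sgz3_sign_class s : s \in sign_classes -> sgz3 (pnt s) = s.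
Proof.
move=> sc; have sz (i : int) : i \in [:: -1; 0; 1] -> sgz i = i.
  by rewrite !inE => /or3P[] /eqP->.
have [/sz e1 /sz e2 /sz e3] := sign_class_entries sc.
by rewrite /pnt (sgz3_even_point gen) e1 e2 e3; case: s {sc e1 e2 e3} => -[].
Qed.

Lemma even_point_neq0 s : s \in sign_classes -> pnt s != 0.
Proof.
move=> sc; apply/eqP => p0; move: (sgz3_sign_class sc).
by rewrite p0 /sgz3 !mxE sgz0 => e; rewrite -e in sc.
Qed.

(** An even_point has the sign vector it is built from, and distinct classes are not
    opposite. *)
Lemma even_point_cross s t : s \in sign_classes -> t \in sign_classes -> s != t ->
  cross (pnt s) (pnt t) != 0.
Proof.
move=> sc tc st; apply/eqP => /(cross_eq0P _ (even_point_neq0 sc))[k e].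
have := sgz3_sign_class tc; rewrite e; have := sgz3_sign_class sc.
move: (pnt s) => p; move: s st sc e => [[i j] l] st sc e; rewrite /sgz3.
rewrite !mxE !sgzM => -[-> -> ->] te.
have : sgz k \in [:: -1; 0; 1 : int] by exact: sgz_in.
have /allP/(_ _ sc)/allP/(_ _ tc)/implyP/(_ st) : all (fun s : signs => all
  (fun t : signs => (s != t) ==> (opp_signs s != t)) sign_classes) sign_classes by [].
rewrite -te !inE => ss /or3P[] /eqP k1.
- by move: ss; rewrite k1 !mulN1r eqxx.
- by move: te tc; rewrite k1 !mul0r => <-.
- by move: st; rewrite -te k1 !mul1r eqxx.
Qed.

(** Each admissible class of sign vectors carries exactly one eigenpoint. *)
Lemma even_count : \forall c \near f, (eigenset c #=
  `I_(3 + 2 * (edge12 a11 a12 a22 + edge13 a11 a13 a33 + edge23 a22 a23 a33)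
      + 4 * face a11 a12 a13 a22 a23 a33))%card.
Proof.
pose s := [seq pnt t | t <- sign_classes & cond t].
suff -> : (3 + 2 * (edge12 a11 a12 a22 + edge13 a11 a13 a33 + edge23 a22 a23 a33)
      + 4 * face a11 a12 a13 a22 a23 a33)%N = size s.
  apply: stable_count_seq.
  - move=> p /mapP[t]; rewrite mem_filter => /andP[tc ts] ->.
    have p0 := even_point_neq0 ts.
    have [e1 e2 e3] := sign_class_entries ts.
    have ep : eigen f (pnt t) by exact: even_point_eigen.
    by split => //; exact: even_nondegenerate.
  - rewrite pairwise_map; apply: pairwise_filter.
    have : uniq sign_classes by [].
    rewrite uniq_pairwise; apply: (@sub_in_pairwise _ (mem sign_classes)).
      by move=> t u tc uc; exact: even_point_cross.
    by apply/allP.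
  - move=> v v0 ev; have [vc [k _ vk]] := even_eigen_point gen v0 ev.
    have sv0 : ~~ [&& sgz (v 0 0) == 0, sgz (v 0 1) == 0 & sgz (v 0 2) == 0].
      apply/negP; rewrite !sgz_eq0 => /and3P[/eqP h0 /eqP h1 /eqP h2].
      by case/eqP: v0; rewrite [v]vec3_eta h0 h1 h2; apply/rowP => -[[|[|[|//]]] i3]; rewrite !mxE.
    have /orP[sc|sc] := sign_classesP (sgz_in (v 0 0)) (sgz_in (v 0 1)) (sgz_in (v 0 2)) sv0.
      exists (pnt (sgz3 v)); last by exists k.
      by apply: map_f; rewrite mem_filter sc andbT.
    exists (pnt (opp_signs (sgz3 v))).
      by apply: map_f; rewrite mem_filter sc andbT even_cond_opp.
    by exists (- k); rewrite even_point_opp scalerN scaleNr opprK.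
rewrite size_map size_filter.
have -> : count cond sign_classes = count id (map cond sign_classes) by rewrite count_map.
have -> : map cond sign_classes = let e12 := edge12 a11 a12 a22 in
   let e13 := edge13 a11 a13 a33 in let e23 := edge23 a22 a23 a33 in
   let e := face a11 a12 a13 a22 a23 a33 in
  [:: true; true; true; e12; e12; e13; e13; e23; e23; e; e; e; e] by [].
by move=> /=; case: edge12; case: edge13; case: edge23; case: face.
Qed.

End even_count.

(** * From stable forms to positive volume *)

Section realization.
Context {R : realType}.
Implicit Types (c g : 'rV[R]_15) (a : arrangement).

Lemma zero_locus_quartic_of c : zero_locus (quartic_of c) = zeroset c.
Proof.
rewrite /zero_locus (image_proj_point (fun v => eval_at (quartic_of c) v = 0)).
by apply/seteqP; split => x /= [v [? ? ?]]; exists v; split => //;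
  rewrite ?eval_quartic_of // -eval_quartic_of.
Qed.

Lemma eigenpoints_quartic_of c : eigenpoints (quartic_of c) = eigenset c.
Proof.
rewrite /eigenpoints (image_proj_point (fun v => exists lambda : R, forall i : 'I_3,
  eval_at (mpoly.mderiv i (quartic_of c)) v = lambda * v 0 i)).
apply/seteqP; split => x /= [v [? [l e] ?]]; exists v; split => //; exists l.
  by apply/rowP => i; rewrite -eval_mderiv_quartic_of e !mxE.
by move=> i; rewrite eval_mderiv_quartic_of e !mxE.
Qed.

Definition oval_arrangement a c :=
  exists O : 'I_(nb_ovals a) -> set (RP2 R),
    [/\ forall i, oval (O i), trivIset setT O, zeroset c = \bigcup_i O i &
    match a with
    | TwoNested => forall i j, i != j -> nested (O i) (O j)
    | TwoNonNested => forall i j, i != j -> ~ nested (O i) (O j)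
    | _ => True
    end].

Definition realized a t :=
  positive_volume [set f : quartic R | has_ovals a f /\ (eigenpoints f #= `I_t)%card].

Lemma realizedP a t c : (\forall d \near c, d != 0 /\ oval_arrangement a d) ->
  (\forall d \near c, (eigenset d #= `I_t)%card) -> realized a t.
Proof.
move=> ovals eigs; apply: (@positive_volume_nbhs R _ c).
near=> d; have [d0 [U [U1 U2 U3 U4]]] : d != 0 /\ oval_arrangement a d by near: d.
split; last by rewrite eigenpoints_quartic_of; near: d.
exists U; split => //; split => //; last by rewrite zero_locus_quartic_of.
by apply/eqP => /eq_quartic_of0 e; rewrite e eqxx in d0.
Unshelve. all: by end_near. Qed.

Definition norm4 : 'rV[R]_15 := even_form 1 1 1 1 1 1.

Lemma ev_norm4 v : ev norm4 v = dotp v v ^+ 2.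
Proof. by rewrite ev_even /dotp /=; ring. Qed.

Lemma ev_deform g e v : ev (g - e *: norm4) v = ev g v - e * ev norm4 v.
Proof.
rewrite /ev /qform /cf !mxE; move: (v 0 0) (v 0 1) (v 0 2) => x y z.
ring.
Qed.

Lemma cts_line (g n : 'rV[R]_15) (x : R) :
  {for x, continuous (fun e : R => g - e *: n)}.
Proof.
apply: (@cts_mx R _ 0 14) => i j.
suff -> : (fun e : R => (g - e *: n) i j) = (fun e => g i j + - (e * n i j)) by cts.
by apply/funext => e; rewrite !mxE.
Qed.

(** Subtracting a small multiple of |v|^4 from a nonnegative form opens an oval
    around each of its zeros. *)
Lemma realized_psd a t g (s : seq 'rV[R]_3) : a <> TwoNested -> size s = nb_ovals a ->
  (forall v, 0 <= ev g v) ->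
  {in s, forall p, [/\ p != 0, ev g p = 0 & nondegenerate_eigen g p]} ->
  pairwise (fun p q => cross p q != 0) s ->
  (forall v, v != 0 -> ev g v = 0 -> exists2 p, p \in s & exists k, v = k *: p) ->
  (\forall c \near g, (eigenset c #= `I_t)%card) -> realized a t.
Proof.
move=> aN sa g0 sP sC sE eigs.
have sn (i : 'I_(nb_ovals a)) : s`_i \in s by rewrite mem_nth// sa.
have stable : \forall c \near g, (forall i : 'I_(nb_ovals a), ev c s`_i < 0) ->
    exists U : 'I_(nb_ovals a) -> set (RP2 R),
      [/\ forall i, oval (U i), trivIset setT U, zeroset c = \bigcup_i U i &
        forall i j, i != j -> ~ nested (U i) (U j)].
  apply: (@stable_ovals R _ (fun i => s`_i) g g0).
  - by move=> i; have [] := sP _ (sn i).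
  - by move=> i j; exact: pairwise_cross.
  - by move=> i; have [] := sP _ (sn i).
  - move=> v v0 /(sE v v0)[p ps [k vk]].
    have i3 : (index p s < nb_ovals a)%N by rewrite -sa index_mem.
    by exists (Ordinal i3), k; rewrite /= nth_index.
  - by move=> i; have [] := sP _ (sn i).
have near_ovals : \forall c \near g, (forall i : 'I_(nb_ovals a), ev c s`_i < 0) ->
    oval_arrangement a c.
  apply: filterS stable => c st /st[U [U1 U2 U3 U4]].
  exists U; split => //; move: aN U U4 {U1 U2 U3}.
  by case: (a) => // aN; case: aN.
pose h (e : R) := g - e *: norm4.
have hg : h @ (0 : R) --> g.
  have : {for (0 : R), continuous h} := @cts_line g norm4 0.
  by have -> : g = h 0 by rewrite /h scale0r subr0.
have nearby (W : set 'rV[R]_15) : (\forall c \near g, W c) ->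
    \forall e \near (0 : R)^'+, \forall c \near h e, W c.
  by move=> /nbhs_interior /hg Wh; apply: (@filterS _ (nbhs (0 : R)) _ _ _ _ Wh) => e eW _.
have [e e0 [eo ee]] : exists2 e, 0 < e & (\forall c \near h e,
   (forall i : 'I_(nb_ovals a), ev c s`_i < 0) -> oval_arrangement a c) /\
   (\forall c \near h e, (eigenset c #= `I_t)%card).
  have : \forall e \near (0 : R)^'+, 0 < e by exact: nbhs_right_gt.
  move=> /filterI/(_ (nearby _ near_ovals))/filterI/(_ (nearby _ eigs)).
  by move=> /filter_ex[e [[e0 eo] ee]]; exists e.
apply: (@realizedP a t (h e)) => //.
have neg_i (i : 'I_(nb_ovals a)) : \forall c \near h e, ev c s`_i < 0.
  have ei : ev (h e) s`_i < 0.
    have [p0 p1 _] := sP _ (sn i).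
    rewrite /h ev_deform p1 sub0r oppr_lt0 mulr_gt0// ev_norm4 exprn_gt0//.
    exact: dotpp_gt0.
  apply: (@cts_lt R _ (fun c => ev c s`_i) (fun=> 0)) => //; last exact: cts_cst.
  apply: (@cts_ev R _ (fun c => c) (fun=> s`_i)); [exact: cvg_id|exact: cts_cst].
have neg := @filter_forall _ _ _ (nbhs (h e)) (nbhs_filter (h e)) neg_i.
near=> c.
have oc : oval_arrangement a c.
  have : forall i : 'I_(nb_ovals a), ev c s`_i < 0 by near: c.
  by near: c.
split => //; apply/eqP => c0.
(* the zero form has no negative value and vanishes everywhere *)
have [n0|n0] := posnP (nb_ovals a).
  have [U [_ _ /seteqP[zU _] _]] := oc.
  have [|[i i3] _ _] := zU (pt (vec3 1 0 0)).
    exists (vec3 1 0 0); split => //; last first.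
      by rewrite c0 /ev /qform /cf !mxE; ring.
    by apply/eqP => /rowP/(_ 0); rewrite !mxE /= => /eqP; rewrite oner_eq0.
  by rewrite n0 in i3.
have : ev c s`_(Ordinal n0) < 0 by move: (Ordinal n0); near: c.
by rewrite c0 /ev /qform /cf !mxE !mul0r !addr0 ltxx.
Unshelve. all: by end_near. Qed.

End realization.
Arguments realized R a t : clear implicits.

(** The criterion for nested ovals in the frame e3, e1, e2. *)
Lemma realized_nested (R : realType) t (c : 'rV[R]_15) : 0 < ev c (vec3 0 0 1) ->
  (forall x y : R, x ^+ 2 + y ^+ 2 = 1 ->
    [/\ `|grad c (vec3 x y 0) 0 2| < ev c (vec3 x y 0),
        `|grad c (vec3 x y 0) 0 2| < ev c (vec3 0 0 1) & ev c (vec3 x y 1) < 0]) ->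
  (\forall d \near c, (eigenset d #= `I_t)%card) -> realized R TwoNested t.
Proof.
move=> c0 H; pose B : 'M[R]_3 := rows3 (vec3 0 0 1) (vec3 1 0 0) (vec3 0 1 0).
have rB := @row_rows3 R (vec3 0 0 1) (vec3 1 0 0) (vec3 0 1 0).
have Bu : B \in unitmx.
  apply: rows3_unit => x y z /rowP h; have := h 0; have := h 1; have := h 2.
  by rewrite !mxE /= => h2 h1 h0; do ![split]; lra.
have BP : nested_cond c B.
  split; first by rewrite rB.
  move=> w w1; rewrite affE /dir !rB.
  have -> : w.1 *: vec3 1 0 0 + w.2 *: vec3 0 1 0 = vec3 w.1 w.2 0.
    by apply/rowP => -[[|[|[|//]]] k3]; rewrite !mxE /=; ring.
  have -> : vec3 0 0 1 + w.1 *: vec3 1 0 0 + w.2 *: vec3 0 1 0 = vec3 w.1 w.2 1.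
    by apply/rowP => -[[|[|[|//]]] k3]; rewrite !mxE /=; ring.
  have {}/H[h1 h2 h3] : w.1 ^+ 2 + w.2 ^+ 2 = 1.
    have := congr1 (fun x => x ^+ 2) w1.
    by rewrite /enorm sqr_sqrtr ?expr1n // addr_ge0 ?sqr_ge0.
  have -> : dotp (grad c (vec3 w.1 w.2 0)) (vec3 0 0 1) = grad c (vec3 w.1 w.2 0) 0 2.
    by rewrite /dotp !vec3E !mulr0 !add0r mulr1.
  by split.
apply: realizedP; have := nested_cond_near Bu BP; apply: filterS => d dB.
split; last by have [U [? ? ? ?]] := nested_ovals Bu dB; exists U.
by case: dB => + _; apply: contraTneq => ->; rewrite /ev /qform /cf !mxE !mul0r !addr0 ltxx.
Qed.

(** * Families of even quartics *)

(** Integral data: the classification of the eigenpoints of an even form is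
    decided by computation. *)
Section integral_even_forms.
Context (a11 a12 a13 a22 a23 a33 : int).

Let w1 := a22 * a33 - a23 ^+ 2 - a12 * (a33 - a23) - a13 * (a22 - a23).
Let w2 := a11 * a33 - a13 ^+ 2 - a12 * (a33 - a13) - a23 * (a11 - a13).
Let w3 := a11 * a22 - a12 ^+ 2 - a13 * (a22 - a12) - a23 * (a11 - a12).

Definition int_generic := [&& a11 != a12, a22 != a12, a11 != a13, a33 != a13 &
  [&& a22 != a23, a33 != a23, w1 != 0, w2 != 0 & w3 != 0]].

Definition int_count : nat :=
  3 + 2 * ((0 < (a11 - a12) * (a22 - a12))%R + (0 < (a11 - a13) * (a33 - a13))%R
           + (0 < (a22 - a23) * (a33 - a23))%R) + 4 * ((0 < w1 * w2)%R && (0 < w1 * w3)%R).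

Context (R : realType).

Definition int_form : 'rV[R]_15 :=
  even_form a11%:~R a12%:~R a13%:~R a22%:~R a23%:~R a33%:~R.

Lemma int_even_generic : int_generic ->
  @even_generic R a11%:~R a12%:~R a13%:~R a22%:~R a23%:~R a33%:~R.
Proof.
move=> /and5P[? ? ? ? /and5P[? ? h1 h2 h3]]; split.
- by rewrite !eqr_int; apply/and3P.
- by rewrite !eqr_int; apply/and3P.
- by rewrite -!(intrM, intrB, rmorphXn) /= !intr_eq0 h1 h2 h3.
Qed.

Lemma int_form_count : int_generic ->
  \forall c \near int_form, (eigenset c #= `I_int_count)%card.
Proof.
move=> /int_even_generic/even_count.
rewrite /edge12 /edge13 /edge23 /face -?rmorphXn /=.
by rewrite -!(intrM, intrB, rmorphXn) /= !ltr0z.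
Qed.

Lemma ev_int_form (v : 'rV[R]_3) : let X := v 0 0 ^+ 2 in let Y := v 0 1 ^+ 2 in
  let Z := v 0 2 ^+ 2 in ev int_form v =
  a11%:~R * X ^+ 2 + a22%:~R * Y ^+ 2 + a33%:~R * Z ^+ 2
  + 2 * a12%:~R * (X * Y) + 2 * a13%:~R * (X * Z) + 2 * a23%:~R * (Y * Z).
Proof. exact: ev_even. Qed.

Lemma realized_even_psd a (s : seq 'rV[R]_3) : int_generic -> a <> TwoNested ->
  size s = nb_ovals a -> (forall v, 0 <= ev int_form v) ->
  {in s, forall p, p != 0 /\ ev int_form p = 0} ->
  pairwise (fun p q => cross p q != 0) s ->
  (forall v, v != 0 -> ev int_form v = 0 -> exists2 p, p \in s & exists k, v = k *: p) ->
  realized R a int_count.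
Proof.
move=> gen aN sa g0 sP sC sE; apply: (@realized_psd R a int_count int_form s) => //.
  move=> p ps; have [p0 ep] := sP p ps; split => //.
  apply: even_nondegenerate => //; first exact: int_even_generic.
  by exists 0; rewrite scale0r; exact: psd_grad0.
exact: int_form_count.
Qed.

End integral_even_forms.

Section nonnegative_coefficients.
Context (R : realType).
Implicit Types v : 'rV[R]_3.

Lemma vec3_eq0 v : v 0 0 = 0 -> v 0 1 = 0 -> v 0 2 = 0 -> v = 0.
Proof.
move=> h0 h1 h2; rewrite [v]vec3_eta h0 h1 h2.
by apply/rowP => -[[|[|[|//]]] i3]; rewrite !mxE.
Qed.

Lemma vec3_neq0 (x y z : R) : [|| x != 0, y != 0 | z != 0] -> vec3 x y z != 0.
Proof.
apply: contraTneq => /rowP e; have := e 0; have := e 1; have := e 2.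
by rewrite !mxE /= => -> -> ->; rewrite eqxx.
Qed.

Lemma crossE (x y z x' y' z' : R) : cross (vec3 x y z) (vec3 x' y' z') =
  vec3 (y * z' - z * y') (z * x' - x * z') (x * y' - y * x').
Proof. by rewrite /cross !vec3E. Qed.

Lemma scale_vec3 (k x y z : R) : k *: vec3 x y z = vec3 (k * x) (k * y) (k * z).
Proof. by apply/rowP => -[[|[|[|//]]] i3]; rewrite !mxE. Qed.

Context (a11 a12 a13 a22 a23 a33 : int).
Let f := int_form a11 a12 a13 a22 a23 a33 R.
Let t := int_count a11 a12 a13 a22 a23 a33.
Context (gen : int_generic a11 a12 a13 a22 a23 a33).
Context (ge0 : [&& 0 <= a11, 0 <= a12, 0 <= a13, 0 <= a22 & (0 <= a23) && (0 <= a33)]).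

Let terms v : exists t1 t2 t3 t4 t5 t6, [/\ ev f v = t1 + t2 + t3 + t4 + t5 + t6,
  [/\ t1 = a11%:~R * (v 0 0) ^+ 4, t2 = a22%:~R * (v 0 1) ^+ 4 & t3 = a33%:~R * (v 0 2) ^+ 4],
  [/\ t4 = 2 * a12%:~R * (v 0 0 * v 0 1) ^+ 2, t5 = 2 * a13%:~R * (v 0 0 * v 0 2) ^+ 2
    & t6 = 2 * a23%:~R * (v 0 1 * v 0 2) ^+ 2],
  [/\ 0 <= t1, 0 <= t2 & 0 <= t3] & [/\ 0 <= t4, 0 <= t5 & 0 <= t6]].
Proof.
have p4 (x : R) : 0 <= x ^+ 4 by rewrite -[4%N]/(2 * 2)%N exprM sqr_ge0.
have := ge0; rewrite -!(ler0z R) => /and5P[h1 h2 h3 h4 /andP[h5 h6]].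
do 6 eexists; split; [|by split; reflexivity|by split; reflexivity|split|split].
- by rewrite ev_int_form /=; ring.
- by rewrite mulr_ge0.
- by rewrite mulr_ge0.
- by rewrite mulr_ge0.
- by rewrite mulr_ge0 ?sqr_ge0// mulr_ge0.
- by rewrite mulr_ge0 ?sqr_ge0// mulr_ge0.
- by rewrite mulr_ge0 ?sqr_ge0// mulr_ge0.
Qed.

Lemma int_form_ge0 v : 0 <= ev f v.
Proof.
by have [? [? [? [? [? [? [-> _ _ [? ? ?] [? ? ?]]]]]]]] := terms v; rewrite !addr_ge0.
Qed.

Let term_eq0 (n : int) (m : nat) (x : R) : 0 < n -> n%:~R * x ^+ m = 0 -> x = 0.
Proof.
move=> n0 /eqP; rewrite mulf_eq0 intr_eq0 gt_eqF//= expf_eq0 => /andP[_ /eqP//].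
Qed.

Let term2_eq0 (n : int) (m : nat) (x : R) : 0 < n -> 2 * n%:~R * x ^+ m = 0 -> x = 0.
Proof.
move=> n0; rewrite -mulrA => /eqP; rewrite mulf_eq0 pnatr_eq0 => /eqP; exact: term_eq0.
Qed.

Lemma int_form_eq0 v : ev f v = 0 ->
  [/\ 0 < a11 -> v 0 0 = 0, 0 < a22 -> v 0 1 = 0, 0 < a33 -> v 0 2 = 0 &
      0 < a12 -> v 0 0 * v 0 1 = 0].
Proof.
have [t1 [t2 [t3 [t4 [t5 [t6 [-> [e1 e2 e3] [e4 e5 e6] [? ? ?] [? ? ?]]]]]]]] := terms v.
move=> e0; have z1 : t1 = 0 by lra.
have z2 : t2 = 0 by lra.
have z3 : t3 = 0 by lra.
have z4 : t4 = 0 by lra.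
split=> n0.
- by apply: (@term_eq0 _ 4 _ n0); rewrite -e1.
- by apply: (@term_eq0 _ 4 _ n0); rewrite -e2.
- by apply: (@term_eq0 _ 4 _ n0); rewrite -e3.
- by apply: (@term2_eq0 _ 2 _ n0); rewrite -e4.
Qed.

(** A form with nonnegative coefficients is a sum of nonnegative monomials: its zeros are
    the coordinate points at which the corresponding diagonal entry vanishes. *)
Lemma realized_no_oval : [&& 0 < a11, 0 < a22 & 0 < a33] -> realized R NoOval t.
Proof.
move=> /and3P[p1 p2 p3]; apply: (realized_even_psd (s := [::])) => //.
  exact: int_form_ge0.
move=> v v0 /int_form_eq0[/(_ p1) x0 /(_ p2) y0 /(_ p3) z0 _].
by case/eqP: v0; exact: vec3_eq0.
Qed.

Lemma realized_one_oval : [&& a11 == 0, 0 < a22 & 0 < a33] -> realized R OneOval t.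
Proof.
move=> /and3P[/eqP p1 p2 p3]; apply: (realized_even_psd (s := [:: vec3 1 0 0])) => //.
- exact: int_form_ge0.
- move=> p; rewrite inE => /eqP ->; rewrite vec3_neq0 ?oner_neq0//; split => //.
  by rewrite ev_int_form !vec3E p1 /=; ring.
- move=> v v0 /int_form_eq0[_ /(_ p2) y0 /(_ p3) z0 _].
  exists (vec3 1 0 0); rewrite ?inE//; exists (v 0 0).
  by rewrite scale_vec3 {1}[v]vec3_eta y0 z0 mulr1 mulr0.
Qed.

Lemma realized_two_non_nested : [&& a11 == 0, a22 == 0, 0 < a33 & 0 < a12] ->
  realized R TwoNonNested t.
Proof.
move=> /and4P[/eqP p1 /eqP p2 p3 p4].
apply: (realized_even_psd (s := [:: vec3 1 0 0; vec3 0 1 0])) => //.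
- exact: int_form_ge0.
- by move=> p; rewrite !inE => /orP[] /eqP ->; rewrite vec3_neq0 ?oner_neq0 ?orbT//;
    split => //; rewrite ev_int_form !vec3E p1 p2 /=; ring.
- by rewrite /= andbT crossE vec3_neq0// !(mul0r, mulr0, subr0, mulr1) oner_neq0 !orbT.
- move=> v v0 /int_form_eq0[_ _ /(_ p3) z0 /(_ p4) /eqP]; rewrite mulf_eq0.
  case/orP => /eqP e0; [exists (vec3 0 1 0)|exists (vec3 1 0 0)]; rewrite ?inE ?eqxx ?orbT//;
    [exists (v 0 1)|exists (v 0 0)];
    by rewrite scale_vec3 {1}[v]vec3_eta e0 z0 mulr1 mulr0.
Qed.

End nonnegative_coefficients.

(** Three ovals, around the zeros of the form with p and q positive,
    4 (y^2 - z^2)^2 + 2 x^2 (p y^2 + q z^2). *)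
Lemma realized_three_ovals (R : realType) (p q : int) :
  int_generic 0 p q 4 (-4) 4 -> 0 < p -> 0 < q ->
  realized R ThreeOvals (int_count 0 p q 4 (-4) 4).
Proof.
move=> gen p0 q0; have P0 : 0 < p%:~R :> R by rewrite ltr0z.
have Q0 : 0 < q%:~R :> R by rewrite ltr0z.
pose f := int_form 0 p q 4 (-4) 4 R.
have fE (v : 'rV[R]_3) : ev f v = 4 * (v 0 1 ^+ 2 - v 0 2 ^+ 2) ^+ 2 +
    2 * (p%:~R * (v 0 0 * v 0 1) ^+ 2 + q%:~R * (v 0 0 * v 0 2) ^+ 2).
  by rewrite ev_int_form /=; ring.
have pge (v : 'rV[R]_3) : 0 <= p%:~R * (v 0 0 * v 0 1) ^+ 2 by rewrite mulr_ge0 ?sqr_ge0// ltW.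
have qge (v : 'rV[R]_3) : 0 <= q%:~R * (v 0 0 * v 0 2) ^+ 2 by rewrite mulr_ge0 ?sqr_ge0// ltW.
apply: (realized_even_psd (s := [:: vec3 1 0 0; vec3 0 1 1; vec3 0 1 (-1)])) => //.
- move=> v; rewrite -[int_form _ _ _ _ _ _ _]/f fE.
  have hp := pge v; have hq := qge v; have hs := sqr_ge0 (v 0 1 ^+ 2 - v 0 2 ^+ 2).
  by lra.
- by move=> v; rewrite !inE => /or3P[] /eqP ->; rewrite vec3_neq0 ?oner_neq0 ?orbT//;
    split => //; rewrite -[int_form _ _ _ _ _ _ _]/f fE !vec3E; ring.
- rewrite /= !andbT !crossE -?andbA; apply/and3P; split; apply: vec3_neq0; apply/or3P.
  + by apply: Or33; rewrite !(mul0r, mulr0, subr0, mulr1) oner_neq0.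
  + by apply: Or33; rewrite !(mul0r, mulr0, subr0, mulr1) oner_neq0.
  + by apply: Or31; apply/eqP; lra.
- move=> v v0; rewrite -[int_form _ _ _ _ _ _ _]/f fE => e0.
  have hp := pge v; have hq := qge v; have hs := sqr_ge0 (v 0 1 ^+ 2 - v 0 2 ^+ 2).
  have /eqP : (v 0 1 ^+ 2 - v 0 2 ^+ 2) ^+ 2 = 0 by lra.
  have /eqP : p%:~R * (v 0 0 * v 0 1) ^+ 2 = 0 by lra.
  rewrite mulf_eq0 (gt_eqF P0) orFb sqrf_eq0 mulf_eq0 sqrf_eq0 subr_eq0 eqf_sqr.
  move=> /orP[/eqP x0|/eqP y0] /orP[] /eqP yz.
  + exists (vec3 0 1 1); rewrite ?inE ?eqxx ?orTb ?orbT//; exists (v 0 1).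
    by rewrite scale_vec3 {1}[v]vec3_eta x0 -yz mulr1 mulr0.
  + exists (vec3 0 1 (-1)); rewrite ?inE ?eqxx ?orTb ?orbT//; exists (v 0 1).
    by rewrite scale_vec3 {1}[v]vec3_eta x0 yz mulrN1 opprK mulr1 mulr0.
  + exists (vec3 1 0 0); rewrite ?inE ?eqxx ?orTb ?orbT//; exists (v 0 0).
    by rewrite scale_vec3 {1}[v]vec3_eta -yz y0 mulr1 mulr0.
  + exists (vec3 1 0 0); rewrite ?inE ?eqxx ?orTb ?orbT//; exists (v 0 0).
    rewrite scale_vec3 {1}[v]vec3_eta mulr1 mulr0 y0; congr vec3.
    by apply/eqP; rewrite -oppr_eq0 -yz y0.
Qed.

(** Four ovals, around the zeros of (x^2 - y^2 + k^2 z^2)^2 + 2 x^2 z^2. *)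
Lemma realized_four_ovals (R : realType) (k : int) : k != 0 ->
  int_generic 1 (-1) (k ^+ 2 + 1) 1 (- k ^+ 2) (k ^+ 4) ->
  realized R FourOvals (int_count 1 (-1) (k ^+ 2 + 1) 1 (- k ^+ 2) (k ^+ 4)).
Proof.
move=> k0 gen; have K0 : k%:~R != 0 :> R by rewrite intr_eq0.
pose f := int_form 1 (-1) (k ^+ 2 + 1) 1 (- k ^+ 2) (k ^+ 4) R.
have fE (v : 'rV[R]_3) : ev f v = (v 0 0 ^+ 2 - v 0 1 ^+ 2 + (k%:~R * v 0 2) ^+ 2) ^+ 2 +
    2 * (v 0 0 * v 0 2) ^+ 2.
  by rewrite ev_int_form /= mulrNz rmorphD !rmorphXn /=; ring.
move: (k%:~R : R) K0 fE => K K0 fE.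
apply: (realized_even_psd (s := [:: vec3 1 1 0; vec3 1 (-1) 0; vec3 0 K 1; vec3 0 (- K) 1])) => //.
- move=> v; rewrite -[int_form _ _ _ _ _ _ _]/f fE.
  have hp := sqr_ge0 (v 0 0 * v 0 2).
  have hs := sqr_ge0 (v 0 0 ^+ 2 - v 0 1 ^+ 2 + (K * v 0 2) ^+ 2).
  by lra.
- by move=> v; rewrite !inE => /or4P[] /eqP ->; rewrite vec3_neq0 ?oner_neq0 ?orbT//;
    split => //; rewrite -[int_form _ _ _ _ _ _ _]/f fE !vec3E; ring.
- rewrite /= !andbT !crossE -!andbA.
  apply/andP; split; first by apply: vec3_neq0; apply/or3P/Or33/eqP; lra.
  do 4 (apply/andP; split; first by apply: vec3_neq0; apply/or3P/Or32/eqP; lra).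
  by apply: vec3_neq0; apply/or3P/Or31; apply: contra K0 => /eqP e0; apply/eqP; lra.
- move=> v v0; rewrite -[int_form _ _ _ _ _ _ _]/f fE => e0.
  have hp := sqr_ge0 (v 0 0 * v 0 2).
  have hs := sqr_ge0 (v 0 0 ^+ 2 - v 0 1 ^+ 2 + (K * v 0 2) ^+ 2).
  have /eqP : (v 0 0 ^+ 2 - v 0 1 ^+ 2 + (K * v 0 2) ^+ 2) ^+ 2 = 0 by lra.
  have /eqP : (v 0 0 * v 0 2) ^+ 2 = 0 by lra.
  rewrite !sqrf_eq0 mulf_eq0 => /orP[/eqP x0|/eqP z0]; [rewrite x0|rewrite z0].
    rewrite expr0n /= sub0r addrC subr_eq0 eqf_sqr => /orP[] /eqP yz.
      exists (vec3 0 K 1); rewrite ?inE ?eqxx ?orTb ?orbT//; exists (v 0 2).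
      by rewrite scale_vec3 {1}[v]vec3_eta x0 mulr0 mulr1 mulrC yz.
    exists (vec3 0 (- K) 1); rewrite ?inE ?eqxx ?orTb ?orbT//; exists (v 0 2).
    by rewrite scale_vec3 {1}[v]vec3_eta x0 mulr0 mulr1 mulrN mulrC yz opprK.
  rewrite mulr0 expr0n /= addr0 subr_eq0 eqf_sqr => /orP[] /eqP xy.
    exists (vec3 1 1 0); rewrite ?inE ?eqxx ?orTb ?orbT//; exists (v 0 0).
    by rewrite scale_vec3 {1}[v]vec3_eta z0 mulr0 mulr1 xy.
  exists (vec3 1 (-1) 0); rewrite ?inE ?eqxx ?orTb ?orbT//; exists (v 0 0).
  by rewrite scale_vec3 {1}[v]vec3_eta z0 mulr0 mulr1 mulrN1 xy opprK.
Qed.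

Lemma realized_two_nested (R : realType) (a11 a12 a13 a22 a23 a33 : int) :
  int_generic a11 a12 a13 a22 a23 a33 ->
  [&& 0 < a11, 0 <= a12, 0 < a22 & 0 < a33] ->
  [&& a11 + 2 * a13 + a33 < 0, a22 + 2 * a23 + a33 < 0 & a12 + a13 + a23 + a33 < 0] ->
  realized R TwoNested (int_count a11 a12 a13 a22 a23 a33).
Proof.
move=> gen; rewrite -!(ltr0z R) -(ler0z R) => /and4P[p1 p2 p3 p4].
rewrite -!(ltrz0 R) !intrD !intrM => /and3P[n1 n2 n3].
apply: (@realized_nested R _ (int_form a11 a12 a13 a22 a23 a33 R)).
- by rewrite ev_int_form !vec3E /= expr0n /= expr1n; lra.
- move=> x y xy; rewrite grad_even !vec3E /= !(mulr0, mul0r) normr0 !ev_int_form !vec3E /=.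
  have X0 := sqr_ge0 x; have Y0 := sqr_ge0 y.
  move: (x ^+ 2) (y ^+ 2) X0 Y0 xy => X Y X0 Y0 XY.
  move: (a11%:~R : R) (a12%:~R : R) (a13%:~R : R) (a22%:~R : R) (a23%:~R : R)
    (a33%:~R : R) p1 p2 p3 p4 n1 n2 n3 => A B C D E F p1 p2 p3 p4 n1 n2 n3.
  (* both inequalities become linear in the Bernstein monomials of X + Y = 1 *)
  have [P [Q [S [P0 Q0 S0 PS [eX eY e1]]]]] : exists P Q S : R, [/\ 0 <= P, 0 <= Q, 0 <= S,
      0 < P + S & [/\ P = X ^+ 2, S = Y ^+ 2 & Q = X * Y]].
    exists (X ^+ 2), (X * Y), (Y ^+ 2); split; rewrite ?sqr_ge0 ?mulr_ge0//.
    have := sqr_ge0 (X - Y); have : (X + Y) ^+ 2 = 1 by rewrite XY expr1n.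
    by rewrite sqrrD sqrrB; lra.
  have XE : X = P + Q by rewrite eX e1 expr2 -mulrDr XY mulr1.
  have YE : Y = S + Q by rewrite eY e1 expr2 [X * Y]mulrC -mulrDr [Y + X]addrC XY mulr1.
  have one : P + 2 * Q + S = 1 by rewrite XE YE in XY; lra.
  have [AP DS BQ] : [/\ 0 <= A * P, 0 <= D * S & 0 <= B * Q].
    by split; apply: mulr_ge0 => //; exact: ltW.
  have pos (k l : R) : 0 < k -> 0 < l -> 0 < k * P + l * S.
    move=> k1 l1; have [Pz|Pn] := eqVneq P 0.
      by rewrite Pz mulr0 add0r mulr_gt0//; lra.
    by apply: ltr_pwDl; [rewrite mulr_gt0// lt0r Pn|rewrite mulr_ge0// ltW].
  split; rewrite -?eX -?eY -?e1.
  + by have := pos _ _ p1 p3; lra.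
  + by rewrite !expr0n expr1n /=; lra.
  + rewrite !expr1n !mulr1; have h := pos (- (A + 2 * C + F)) (- (D + 2 * E + F)).
    have {}h : 0 < - (A + 2 * C + F) * P + - (D + 2 * E + F) * S by apply: h; lra.
    have q : 0 <= - (B + C + E + F) * Q by rewrite mulr_ge0//; lra.
    have -> : F = F * (P + 2 * Q + S) by rewrite one mulr1.
    by rewrite XE YE; lra.
- exact: int_form_count.
Qed.

Section critical_points.
Context {R : realType}.
Implicit Types (c : 'rV[R]_15) (p d v : 'rV[R]_3).

Lemma nondegenerate_at c p l : p != 0 -> grad c p = l *: p ->
  (forall d m, hess c p d = l *: d + m *: p -> cross p d = 0) ->
  [/\ p != 0, eigen c p & nondegenerate_eigen c p].
Proof.
move=> p0 gp h; split => //; first by exists l.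
move=> l' gp' d m; have -> : l' = l.
  have /eqP : (l' - l) *: p = 0 by rewrite scalerBl -gp -gp' subrr.
  by rewrite scaler_eq0 (negbTE p0) orbF subr_eq0 => /eqP.
by move=> /h/(cross_eq0P _ p0).
Qed.

Lemma eigen_coord c v : eigen c v -> exists l, [/\ grad c v 0 0 = l * v 0 0,
  grad c v 0 1 = l * v 0 1 & grad c v 0 2 = l * v 0 2].
Proof. by move=> [l e]; exists l; rewrite e !mxE. Qed.

Lemma vec3_inj (x y z x' y' z' : R) : vec3 x y z = vec3 x' y' z' ->
  [/\ x = x', y = y' & z = z'].
Proof.
by move=> /rowP e; have := e 0; have := e 1; have := e 2; rewrite !mxE /= => -> -> ->.
Qed.

Lemma add_vec3 (x y z x' y' z' : R) :
  vec3 x y z + vec3 x' y' z' = vec3 (x + x') (y + y') (z + z').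
Proof. by apply/rowP => -[[|[|[|//]]] i3]; rewrite !mxE. Qed.

Lemma definite_eq0 (a b e x z : R) : 0 < a -> b ^+ 2 < 4 * a * e ->
  a * x ^+ 2 + b * (x * z) + e * z ^+ 2 = 0 -> x = 0 /\ z = 0.
Proof.
move=> a0 D e0; have h : (2 * a * x + b * z) ^+ 2 + (4 * a * e - b ^+ 2) * z ^+ 2 = 0.
  transitivity (4 * a * (a * x ^+ 2 + b * (x * z) + e * z ^+ 2)); first by ring.
  by rewrite e0 mulr0.
have D0 : 0 < 4 * a * e - b ^+ 2 by rewrite subr_gt0.
move/eqP: h; rewrite paddr_eq0 ?sqr_ge0 ?(mulr_ge0 (ltW D0)) ?sqr_ge0//.
rewrite sqrf_eq0 mulf_eq0 sqrf_eq0 (gt_eqF D0) orFb => /andP[/eqP + /eqP z0].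
rewrite z0 mulr0 addr0 => /eqP; rewrite !mulf_eq0 (gt_eqF a0) pnatr_eq0 => /eqP ->.
by [].
Qed.

Lemma sqr_cases (s y k : R) : 0 <= s -> y ^+ 2 = s * k ^+ 2 ->
  y = k * Num.sqrt s \/ y = k * (- Num.sqrt s).
Proof.
move=> s0 e; have : y ^+ 2 = (k * Num.sqrt s) ^+ 2.
  by rewrite exprMn sqr_sqrtr// mulrC.
by move/eqP; rewrite eqf_sqr mulrN => /orP[/eqP|/eqP]; [left|right].
Qed.

Lemma vec3_0 (x y z : R) : x = 0 -> y = 0 -> z = 0 -> vec3 x y z = 0.
Proof. by move=> -> -> ->; apply/rowP => -[[|[|[|//]]] i3]; rewrite !mxE. Qed.

End critical_points.

(** Nondegeneracy at a rational eigenvector for the eigenvalue l. *)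
Ltac rational_point gradf hessf l :=
  let a := fresh "a" in let b := fresh "b" in let e := fresh "e" in
  let d := fresh "d" in let m := fresh "m" in
  let h1 := fresh "h" in let h2 := fresh "h" in let h3 := fresh "h" in
  apply: (@nondegenerate_at _ _ _ l);
  [by apply: vec3_neq0; apply/or3P;
    first [by apply: Or31; apply/eqP; lra|by apply: Or32; apply/eqP; lra
          |by apply: Or33; apply/eqP; lra]
  |by rewrite gradf scale_vec3; congr vec3; ring
  |move=> d m; rewrite [d]vec3_eta hessf !scale_vec3 add_vec3 crossE;
   move: (d 0 0) (d 0 1) (d 0 2) => a b e /vec3_inj[h1 h2 h3]; apply: vec3_0; lra].

(** The same at an eigenvector whose coordinate y is the square root of a rational
    number S: the equations are linear in a, y b, e and m once the middle one is
    multiplied by y. *)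
Ltac sqrt_point gradf hessf l y y0 yy :=
  let a := fresh "a" in let b := fresh "b" in let e := fresh "e" in
  let d := fresh "d" in let m := fresh "m" in let ye := fresh "ye" in
  let h1 := fresh "h" in let h2 := fresh "h" in let h3 := fresh "h" in
  apply: (@nondegenerate_at _ _ _ l);
  [by apply: vec3_neq0; apply/or3P/Or32
  |by rewrite gradf scale_vec3 yy; congr vec3; ring
  |move=> d m; rewrite [d]vec3_eta hessf !scale_vec3 add_vec3 crossE;
   move: (d 0 0) (d 0 1) (d 0 2) => a b e; rewrite yy => /vec3_inj[h1 h2 h3];
   have ye t : y * (y * t) = y ^+ 2 * t by [rewrite mulrA];
   have := congr1 (fun t => y * t) h2; have := ye a; have := ye e; have := ye m;
   rewrite yy => ? ? ? ?;
   apply: vec3_0; [apply: (mulfI y0); lra|lra|apply: (mulfI y0); lra]].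

Ltac pairwise_points :=
  rewrite /= ?andbT !crossE -?andbA;
  repeat (apply/andP; split);
  apply: vec3_neq0; apply/or3P;
  first [by apply: Or31; apply/eqP; lra|by apply: Or32; apply/eqP; lra
          |by apply: Or33; apply/eqP; lra].

Ltac member := rewrite ?inE ?eqxx ?orTb ?orbT.

(** * Three quartics that are even in one variable only *)

(** The form (x^2 - 4 z^2)^2 + (3 x + 5 z)^2 y^2 + x^2 y^2, with three zeros
    and only seven eigenpoints. *)
Section three_ovals.
Context (R : realType).
Implicit Types (d v : 'rV[R]_3).

Let f : 'rV[R]_15 := coefs [:: 1; 0; 0; 10; 0; - 8; 0; 30; 0; 0; 0; 0; 25; 0; 16].

Let fE v : let x := v 0 0 in let y := v 0 1 in let z := v 0 2 in
  ev f v = (x ^+ 2 - 4 * z ^+ 2) ^+ 2 + (((3 * x + 5 * z) * y) ^+ 2 + (x * y) ^+ 2).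
Proof. by rewrite /ev /qform !cf_coefs //=; ring. Qed.

Let gradf x y z : grad f (vec3 x y z) =
  vec3 (4 * x ^+ 3 + 20 * (x * y ^+ 2) - 16 * (x * z ^+ 2) + 30 * (y ^+ 2 * z))
       (y * (20 * x ^+ 2 + 60 * (x * z) + 50 * z ^+ 2))
       (- 16 * (x ^+ 2 * z) + 30 * (x * y ^+ 2) + 50 * (y ^+ 2 * z) + 64 * z ^+ 3).
Proof.
rewrite [LHS]vec3_eta !mxE /= /qx /qy /qz !cf_coefs //=.
by congr vec3; ring.
Qed.

Let hessf x y z a b e : hess f (vec3 x y z) (vec3 a b e) =
  vec3 ((12 * x ^+ 2 + 20 * y ^+ 2 - 16 * z ^+ 2) * a + (40 * x + 60 * z) * (y * b)
        + (- 32 * (x * z) + 30 * y ^+ 2) * e)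
       ((40 * x + 60 * z) * (y * a) + (20 * x ^+ 2 + 60 * (x * z) + 50 * z ^+ 2) * b
        + (60 * x + 100 * z) * (y * e))
       ((- 32 * (x * z) + 30 * y ^+ 2) * a + (60 * x + 100 * z) * (y * b)
        + (- 16 * x ^+ 2 + 50 * y ^+ 2 + 192 * z ^+ 2) * e).
Proof.
rewrite /hess /dgrad /cubics /divdiff !cf_coefs //= !vec3E.
by congr vec3; ring.
Qed.

Let zeros : seq 'rV[R]_3 := [:: vec3 2 0 1; vec3 (- 2) 0 1; vec3 0 1 0].
Let r : R := Num.sqrt 56.
Let points : seq 'rV[R]_3 := zeros ++ [:: vec3 1 0 0; vec3 0 0 1; vec3 (- 7) r 4; vec3 (- 7) (- r) 4].

Let r0 : 0 < r. Proof. by rewrite sqrtr_gt0. Qed.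
Let rr : r ^+ 2 = 56. Proof. by rewrite sqr_sqrtr. Qed.

Let point_sqrt y : y != 0 -> y ^+ 2 = 56 -> [/\ vec3 (- 7) y 4 != 0, eigen f (vec3 (- 7) y 4)
  & nondegenerate_eigen f (vec3 (- 7) y 4)].
Proof.
by move=> y0 yy; sqrt_point gradf hessf (100 : R) y y0 yy.
Qed.

Let pointsP : {in points, forall p, [/\ p != 0, eigen f p & nondegenerate_eigen f p]}.
Proof.
move=> p; rewrite /points !inE => /or4P[| | |/or4P[]] /eqP ->.
- by rational_point gradf hessf (0 : R).
- by rational_point gradf hessf (0 : R).
- by rational_point gradf hessf (0 : R).
- by rational_point gradf hessf (4 : R).
- by rational_point gradf hessf (64 : R).
- by apply: point_sqrt; rewrite ?rr// gt_eqF.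
- by apply: point_sqrt; rewrite ?sqrrN ?rr// oppr_eq0 gt_eqF.
Qed.

Let pairwise_f : pairwise (fun p q => cross p q != 0) points.
Proof. have := r0; rewrite /points; move: r => s s0; by pairwise_points. Qed.

Let eigen_f v : v != 0 -> eigen f v -> exists2 p, p \in points & exists k, v = k *: p.
Proof.
move=> v0 /eigen_coord[l]; rewrite [v]vec3_eta gradf !vec3E => -[].
move: (v 0 0) (v 0 1) (v 0 2) => x y z .
have [y0|y0] := eqVneq y 0.
  rewrite y0 expr0n /= => h1 _ h3.
  have /eqP : x * (z * ((x - 2 * z) * (x + 2 * z))) = 0.
    have : l * x * z = l * z * x by ring.
    by rewrite -h1 -h3; lra.
  rewrite !mulf_eq0 => /or4P[] /eqP e.
  - exists (vec3 0 0 1); first by member.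
    by exists z; rewrite e scale_vec3 mulr0 mulr1.
  - exists (vec3 1 0 0); first by member.
    by exists x; rewrite e scale_vec3 mulr0 mulr1.
  - exists (vec3 2 0 1); first by member.
    by exists z; rewrite scale_vec3; congr vec3; lra.
  - exists (vec3 (-2) 0 1); first by member.
    by exists z; rewrite scale_vec3; congr vec3; lra.
move=> h1 h2 h3; have {h2} lE : l = 20 * x ^+ 2 + 60 * (x * z) + 50 * z ^+ 2.
  by apply: (mulfI y0); rewrite h2 mulrC.
(* eliminating y^2 from these two equations leaves a binary quartic in x and z *)
have k1 : y ^+ 2 * (20 * x + 30 * z) = 16 * x ^+ 3 + 60 * (x ^+ 2 * z) + 66 * (x * z ^+ 2).
  by move: h1; rewrite lE; lra.
have k2 : y ^+ 2 * (30 * x + 50 * z) = 36 * (x ^+ 2 * z) + 60 * (x * z ^+ 2) - 14 * z ^+ 3.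
  by move: h3; rewrite lE; lra.
have Y0 : 0 < y ^+ 2 by rewrite lt0r sqrf_eq0 y0 sqr_ge0.
have /eqP : (2 * x + z) * ((4 * x + 7 * z) * (60 * x ^+ 2 + 100 * (x * z) + 60 * z ^+ 2)) = 0.
  transitivity ((16 * x ^+ 3 + 60 * (x ^+ 2 * z) + 66 * (x * z ^+ 2)) * (30 * x + 50 * z)
    - (36 * (x ^+ 2 * z) + 60 * (x * z ^+ 2) - 14 * z ^+ 3) * (20 * x + 30 * z)); first by ring.
  by rewrite -k1 -k2; ring.
have origin : x = 0 -> z = 0 -> exists2 p, p \in points & exists k, vec3 x y z = k *: p.
  move=> x0 z0; exists (vec3 0 1 0); first by member.
  by exists y; rewrite x0 z0 scale_vec3 mulr0 mulr1.
rewrite !mulf_eq0 => /or3P[] /eqP e.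
- (* y^2 = - 4 x^2 on this line *)
  have zE : z = - 2 * x by lra.
  have [x0|x0] := eqVneq x 0; first by apply: origin; rewrite // zE x0 mulr0.
  have : x * y ^+ 2 = x * (- 4 * x ^+ 2) by move: k1; rewrite zE; lra.
  by move=> /(mulfI x0) yx; have := sqr_ge0 x; lra.
- have [k [xE zE]] : exists k, x = k * (- 7) /\ z = k * 4 by exists (z / 4); split; lra.
  have [k0|k0] := eqVneq k 0; first by apply: origin; rewrite ?xE ?zE k0 mul0r.
  have : k * y ^+ 2 = k * (56 * k ^+ 2) by move: k1; rewrite xE zE; lra.
  move=> /(mulfI k0) /sqr_cases[] // yE.
    by exists (vec3 (- 7) r 4); [member|exists k; rewrite xE zE yE scale_vec3].
  by exists (vec3 (- 7) (- r) 4); [member|exists k; rewrite xE zE yE scale_vec3].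
- have d1 : 0 < 60 :> R by lra.
  have d2 : 100 ^+ 2 < 4 * 60 * 60 :> R by lra.
  by have [x0 z0] := definite_eq0 d1 d2 e; exact: origin.
Qed.

Lemma realized_three_ovals_7 : realized R ThreeOvals 7.
Proof.
apply: (@realized_psd R ThreeOvals 7 f zeros) => //.
- by move=> v; rewrite fE /= !addr_ge0 ?sqr_ge0.
- move=> p pz; have [p0 _ pn] := pointsP (mem_subseq (prefix_subseq _ _) pz).
  split => //; move: pz; rewrite !inE => /or3P[] /eqP ->; rewrite fE !vec3E; ring.
- by have := pairwise_f; rewrite pairwise_cat => /and3P[].
- move=> v _ /eqP; rewrite fE /= !paddr_eq0 ?addr_ge0 ?sqr_ge0//.
  rewrite !sqrf_eq0 !mulf_eq0 => /and3P[/eqP xz yz xy]; rewrite [v]vec3_eta.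
  move: (v 0 0) (v 0 1) (v 0 2) xz yz xy => x y z xz yz xy.
  have [y0|y0] := eqVneq y 0.
    have /eqP : (x - 2 * z) * (x + 2 * z) = 0 by rewrite -xz; ring.
    rewrite mulf_eq0 => /orP[] /eqP e.
      by exists (vec3 2 0 1); [member|exists z; rewrite scale_vec3 y0; congr vec3; lra].
    by exists (vec3 (- 2) 0 1); [member|exists z; rewrite scale_vec3 y0; congr vec3; lra].
  move: yz xy; rewrite (negbTE y0) !orbF => /eqP yz /eqP x0.
  exists (vec3 0 1 0); first by member.
  by exists y; rewrite scale_vec3 x0 mulr0 mulr1; congr vec3; lra.
- exact: (stable_count_seq pointsP pairwise_f eigen_f).
Qed.
End three_ovals.

(** The form (x^2 + y^2 - 4 z^2)^2 + 16 y^2 (x - z)^2, with four zeros and nine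
    eigenpoints. *)
Section four_ovals.
Context (R : realType).
Implicit Types (d v : 'rV[R]_3).

Let f : 'rV[R]_15 := coefs [:: 1; 0; 0; 18; 0; - 8; 0; - 32; 0; 0; 1; 0; 8; 0; 16].

Let fE v : let x := v 0 0 in let y := v 0 1 in let z := v 0 2 in
  ev f v = (x ^+ 2 + y ^+ 2 - 4 * z ^+ 2) ^+ 2 + (4 * (y * (x - z))) ^+ 2.
Proof. by rewrite /ev /qform !cf_coefs //=; ring. Qed.

Let gradf x y z : grad f (vec3 x y z) =
  vec3 (4 * x ^+ 3 + 36 * (x * y ^+ 2) - 16 * (x * z ^+ 2) - 32 * (y ^+ 2 * z))
       (y * (36 * x ^+ 2 - 64 * (x * z) + 4 * y ^+ 2 + 16 * z ^+ 2))
       (- 16 * (x ^+ 2 * z) - 32 * (x * y ^+ 2) + 16 * (y ^+ 2 * z) + 64 * z ^+ 3).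
Proof.
rewrite [LHS]vec3_eta !mxE /= /qx /qy /qz !cf_coefs //=.
by congr vec3; ring.
Qed.

Let hessf x y z a b e : hess f (vec3 x y z) (vec3 a b e) =
  vec3 ((12 * x ^+ 2 + 36 * y ^+ 2 - 16 * z ^+ 2) * a + (72 * x - 64 * z) * (y * b)
        + (- 32 * (x * z) - 32 * y ^+ 2) * e)
       ((72 * x - 64 * z) * (y * a)
        + (36 * x ^+ 2 - 64 * (x * z) + 12 * y ^+ 2 + 16 * z ^+ 2) * b
        + (- 64 * x + 32 * z) * (y * e))
       ((- 32 * (x * z) - 32 * y ^+ 2) * a + (- 64 * x + 32 * z) * (y * b)
        + (- 16 * x ^+ 2 + 16 * y ^+ 2 + 192 * z ^+ 2) * e).
Proof.
rewrite /hess /dgrad /cubics /divdiff !cf_coefs //= !vec3E.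
by congr vec3; ring.
Qed.

Let r : R := Num.sqrt 3.
Let zeros : seq 'rV[R]_3 := [:: vec3 2 0 1; vec3 (- 2) 0 1; vec3 1 r 1; vec3 1 (- r) 1].
Let points : seq 'rV[R]_3 := zeros ++
  [:: vec3 1 0 0; vec3 0 1 0; vec3 0 0 1; vec3 3 r 2; vec3 3 (- r) 2].

Let r0 : 0 < r. Proof. by rewrite sqrtr_gt0. Qed.
Let rr : r ^+ 2 = 3. Proof. by rewrite sqr_sqrtr. Qed.

Let point_zero y : y != 0 -> y ^+ 2 = 3 -> [/\ vec3 1 y 1 != 0, eigen f (vec3 1 y 1)
  & nondegenerate_eigen f (vec3 1 y 1)].
Proof. by move=> y0 yy; sqrt_point gradf hessf (0 : R) y y0 yy. Qed.

Let point_other y : y != 0 -> y ^+ 2 = 3 -> [/\ vec3 3 y 2 != 0, eigen f (vec3 3 y 2)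
  & nondegenerate_eigen f (vec3 3 y 2)].
Proof. by move=> y0 yy; sqrt_point gradf hessf (16 : R) y y0 yy. Qed.

Let pointsP : {in points, forall p, [/\ p != 0, eigen f p & nondegenerate_eigen f p]}.
Proof.
have [rn nn] : r != 0 /\ - r != 0 by rewrite oppr_eq0 gt_eqF.
have nr : (- r) ^+ 2 = 3 by rewrite sqrrN rr.
move=> p; rewrite /points !inE => /or4P[| | |/or4P[| | |/or3P[]]] /eqP ->.
- by rational_point gradf hessf (0 : R).
- by rational_point gradf hessf (0 : R).
- exact: point_zero.
- exact: point_zero.
- by rational_point gradf hessf (4 : R).
- by rational_point gradf hessf (4 : R).
- by rational_point gradf hessf (64 : R).
- exact: point_other.
- exact: point_other.
Qed.

Let pairwise_f : pairwise (fun p q => cross p q != 0) points.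
Proof. have := r0; rewrite /points /zeros; move: r => s s0; by pairwise_points. Qed.

Let eigen_f v : v != 0 -> eigen f v -> exists2 p, p \in points & exists k, v = k *: p.
Proof.
move=> v0 /eigen_coord[l]; rewrite [v]vec3_eta gradf !vec3E => -[].
move: (v 0 0) (v 0 1) (v 0 2) => x y z.
have [y0|y0] := eqVneq y 0.
  rewrite y0 expr0n /= => h1 _ h3.
  have /eqP : x * (z * ((x - 2 * z) * (x + 2 * z))) = 0.
    have : l * x * z = l * z * x by ring.
    by rewrite -h1 -h3; lra.
  rewrite !mulf_eq0 => /or4P[] /eqP e.
  - exists (vec3 0 0 1); first by member.
    by exists z; rewrite e scale_vec3 mulr0 mulr1.
  - exists (vec3 1 0 0); first by member.
    by exists x; rewrite e scale_vec3 mulr0 mulr1.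
  - exists (vec3 2 0 1); first by member.
    by exists z; rewrite scale_vec3; congr vec3; lra.
  - exists (vec3 (-2) 0 1); first by member.
    by exists z; rewrite scale_vec3; congr vec3; lra.
move=> h1 h2 h3.
have {h2} lE : l = 36 * x ^+ 2 - 64 * (x * z) + 4 * y ^+ 2 + 16 * z ^+ 2.
  by apply: (mulfI y0); rewrite h2 mulrC.
have k1 : (x - z) * (y ^+ 2 - x * (x - z)) = 0 by move: h1; rewrite lE; lra.
have k2 : y ^+ 2 * (- 8 * x + 3 * z) = 13 * (x ^+ 2 * z) - 16 * (x * z ^+ 2) - 12 * z ^+ 3.
  by move: h3; rewrite lE; lra.
have sn : 0 <= 3 :> R by [].
have [xz|xz] := eqVneq (x - z) 0.
  have {}xz : x = z by apply/eqP; rewrite -subr_eq0 xz.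
  have [z0|z0] := eqVneq z 0.
    exists (vec3 0 1 0); first by member.
    by exists y; rewrite xz z0 scale_vec3 mulr0 mulr1.
  have /(mulfI z0) : z * y ^+ 2 = z * (3 * z ^+ 2) by move: k2; rewrite xz; lra.
  move=> /(sqr_cases sn)[] yE.
    by exists (vec3 1 r 1); [member|exists z; rewrite xz yE scale_vec3 mulr1].
  by exists (vec3 1 (- r) 1); [member|exists z; rewrite xz yE scale_vec3 mulr1].
have yy : y ^+ 2 = x * (x - z).
  by apply/eqP; rewrite -subr_eq0; apply/eqP; apply: (mulfI xz); rewrite k1 mulr0.
have /eqP : (2 * x - 3 * z) * (4 * x ^+ 2 + 7 * (x * z) + 4 * z ^+ 2) = 0.
  by move: k2; rewrite yy; lra.
rewrite mulf_eq0 => /orP[] /eqP e.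
  have [k [xE zE]] : exists k, x = k * 3 /\ z = k * 2 by exists (z / 2); split; lra.
  have : y ^+ 2 = 3 * k ^+ 2 by rewrite yy xE zE; ring.
  move=> /(sqr_cases sn)[] yE.
    by exists (vec3 3 r 2); [member|exists k; rewrite xE zE yE scale_vec3].
  by exists (vec3 3 (- r) 2); [member|exists k; rewrite xE zE yE scale_vec3].
have d1 : 0 < 4 :> R by lra.
have d2 : 7 ^+ 2 < 4 * 4 * 4 :> R by lra.
by have [x0 z0] := definite_eq0 d1 d2 e; rewrite x0 z0 subrr eqxx in xz.
Qed.

Lemma realized_four_ovals_9 : realized R FourOvals 9.
Proof.
apply: (@realized_psd R FourOvals 9 f zeros) => //.
- by move=> v; rewrite fE /= !addr_ge0 ?sqr_ge0.
- move=> p pz; have [p0 _ pn] := pointsP (mem_subseq (prefix_subseq _ _) pz).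
  split => //; move: pz; rewrite !inE => /or4P[] /eqP ->; rewrite fE !vec3E ?sqrrN ?rr; ring.
- by have := pairwise_f; rewrite pairwise_cat => /and3P[].
- move=> v _ /eqP; rewrite fE /= !paddr_eq0 ?addr_ge0 ?sqr_ge0//.
  rewrite !sqrf_eq0 !mulf_eq0 pnatr_eq0 orFb => /andP[/eqP e yxz]; rewrite [v]vec3_eta.
  move: (v 0 0) (v 0 1) (v 0 2) e yxz => x y z e /orP[] /eqP e'.
    have /eqP : (x - 2 * z) * (x + 2 * z) = 0 by rewrite -e e'; ring.
    rewrite mulf_eq0 => /orP[] /eqP e2.
      by exists (vec3 2 0 1); [member|exists z; rewrite scale_vec3 e'; congr vec3; lra].
    by exists (vec3 (- 2) 0 1); [member|exists z; rewrite scale_vec3 e'; congr vec3; lra].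
  have xz : x = z by apply/eqP; rewrite -subr_eq0 e'.
  have sn : 0 <= 3 :> R by [].
  have : y ^+ 2 = 3 * z ^+ 2 by move: e; rewrite xz; lra.
  move=> /(sqr_cases sn)[] yE.
    by exists (vec3 1 r 1); [member|exists z; rewrite xz yE scale_vec3 mulr1].
  by exists (vec3 1 (- r) 1); [member|exists z; rewrite xz yE scale_vec3 mulr1].
- exact: (stable_count_seq pointsP pairwise_f eigen_f).
Qed.

End four_ovals.

(** The form 50 |v|^4 - 443 z^2 (x^2 + y^2) + 190 x z^3 + 7 x^2 |v|^2. The first two terms are
    invariant under rotation about the z-axis, with two nested circles as zero set and
    whole circles of eigenpoints; the last terms break the symmetry and leave five
    eigenpoints. *)
Section two_nested_ovals.
Context (R : realType).
Implicit Types (d v : 'rV[R]_3).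

Let f : 'rV[R]_15 := coefs [:: 57; 0; 0; 107; 0; - 336; 0; 0; 0; 190; 50; 0; - 343; 0; 50].

Let fE x y z : ev f (vec3 x y z) = 57 * x ^+ 4 + 107 * (x * y) ^+ 2 + 50 * y ^+ 4
  - (336 * x ^+ 2 + 343 * y ^+ 2) * z ^+ 2 + 190 * (x * z ^+ 3) + 50 * z ^+ 4.
Proof. by rewrite /ev /qform !cf_coefs // !vec3E /=; ring. Qed.

Let gradf x y z : grad f (vec3 x y z) =
  vec3 (228 * x ^+ 3 + 214 * (x * y ^+ 2) - 672 * (x * z ^+ 2) + 190 * z ^+ 3)
       (y * (214 * x ^+ 2 + 200 * y ^+ 2 - 686 * z ^+ 2))
       (- 672 * (x ^+ 2 * z) - 686 * (y ^+ 2 * z) + 200 * z ^+ 3 + 570 * (x * z ^+ 2)).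
Proof.
rewrite [LHS]vec3_eta !mxE /= /qx /qy /qz !cf_coefs //=.
by congr vec3; ring.
Qed.

Let hessf x y z a b e : hess f (vec3 x y z) (vec3 a b e) =
  vec3 ((684 * x ^+ 2 + 214 * y ^+ 2 - 672 * z ^+ 2) * a + 428 * (x * y * b)
        + (- 1344 * (x * z) + 570 * z ^+ 2) * e)
       (428 * (x * y * a) + (214 * x ^+ 2 + 600 * y ^+ 2 - 686 * z ^+ 2) * b
        - 1372 * (y * z * e))
       ((- 1344 * (x * z) + 570 * z ^+ 2) * a - 1372 * (y * z * b)
        + (- 672 * x ^+ 2 - 686 * y ^+ 2 + 600 * z ^+ 2 + 1140 * (x * z)) * e).
Proof.
rewrite /hess /dgrad /cubics /divdiff !cf_coefs //= !vec3E.
by congr vec3; ring.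
Qed.

Let points : seq 'rV[R]_3 := [:: vec3 1 0 0; vec3 0 1 0; vec3 1 0 5; vec3 (- 5) 0 6; vec3 19 0 15].

Let pointsP : {in points, forall p, [/\ p != 0, eigen f p & nondegenerate_eigen f p]}.
Proof.
move=> p; rewrite /points !inE => /or4P[| | |/orP[]] /eqP ->.
- by rational_point gradf hessf (228 : R).
- by rational_point gradf hessf (200 : R).
- by rational_point gradf hessf (71 * 100 + 78 : R).
- by rational_point gradf hessf (- (267 * 100) : R).
- by rational_point gradf hessf (- (351 * 100 + 42) : R).
Qed.

Let pairwise_f : pairwise (fun p q => cross p q != 0) points.
Proof. by pairwise_points. Qed.

Let eigen_f v : v != 0 -> eigen f v -> exists2 p, p \in points & exists k, v = k *: p.
Proof.
move=> v0 /eigen_coord[l]; rewrite [v]vec3_eta gradf !vec3E => -[].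
move: (v 0 0) (v 0 1) (v 0 2) => x y z.
have [y0|y0] := eqVneq y 0.
  rewrite y0 expr0n /= => h1 _ h3.
  have /eqP : z * ((5 * x - z) * ((6 * x + 5 * z) * (15 * x - 19 * z))) = 0.
    have : l * x * z = l * z * x by ring.
    by rewrite -h1 -h3; lra.
  rewrite !mulf_eq0 => /or4P[] /eqP e.
  - exists (vec3 1 0 0); first by member.
    by exists x; rewrite e scale_vec3 mulr0 mulr1.
  - exists (vec3 1 0 5); first by member.
    by exists x; rewrite scale_vec3; congr vec3; lra.
  - exists (vec3 (- 5) 0 6); first by member.
    by exists (z / 6); rewrite scale_vec3; congr vec3; lra.
  - exists (vec3 19 0 15); first by member.
    by exists (z / 15); rewrite scale_vec3; congr vec3; lra.
move=> h1 h2 h3.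
have {h2} lE : l = 214 * x ^+ 2 + 200 * y ^+ 2 - 686 * z ^+ 2.
  by apply: (mulfI y0); rewrite h2 mulrC.
have k1 : 7 * (x * (x ^+ 2 + y ^+ 2 + z ^+ 2)) = - 95 * z ^+ 3.
  by move: h1; rewrite lE; lra.
have k2 : z * (443 * (z ^+ 2 - x ^+ 2 - y ^+ 2) + 285 * (x * z)) = 0.
  by move: h3; rewrite lE; lra.
have [z0|z0] := eqVneq z 0.
  exists (vec3 0 1 0); first by member.
  exists y; rewrite z0 scale_vec3 mulr0 mulr1; congr vec3.
  have Y0 : 0 < y ^+ 2 by rewrite lt0r sqrf_eq0 y0 sqr_ge0.
  move/eqP: k1; rewrite z0 !expr0n /= addr0 mulr0 !mulf_eq0 pnatr_eq0 orFb.
  by rewrite (gt_eqF (ltr_wpDl (sqr_ge0 x) Y0)) orbF => /eqP.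
have k3 : 443 * (z ^+ 2 - x ^+ 2 - y ^+ 2) + 285 * (x * z) = 0.
  by apply: (mulfI z0); rewrite k2 mulr0.
(* eliminating y leaves a definite quadratic form in x and z *)
have e : 1995 * x ^+ 2 + (62 * 100 + 2) * (x * z) + (420 * 100 + 85) * z ^+ 2 = 0.
  apply: (mulfI z0); rewrite mulr0.
  transitivity (7 * x * (443 * (z ^+ 2 - x ^+ 2 - y ^+ 2) + 285 * (x * z))
    + 443 * (7 * (x * (x ^+ 2 + y ^+ 2 + z ^+ 2)) + 95 * z ^+ 3)); first by ring.
  by rewrite k3 k1; ring.
have d1 : 0 < 1995 :> R by lra.
have d2 : (62 * 100 + 2) ^+ 2 < 4 * 1995 * (420 * 100 + 85) :> R by lra.
by have [_ z1] := definite_eq0 d1 d2 e; rewrite z1 eqxx in z0.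
Qed.

Lemma realized_two_nested_5 : realized R TwoNested 5.
Proof.
apply: (@realized_nested R 5 f).
- by rewrite fE !expr0n /= expr1n; lra.
- move=> x y xy; have -> : grad f (vec3 x y 0) 0 2 = 0 by rewrite gradf !vec3E; ring.
  rewrite normr0 !fE /=.
  have yE : y ^+ 2 = 1 - x ^+ 2 by lra.
  have e4 : y ^+ 4 = (1 - x ^+ 2) ^+ 2 by rewrite -yE -exprM.
  have x0 := sqr_ge0 x; have x1 : x ^+ 2 <= 1 by have := sqr_ge0 y; lra.
  have xb : x <= 1 by nra.
  rewrite !exprMn !expr0n !expr1n /= e4 yE -[x ^+ 4]/(x ^+ (2 * 2)) exprM.
  by split; [move: (x ^+ 2) x0 x1 => X ? ?; nra|lra|lra].
- exact: (stable_count_seq pointsP pairwise_f eigen_f).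
Qed.

End two_nested_ovals.

(** * All arrangements *)

Theorem proposition5p2 (R : realType) (c : arrangement) (t : nat)
  (todd : odd t)
  (tmin : (maxn 3 (2 * nb_ovals c + 1) <= t)%N) (tmax : (t <= 13)%N) :
  positive_volume
    [set f : quartic R | has_ovals c f /\ (eigenpoints f #= `I_t)%card].
Proof.
rewrite -/(realized R c t).
have : t \in [:: 3; 5; 7; 9; 11; 13]%N.
  have : (3 <= t)%N by apply: leq_trans tmin; exact: leq_maxl.
  by move: t todd tmax {tmin}; do 14 (case; first by []).
(* for the families of even forms the integers are the entries
   a11, a12, a13, a22, a23, a33 of the symmetric matrix *)
case: c tmin => tmin; rewrite !inE => /or4P[|||/or3P[]] /eqP tE;
  rewrite tE // in tmin *.
- exact: (@realized_no_oval R 1 2 2 3 4 5 isT isT isT).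
- exact: (@realized_no_oval R 1 2 2 3 1 4 isT isT isT).
- exact: (@realized_no_oval R 1 2 3 3 5 2 isT isT isT).
- exact: (@realized_no_oval R 1 3 6 2 1 2 isT isT isT).
- exact: (@realized_no_oval R 1 2 3 3 1 2 isT isT isT).
- exact: (@realized_no_oval R 1 3 3 2 1 2 isT isT isT).
- exact: (@realized_one_oval R 0 1 1 2 3 4 isT isT isT).
- exact: (@realized_one_oval R 0 1 1 2 0 3 isT isT isT).
- exact: (@realized_one_oval R 0 1 2 2 4 1 isT isT isT).
- exact: (@realized_one_oval R 0 2 5 1 0 1 isT isT isT).
- exact: (@realized_one_oval R 0 1 2 2 0 1 isT isT isT).
- exact: (@realized_one_oval R 0 2 2 1 0 1 isT isT isT).
- exact: realized_two_nested_5.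
- exact: (@realized_two_nested R 1 2 (-3) 3 (-3) 1 isT isT isT).
- exact: (@realized_two_nested R 1 0 (-4) 1 (-2) 1 isT isT isT).
- exact: (@realized_two_nested R 1 2 (-2) 3 (-3) 2 isT isT isT).
- exact: (@realized_two_nested R 1 0 (-2) 1 (-2) 1 isT isT isT).
- exact: (@realized_two_non_nested R 0 1 1 0 1 2 isT isT isT).
- exact: (@realized_two_non_nested R 0 1 1 0 3 2 isT isT isT).
- exact: (@realized_two_non_nested R 0 1 2 0 3 1 isT isT isT).
- exact: (@realized_two_non_nested R 0 5 1 0 3 2 isT isT isT).
- exact: (@realized_two_non_nested R 0 1 2 0 2 1 isT isT isT).
- exact: realized_three_ovals_7.
- exact: (@realized_three_ovals R 1 1 isT isT isT).
- exact: (@realized_three_ovals R 1 5 isT isT isT).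
- exact: (@realized_three_ovals R 5 5 isT isT isT).
- exact: realized_four_ovals_9.
- exact: (@realized_four_ovals R 2 isT isT).
- exact: (@realized_four_ovals R 1 isT isT).
Qed.
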